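(* Let $0<a\le 1$ and $z\in\mathbb{C}$ with $0<|z|\le1$. For $\sigma>0$ and $t\in\mathbb{R}$ (whenever the expressions are defined) put $f_{\sigma,a,z}(t):=\Gamma(\sigma+{\rm i}t)\,\Phi(\sigma+{\rm i}t,a,z)$ and $F_{\sigma,a,z}(t):=f_{\sigma,a,z}(t)/f_{\sigma,a,z}(0)$. (1) Let $z=1$. Then $F_{\sigma,a,1}$ is the characteristic function of a probability measure on $\mathbb{R}$ for all $0<\sigma<1$ if and only if $a\ge 1/2$. Furthermore, in that case the associated probability measure is absolutely continuous with density $$P_{\sigma,a,1}(y)=\frac{e^{y\sigma}}{f_{\sigma,a,1}(0)}\left(\frac{\exp((1-a)e^{y})}{\exp(e^{y})-1}-\frac{1}{e^{y}}\right),\qquad y\in\mathbb{R}.$$ (2) Let $z\neq 1$. Then $F_{\sigma,a,z}$ is the characteristic function of a probability measure on $\mathbb{R}$ for all $\sigma>0$ if and only if $z\in[-1,1)$ (and $z\ne0$). In that case the associated probability measure is absolutely continuous with density $$P_{\sigma,a,z}(y)=\frac{e^{y\sigma}\exp((1-a)e^{y})}{f_{\sigma,a,z}(0)\,(\exp(e^{y})-z)},\qquad y\in\mathbb{R}.$$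
   Context: For $0<a\le1$, $s=\sigma+{\rm i}t$ and $z\in\mathbb{C}$ with $0<|z|\le1$, the Hurwitz–Lerch zeta function $\Phi(s,a,z)$ is defined for $\sigma>1$ by $\Phi(s,a,z)=\sum_{n=0}^\infty z^n(n+a)^{-s}$ and is extended by analytic continuation: for $z\ne1$ it is entire in $s$, and for $z=1$ it is the Hurwitz zeta function $\zeta(s,a)$, meromorphic in $\mathbb{C}$ with only a simple pole at $s=1$. The characteristic function of a probability measure $\mu$ on $\mathbb{R}$ is $\int_{\mathbb{R}} e^{{\rm i}ty}\mu(dy)$. *)

(* Defs.v *)
From mathcomp Require Import all_boot all_order all_algebra.
From mathcomp Require Import complex.
From mathcomp Require Import all_classical all_reals all_analysis.
Import Order.TTheory GRing.Theory Num.Theory.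
Set Implicit Arguments. Unset Strict Implicit. Unset Printing Implicit Defensive.
Local Open Scope ring_scope.
Local Open Scope complex_scope.

Section HLZ.
Variable R : realType.
Local Notation C := R[i].

Definition cabs (w : C) : R := ComplexField.Normc.normc w.

Definition cexp (w : C) : C :=
  (expR (complex.Re w))%:C * ((cos (complex.Im w)) +i* (sin (complex.Im w)))%C.

Definition cpowN (b : R) (s : C) : C := cexp (- (s * (ln b)%:C)).

Definition cvgC (u : nat -> C) (l : C) : Prop :=
  forall e : R, 0 < e -> exists N : nat, forall n, (N <= n)%N -> cabs (u n - l) < e.

Definition HLZ_partial (s : C) (a : R) (z : C) (N : nat) : C :=
  \sum_(0 <= n < N) z ^+ n * cpowN (n%:R + a) s.

Definition holomorphic_at (g : C -> C) (s : C) : Prop :=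
  exists l : C, forall e : R, 0 < e -> exists d : R, 0 < d /\
    forall w : C, 0 < cabs (w - s) < d ->
      cabs ((g w - g s) / (w - s) - l) < e.

(* g is the Hurwitz-Lerch zeta function s |-> Phi(s,a,z): it is given by the
   Dirichlet series for Re s > 1 and is holomorphic on C (z <> 1) resp. on
   C \ {1} (z = 1).  By the identity theorem such a g is unique (and it exists):
   this characterizes the analytic continuation Phi(., a, z). *)
Definition is_HLZ (a : R) (z : C) (g : C -> C) : Prop :=
  (forall s : C, 1 < complex.Re s -> cvgC (HLZ_partial s a z) (g s)) /\
  (forall s : C, (z != 1) || (s != 1) -> holomorphic_at g s).

(* Euler's Gamma integral, for Re s > 0:
   Gamma(s) = int_0^oo x^(s-1) e^(-x) dx, with x^(s-1) = x^(sigma-1) e^(i t ln x) *)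
Definition cGamma (s : C) : C :=
  (Rintegral (@lebesgue_measure R) `]0, +oo[%classic
     (fun x => x `^ (complex.Re s - 1) * expR (- x) * cos (complex.Im s * ln x)))
  +i*
  (Rintegral (@lebesgue_measure R) `]0, +oo[%classic
     (fun x => x `^ (complex.Re s - 1) * expR (- x) * sin (complex.Im s * ln x))).

Definition fHLZ (g : C -> C) (sigma t : R) : C :=
  cGamma (sigma +i* t)%C * g (sigma +i* t)%C.

Definition FHLZ (g : C -> C) (sigma t : R) : C := fHLZ g sigma t / fHLZ g sigma 0.

Definition charfun (mu : probability R R) (t : R) : C :=
  (Rintegral mu setT (fun y => cos (t * y))) +i* (Rintegral mu setT (fun y => sin (t * y))).

Definition is_charfun (F : R -> C) : Prop :=
  exists mu : probability R R, forall t : R, charfun mu t = F t.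

Definition has_density (mu : probability R R) (p : R -> R) : Prop :=
  forall A : set R, measurable A ->
    mu A = (\int[@lebesgue_measure R]_(y in A) (p y)%:E)%E.

(* densities; f0 = f_{sigma,a,z}(0) (a real number in the relevant cases) *)
Definition P1 (sigma a f0 : R) (y : R) : R :=
  expR (y * sigma) / f0 *
  (expR ((1 - a) * expR y) / (expR (expR y) - 1) - 1 / expR y).

Definition P2 (sigma a f0 z : R) (y : R) : R :=
  expR (y * sigma) * expR ((1 - a) * expR y) / (f0 * (expR (expR y) - z)).

End HLZ.

(* Main.v *)
(** With [x = exp y], Euler's integral and the geometric series give, for
    [Re s > 1],
      [Gamma(s) Phi(s, a, z) = int exp(s y) exp(-a x) / (1 - z exp(-x)) dy].
    For [z <> 1] the right-hand side is holomorphic on [Re s > 0], so the formula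
    persists there by analytic continuation.  For [z = 1] one subtracts [1 / x]
    from the kernel: [int_(-oo)^0 exp((s - 1) y) dy = 1 / (s - 1)] for [Re s > 1],
    and [1 / (s - 1) = - int_0^oo exp((s - 1) y) dy] for [Re s < 1], which yields
    the kernel [exp(-a x) / (1 - exp(-x)) - 1 / x] on the strip [0 < Re s < 1].

    Hence [F_sigma] is the Fourier transform of the continuous integrable
    function [p y = exp(sigma y) k y / f_sigma(0)], where [k] is the kernel.  By
    uniqueness of Fourier transforms, a probability measure with characteristic
    function [F_sigma] has density [p], so [F_sigma] is a characteristic function
    if and only if [p >= 0].  For [z = 1] the kernel is negative when
    [a >= 1/2] because [x < 2 sinh (x / 2)], and it changes sign when [a < 1/2].
    For [z <> 1] the kernel is positive when [z] is real; conversely, if [p] is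
    real then so is [f_sigma(0) (1 - z exp(-x))] for all [x > 0], which forces
    [z] to be real.

    The identity theorem is proved without power series: if [h] is holomorphic on
    a square around [c] and vanishes near [c], apply Cauchy's formula to
    [h w ((s0 - c) / (w - c)) ^ n] and let [n] tend to infinity.  Fourier
    uniqueness is obtained by smoothing with the Poisson kernel. *)
Require Import Defs.
From HB Require Import structures.
From mathcomp Require Import all_boot all_order all_algebra.
From mathcomp Require Import complex.
From mathcomp Require Import all_classical all_reals all_analysis.
From mathcomp Require Import measurable_realfun ring lra.
Import Order.TTheory GRing.Theory Num.Theory.
Import numFieldNormedType.Exports.
Set Implicit Arguments.
Unset Strict Implicit.
Unset Printing Implicit Defensive.
Local Open Scope ring_scope.
Local Open Scope classical_set_scope.
Local Open Scope complex_scope.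

(** * Complex modulus and holomorphic functions *)

Section ComplexModulus.
Variable R : realType.
Local Notation C := R[i].
Implicit Types (w z s : C) (x y : R).

(** For [z = 1] the pole at [s = 1] lies on the way from [Re s > 1] to the strip. The continuation
    is therefore carried out off the real axis, in the upper and the lower half separately; real
    points, among them the one that normalizes [F], are recovered by continuity.

    The identity theorem uses a sign in place of the value [2 pi i]: on each edge of a square around
    [s0], the relevant real or imaginary part of [1 / (w - s0)] has a fixed sign and is bounded away
    from zero, so a small perturbation cannot have contour integral zero.

    A priori [p] is complex, and the equation at one frequency mixes the transforms of its two
    parts. Comparing [t] with [- t] separates them: the transform of the imaginary part vanishes,
    and that of the real part is the one of the measure.

    Division by zero yields zero, so [f_sigma(0) <> 0] has to be earned: from [F(0) = 1] if [F] is a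
    characteristic function, from the constant sign of the kernel otherwise. *)

Lemma cabsE w : `|w| = (cabs w)%:C.
Proof. by case: w. Qed.

Lemma cabs_ge0 w : 0 <= cabs w.
Proof. by case: w => a b; exact: sqrtr_ge0. Qed.

Lemma cabs0 : cabs (0 : C) = 0.
Proof. exact: ComplexField.Normc.normc0. Qed.

Lemma cabs1 : cabs (1 : C) = 1.
Proof. exact: ComplexField.Normc.normc1. Qed.

Lemma cabs_eq0 w : (cabs w == 0) = (w == 0).
Proof.
apply/eqP/eqP => [|->]; last exact: cabs0.
exact: ComplexField.Normc.eq0_normc.
Qed.

Lemma cabs_gt0 w : (0 < cabs w) = (w != 0).
Proof. by rewrite lt_def cabs_ge0 andbT cabs_eq0. Qed.

Lemma cabsM w z : cabs (w * z) = cabs w * cabs z.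
Proof. exact: ComplexField.Normc.normcM. Qed.

Lemma cabsV w : cabs w^-1 = (cabs w)^-1.
Proof. exact: ComplexField.Normc.normcV. Qed.

Lemma cabsX w n : cabs (w ^+ n) = cabs w ^+ n.
Proof. by elim: n => [|n IH]; rewrite ?expr0 ?cabs1// !exprS cabsM IH. Qed.

Lemma cabsN w : cabs (- w) = cabs w.
Proof. exact: normcN. Qed.

Lemma cabsB w z : cabs (w - z) = cabs (z - w).
Proof. by rewrite -cabsN opprB. Qed.

Lemma ler_cabsD w z : cabs (w + z) <= cabs w + cabs z.
Proof. exact: le_normcD. Qed.

Lemma ler_cabs_dist w z v : cabs (w - z) <= cabs (w - v) + cabs (v - z).
Proof. by apply: le_trans (ler_cabsD _ _); rewrite addrA subrK. Qed.

Lemma ler_Re_cabs w : `|complex.Re w| <= cabs w.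
Proof.
case: w => a b /=; rewrite -sqrtr_sqr ler_wsqrtr// lerDl; exact: sqr_ge0.
Qed.

Lemma ler_Im_cabs w : `|complex.Im w| <= cabs w.
Proof.
case: w => a b /=; rewrite -sqrtr_sqr ler_wsqrtr// lerDr; exact: sqr_ge0.
Qed.

Lemma cabs_sqr w : cabs w ^+ 2 = complex.Re w ^+ 2 + complex.Im w ^+ 2.
Proof. by case: w => a b /=; rewrite sqr_sqrtr// addr_ge0// sqr_ge0. Qed.

Lemma cabs_leD w : cabs w <= `|complex.Re w| + `|complex.Im w|.
Proof.
rewrite -(@ler_pXn2r _ 2)// ?nnegrE ?addr_ge0 ?normr_ge0 ?cabs_ge0//.
rewrite cabs_sqr sqrrD !real_normK ?num_real// -addrA lerD2l lerDr.
by rewrite mulrn_wge0// mulr_ge0.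
Qed.

Lemma cabs_real x : cabs x%:C = `|x|.
Proof. by rewrite /cabs /= expr0n/= addr0 sqrtr_sqr. Qed.

Lemma cabs_cis x : cabs (cos x +i* sin x) = 1.
Proof. by rewrite /cabs /= cos2Dsin2 sqrtr1. Qed.

Lemma ReD w z : complex.Re (w + z) = complex.Re w + complex.Re z.
Proof. by case: w; case: z. Qed.
Lemma ImD w z : complex.Im (w + z) = complex.Im w + complex.Im z.
Proof. by case: w; case: z. Qed.
Lemma ReN w : complex.Re (- w) = - complex.Re w.
Proof. by case: w. Qed.
Lemma ImN w : complex.Im (- w) = - complex.Im w.
Proof. by case: w. Qed.
Lemma ReM w z : complex.Re (w * z) =
  complex.Re w * complex.Re z - complex.Im w * complex.Im z.
Proof. by case: w; case: z. Qed.
Lemma ImM w z : complex.Im (w * z) =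
  complex.Re w * complex.Im z + complex.Im w * complex.Re z.
Proof. by case: w; case: z. Qed.

Lemma complex_ext w z : complex.Re w = complex.Re z ->
  complex.Im w = complex.Im z -> w = z.
Proof. by case: w z => a b [c d] /= -> ->. Qed.

Definition cE := (ReD, ImD, ReN, ImN, ReM, ImM).

End ComplexModulus.

Section Holomorphy.
Variable R : realType.
Local Notation C := R[i].
Implicit Types (f g : C -> C) (s w : C).

(** Balls of [C^o] have radii in [C]; a positive element of [C] is real, so complex and real radii
    can be exchanged. *)
Lemma ccontinuousP (f : C^o -> C^o) (s : C^o) :
  {for s, continuous f} <->
  forall e : R, 0 < e -> exists2 d : R, 0 < d &
    forall w, cabs (w - s) < d -> cabs (f w - f s) < e.
Proof.
split.
  move=> cf e e0.
  have ec0 : 0 < e%:C :> C by rewrite ltcR.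
  have nb : nbhs (f s : C^o) (ball (f s : C^o) e%:C) by apply: nbhsx_ballx.
  have {nb} := cf (ball (f s : C^o) e%:C) nb.
  rewrite /= nbhs_simpl /=. move=> /nbhs_ballP[d d0 dP].
  have dR : d = (complex.Re d)%:C.
    by move: d0; rewrite /= ltcE => /andP[/eqP di _]; apply: complex_ext.
  exists (complex.Re d); first by rewrite -ltcR -dR.
  move=> w ws.
  have : ball s d w by rewrite /ball /= -normrN opprB cabsE dR ltcR.
  by move=> /dP; rewrite /ball /= -normrN opprB cabsE ltcR.
move=> H A /nbhs_ballP[e e0 eA].
have eR : e = (complex.Re e)%:C.
  by move: e0; rewrite /= ltcE => /andP[/eqP di _]; apply: complex_ext.
have [|d d0 dP] := H (complex.Re e); first by rewrite -ltcR -eR.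
apply/nbhs_ballP; exists d%:C => /=; first by rewrite ltcR.
move=> w; rewrite /ball /= -normrN opprB cabsE ltcR => /dP wd.
by apply: eA; rewrite /ball /= -normrN opprB eR cabsE ltcR.
Qed.

(** Phrased through [C^o], the normed module of [C] over itself, so that continuity of sums,
    products and inverses is inherited. *)
Definition ccont (f : C -> C) (s : C) : Prop :=
  {for (s : C^o), continuous (f : C^o -> C^o)}.

Lemma ccontP f s : ccont f s <->
  forall e : R, 0 < e -> exists2 d : R, 0 < d &
    forall w, cabs (w - s) < d -> cabs (f w - f s) < e.
Proof. exact: ccontinuousP. Qed.

Lemma ccont_cst (k : C) s : ccont (fun=> k) s.
Proof. exact: (@cst_continuous C^o C^o k s). Qed.

Lemma ccontD f g s : ccont f s -> ccont g s -> ccont (fun w => f w + g w) s.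
Proof. move=> cf cg; exact: (@continuousD C C^o C^o f g s cf cg). Qed.

Lemma ccontM f g s : ccont f s -> ccont g s -> ccont (fun w => f w * g w) s.
Proof. move=> cf cg; exact: (@continuousM C C^o f g s cf cg). Qed.

Lemma ccontV f s : f s != 0 -> ccont f s -> ccont (fun w => (f w)^-1) s.
Proof. move=> f0 cf; exact: (@continuousV C C^o f s f0 cf). Qed.

Lemma ccont_id s : ccont id s.
Proof. exact: (@cvg_id C^o). Qed.

Arguments ccont_cst : clear implicits.
Arguments ccont_id : clear implicits.

(* Caratheodory's form of complex differentiability *)
Lemma holomorphicP f s : holomorphic_at f s <->
  exists2 phi : C -> C, ccont phi s &
    forall w, f w - f s = phi w * (w - s).
Proof.
split.
  move=> [l fl].
  exists (fun w => if w == s then l else (f w - f s) / (w - s)); last first.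
    move=> w; have [->|ws] := eqVneq w s; first by rewrite !subrr mulr0.
    by rewrite divfK// subr_eq0.
  apply/ccontP => e e0; have [d [d0 dP]] := fl _ e0.
  exists d => // w wd; rewrite eqxx.
  have [_|ws] := eqVneq w s; first by rewrite subrr cabs0.
  by apply: dP; rewrite wd cabs_gt0 subr_eq0 ws.
move=> [phi /ccontP cphi phiE]; exists (phi s) => e e0.
have [d d0 dP] := cphi _ e0; exists d; split => // w /andP[ws0 wd].
rewrite phiE mulfK; first exact: dP.
by rewrite -cabs_gt0.
Qed.

Lemma holomorphic_continuous f s : holomorphic_at f s ->
  ccont f s.
Proof.
move=> /holomorphicP[phi cphi fE].
have fE' : (fun w => f s + phi w * (w - s)) = f.
  by apply/funext => w; rewrite -fE addrC subrK.
have H : ccont (fun w => f s + phi w * (w - s)) s.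
  exact: (ccontD (ccont_cst (f s) s)
  (ccontM cphi (ccontD (ccont_id s) (ccont_cst (- s) s)))).
by rewrite fE' in H.
Qed.

Lemma holomorphic_cst (k : C) s : holomorphic_at (fun=> k) s.
Proof.
apply/holomorphicP; exists (fun=> 0); first exact: ccont_cst.
by move=> w; rewrite subrr mul0r.
Qed.

Lemma holomorphic_id s : holomorphic_at id s.
Proof.
apply/holomorphicP; exists (fun=> 1); first exact: ccont_cst.
by move=> w; rewrite mul1r.
Qed.

Lemma holomorphicD f g s : holomorphic_at f s -> holomorphic_at g s ->
  holomorphic_at (fun w => f w + g w) s.
Proof.
move=> /holomorphicP[p cp pE] /holomorphicP[q cq qE]; apply/holomorphicP.
exists (fun w => p w + q w); first exact: (ccontD cp cq).
by move=> w; rewrite mulrDl -pE -qE; ring.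
Qed.

Lemma holomorphicM f g s : holomorphic_at f s -> holomorphic_at g s ->
  holomorphic_at (fun w => f w * g w) s.
Proof.
move=> hf hg; have cg := holomorphic_continuous hg.
move: hf hg => /holomorphicP[p cp pE] /holomorphicP[q cq qE]; apply/holomorphicP.
exists (fun w => p w * g w + f s * q w).
  exact: (ccontD (ccontM cp cg) (ccontM (ccont_cst (f s) s) cq)).
by move=> w; rewrite mulrDl -mulrA [g w * _]mulrC mulrA -pE -mulrA -qE; ring.
Qed.

Lemma holomorphicN f s : holomorphic_at f s -> holomorphic_at (fun w => - f w) s.
Proof.
move=> hf; have := holomorphicM (holomorphic_cst (-1) s) hf.
by congr (holomorphic_at _ _); apply/funext => w; rewrite mulN1r.
Qed.

Lemma holomorphicB f g s : holomorphic_at f s -> holomorphic_at g s ->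
  holomorphic_at (fun w => f w - g w) s.
Proof. by move=> hf hg; apply: holomorphicD => //; exact: holomorphicN. Qed.

Lemma holomorphicX f n s : holomorphic_at f s ->
  holomorphic_at (fun w => f w ^+ n) s.
Proof.
move=> hf; elim: n => [|n IH].
  by under eq_fun do rewrite expr0; exact: holomorphic_cst.
by under eq_fun do rewrite exprS; exact: holomorphicM.
Qed.

Lemma holomorphic_near f g s (d : R) : 0 < d ->
  (forall w, cabs (w - s) < d -> f w = g w) ->
  holomorphic_at f s -> holomorphic_at g s.
Proof.
move=> d0 fg [l fl]; exists l => e e0; have [d' [d'0 fd']] := fl _ e0.
exists (Num.min d d'); split => [|w]; first by rewrite lt_min d0.
rewrite lt_min => /and3P[ws0 wd wd'].
by rewrite -fg// -(fg s) ?subrr ?cabs0//; apply: fd'; rewrite ws0.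
Qed.

(** The identity [1/f(w) - 1/f(s) = - p(w) (w - s) / (f(w) f(s))] needs [f(w) <> 0], hence holds
    only near [s]. The function [(f s)^-1 + q w * (w - s)] is differentiated instead, and it agrees
    with [1/f] near [s]. *)
Lemma holomorphicV f s : holomorphic_at f s -> f s != 0 ->
  holomorphic_at (fun w => (f w)^-1) s.
Proof.
move=> hf fs0; have cf := holomorphic_continuous hf.
have [|d d0 dP] := (ccontP f s).1 cf (cabs (f s)); first by rewrite cabs_gt0.
move: hf => /holomorphicP[p cp pE].
pose q w := (-1 * p w) * ((f w)^-1 * (f s)^-1).
have cq : ccont q s.
  exact: (ccontM (ccontM (ccont_cst (-1) s) cp)
    (ccontM (ccontV fs0 cf) (ccont_cst (f s)^-1 s))).
apply: (@holomorphic_near (fun w => (f s)^-1 + q w * (w - s)) _ _ d) => //.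
  move=> w /dP wd.
  have fw0 : f w != 0.
    by apply/eqP => fw; move: wd; rewrite fw sub0r cabsN ltxx.
  rewrite /q mulN1r mulrAC mulNr -pE; field; by rewrite fw0.
apply/holomorphicP; exists q => // w.
by rewrite subrr mulr0 addr0 addrAC subrr add0r.
Qed.

End Holomorphy.

(** * Goursat's theorem and analytic continuation *)

Section Bisection.
Variable R : realType.

(** The core of Goursat's argument, freed from integrals. One of the four quarters carries at least
    a quarter of [N]; iterating gives nested rectangles that shrink to a point. The squared
    half-perimeter also drops by exactly 4 at each step, so the local bound at that point transfers
    to the whole rectangle. *)
Lemma bisection (N : R -> R -> R -> R -> R) (x1 x2 y1 y2 : R) :
  x1 <= x2 -> y1 <= y2 ->
  (forall a b c d, x1 <= a -> a <= b -> b <= x2 -> y1 <= c -> c <= d -> d <= y2 ->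
     N a b c d <= N a ((a + b) / 2) c ((c + d) / 2) + N ((a + b) / 2) b c ((c + d) / 2) +
       N a ((a + b) / 2) ((c + d) / 2) d + N ((a + b) / 2) b ((c + d) / 2) d) ->
  (forall p q, x1 <= p <= x2 -> y1 <= q <= y2 -> forall e, 0 < e ->
     exists2 r, 0 < r & forall a b c d,
       x1 <= a -> a <= p -> p <= b -> b <= x2 ->
       y1 <= c -> c <= q -> q <= d -> d <= y2 -> b - a < r -> d - c < r ->
       N a b c d <= e * (b - a + (d - c)) ^+ 2) ->
  N x1 x2 y1 y2 <= 0.
Proof.
move=> x12 y12 Nsub Nloc.
pose val (u : (R * R) * (R * R)) := N u.1.1 u.1.2 u.2.1 u.2.2.
pose ok (u : (R * R) * (R * R)) := [/\ x1 <= u.1.1, u.1.1 <= u.1.2, u.1.2 <= x2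
  & [/\ y1 <= u.2.1, u.2.1 <= u.2.2 & u.2.2 <= y2]].
pose nxt (u v : (R * R) * (R * R)) := [/\ ok v, val u <= 4 * val v,
  [/\ u.1.1 <= v.1.1, v.1.2 <= u.1.2 & v.1.2 - v.1.1 = (u.1.2 - u.1.1) / 2] &
  [/\ u.2.1 <= v.2.1, v.2.2 <= u.2.2 & v.2.2 - v.2.1 = (u.2.2 - u.2.1) / 2]].
(* [ok u] is placed under the existential so that choice gives a total map. *)
have /choice[f fP] : forall u, exists v, ok u -> nxt u v.
  move=> [[a b] [c d]].
  have [okc|] := EM (ok ((a, b), (c, d))); last by move=> nok; exists ((a, b), (c, d)).
  have [/= xa ab bx [yc cd dy]] := okc.
  have := Nsub _ _ _ _ xa ab bx yc cd dy.
  set m := (a + b) / 2; set n := (c + d) / 2 => NN.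
  have [H1|H1] := leP (N a b c d) (4 * N a m c n).
    by exists ((a, m), (c, n)) => _; rewrite /nxt /ok /val /= /m /n; split => //;
      split; try split; lra.
  have [H2|H2] := leP (N a b c d) (4 * N m b c n).
    by exists ((m, b), (c, n)) => _; rewrite /nxt /ok /val /= /m /n; split => //;
      split; try split; lra.
  have [H3|H3] := leP (N a b c d) (4 * N a m n d).
    by exists ((a, m), (n, d)) => _; rewrite /nxt /ok /val /= /m /n; split => //;
      split; try split; lra.
  (* The other three quarters carry less than a quarter of [N] each, so this one carries more. *)
  exists ((m, b), (n, d)) => _; rewrite /nxt /ok /val /= /m /n; split => //.
  - by split; try split; lra.
  - by rewrite -/m -/n; lra.
  - by split; lra.
  - by split; lra.
pose u n := iter n f ((x1, x2), (y1, y2)).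
have ok0 : ok ((x1, x2), (y1, y2)) by rewrite /ok /=; split => //; split.
have oku n : ok (u n).
  by elim: n => [|n IH] //=; have [] := fP _ IH.
have nu n : nxt (u n) (u n.+1) by exact: fP.
have valu n : N x1 x2 y1 y2 <= 4 ^+ n * val (u n).
  elim: n => [|n IH]; first by rewrite expr0 mul1r.
  have [_ h _ _] := nu n.
  by rewrite (le_trans IH)// exprSr -mulrA ler_wpM2l// exprn_ge0.
have wu n : (u n).1.2 - (u n).1.1 = (x2 - x1) / 2 ^+ n.
  elim: n => [|n IH]; first by rewrite expr0 divr1.
  by have [_ _ [_ _ ->] _] := nu n; rewrite IH exprS invfM mulrA mulrAC.
have hu n : (u n).2.2 - (u n).2.1 = (y2 - y1) / 2 ^+ n.
  elim: n => [|n IH]; first by rewrite expr0 divr1.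
  by have [_ _ _ [_ _ ->]] := nu n; rewrite IH exprS invfM mulrA mulrAC.
have nestx n k : (u n).1.1 <= (u (n + k)%N).1.1 /\ (u (n + k)%N).1.2 <= (u n).1.2.
  elim: k => [|k [IH1 IH2]]; first by rewrite addn0.
  rewrite addnS; have [_ _ [h1 h2 _] _] := nu (n + k)%N.
  by split; [exact: le_trans h1|exact: le_trans IH2].
have nesty n k : (u n).2.1 <= (u (n + k)%N).2.1 /\ (u (n + k)%N).2.2 <= (u n).2.2.
  elim: k => [|k [IH1 IH2]]; first by rewrite addn0.
  rewrite addnS; have [_ _ _ [h1 h2 _]] := nu (n + k)%N.
  by split; [exact: le_trans h1|exact: le_trans IH2].
(* Both ends are compared with the rectangle of index [n + k], which lies in both. *)
have crossx n k : (u n).1.1 <= (u k).1.2.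
  have [h1 _] := nestx n k; have [_ h2] := nestx k n.
  have [_ h3 _ _] := oku (n + k)%N.
  by rewrite (le_trans h1)// (le_trans h3)// addnC.
have crossy n k : (u n).2.1 <= (u k).2.2.
  have [h1 _] := nesty n k; have [_ h2] := nesty k n.
  have [_ _ _ [_ h3 _]] := oku (n + k)%N.
  by rewrite (le_trans h1)// (le_trans h3)// addnC.
(* The supremum of the lower ends is a point common to all the intervals. *)
have supP (g h : nat -> R) : (forall n k, g n <= h k) ->
    exists p, forall n, g n <= p /\ p <= h n.
  move=> gh; exists (sup (range g)) => n; split.
    apply: ub_le_sup; last by exists n.
    by exists (h 0%N) => _ [k _ <-].
  by apply: ge_sup; [exists (g 0%N), 0%N|move=> _ [k _ <-]].
have [p pP] := supP _ _ crossx.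
have [q qP] := supP _ _ crossy.
rewrite leNgt; apply/negP => N0.
set D := (x2 - x1 + (y2 - y1)) ^+ 2.
have D0 : 0 <= D by exact: sqr_ge0.
(* Chosen so that [e * D] is below [N]; [D + 1] stays positive for a degenerate rectangle. *)
pose e := N x1 x2 y1 y2 / (2 * (D + 1)).
have e0 : 0 < e by rewrite divr_gt0// mulr_gt0//; lra.
have pin : x1 <= p <= x2.
  by have [h1 h2] := pP 0%N; move: h1 h2 => /= -> ->.
have qin : y1 <= q <= y2.
  by have [h1 h2] := qP 0%N; move: h1 h2 => /= -> ->.
have [r r0 rP] := Nloc _ _ pin qin _ e0.
have [n nP] : exists n, (x2 - x1) / 2 ^+ n < r /\ (y2 - y1) / 2 ^+ n < r.
  have [n hn] : exists n : nat, (x2 - x1 + (y2 - y1)) / r < 2 ^+ n.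
    have [n hn] : exists n : nat, (x2 - x1 + (y2 - y1)) / r < n%:R.
      exists (Num.bound ((x2 - x1 + (y2 - y1)) / r)).
      by apply: archi_boundP; apply: divr_ge0; [lra|exact: ltW].
    exists n; apply: (lt_le_trans hn).
    by rewrite -natrX ler_nat ltnW// ltn_expl.
  exists n; have p0 : 0 < (2 : R) ^+ n by exact: exprn_gt0.
  rewrite !ltr_pdivrMr//; move: hn; rewrite ltr_pdivrMr// => hn; split; lra.
have [h1 h2] := nP.
have [xa ab bx [yc cd dy]] := oku n.
have [pa pb] := pP n; have [qa qb] := qP n.
have := rP _ _ _ _ xa pa pb bx yc qa qb dy.
rewrite wu hu => /(_ h1 h2) hN.
have := valu n; rewrite leNgt => /negP; apply.
have : 4 ^+ n * val (u n) <= e * D.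
  have -> : e * D = 4 ^+ n * (e * ((x2 - x1) / 2 ^+ n + (y2 - y1) / 2 ^+ n) ^+ 2).
    rewrite -mulrDl exprMn -exprVn -exprM mulnC exprM /D.
    have -> : (2^-1 : R) ^+ 2 = 4^-1 by rewrite exprVn; congr (_^-1); rewrite -natrX.
    by rewrite exprVn; field; rewrite expf_neq0.
  by rewrite ler_wpM2l// exprn_ge0.
move=> /le_lt_trans; apply.
rewrite /e mulrAC ltr_pdivrMr; last by rewrite mulr_gt0//; lra.
by rewrite ltr_pM2l//; lra.
Qed.

End Bisection.

Section SegmentIntegral.
Variable R : realType.
Local Notation C := R[i].
Local Notation mu := (@lebesgue_measure R).

(** [phi] stands for the parametrization of an edge, [L] for one of the 1-Lipschitz maps [Re], [Im]
    and [cabs]. *)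
Lemma continuous_path (q : C -> C) (phi : R -> C) (L : C -> R) (x : R) :
  (forall x', cabs (phi x' - phi x) = `|x' - x|) ->
  (forall w z, `|L w - L z| <= cabs (w - z)) ->
  ccont q (phi x) -> {for x, continuous (fun x => L (q (phi x)))}.
Proof.
move=> hphi hL /ccontP cq; apply/cvgrPdistC_lt => e e0.
have [d d0 dP] := cq _ e0.
apply/nbhs_ballP; exists d => //= y; rewrite /ball /= distrC => yd.
by rewrite (le_lt_trans (hL _ _))// dP// hphi.
Qed.

Lemma integrable_segment (f : R -> R) (a b : R) :
  (forall x, a <= x <= b -> {for x, continuous f}) ->
  mu.-integrable `[a, b] (EFin \o f).
Proof.
move=> cf; apply: continuous_compact_integrable; first exact: segment_compact.
apply: continuous_in_subspaceT => x; rewrite inE /= in_itv /= => xab.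
exact: cf.
Qed.

Lemma Rintegral_segment_split (f : R -> R) (a m b : R) : a <= m -> m <= b ->
  mu.-integrable `[a, b] (EFin \o f) ->
  (\int[mu]_(x in `[a, b]) f x =
   \int[mu]_(x in `[a, m]) f x + \int[mu]_(x in `[m, b]) f x)%R.
Proof.
move=> am mb fi.
have := @Rintegral_itvB _ f (BLeft a) (BRight b) m fi; rewrite !bnd_simp => /(_ am mb).
rewrite Rintegral_itv_obnd_cbnd; first by move=> <-; rewrite addrC subrK.
by apply: integrableS fi => //; apply: subset_itvr; rewrite bnd_simp.
Qed.

Lemma Rintegral_segment_cst (a b k : R) : a <= b ->
  (\int[mu]_(x in `[a, b]) k)%R = k * (b - a).
Proof.
move=> ab; rewrite Rintegral_cst//= lebesgue_measure_itv/= lte_fin.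
by move: ab; rewrite le_eqVlt => /predU1P[->|->]; rewrite ?ltxx ?subrr.
Qed.

Lemma Rintegral_segment_le (f : R -> R) (a b k : R) : a <= b ->
  mu.-integrable `[a, b] (EFin \o f) -> (forall x, a <= x <= b -> f x <= k) ->
  (\int[mu]_(x in `[a, b]) f x)%R <= k * (b - a).
Proof.
move=> ab fi fk; rewrite -Rintegral_segment_cst//.
have ki : mu.-integrable `[a, b] (EFin \o (fun=> k)).
  by apply: integrable_segment => x _; exact: cvg_cst.
by apply: le_Rintegral => // x; rewrite /= in_itv /= => /fk.
Qed.

Lemma Rintegral_segment_ge (f : R -> R) (a b k : R) : a <= b ->
  mu.-integrable `[a, b] (EFin \o f) -> (forall x, a <= x <= b -> k <= f x) ->
  k * (b - a) <= (\int[mu]_(x in `[a, b]) f x)%R.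
Proof.
move=> ab fi fk; rewrite -Rintegral_segment_cst//.
have ki : mu.-integrable `[a, b] (EFin \o (fun=> k)).
  by apply: integrable_segment => x _; exact: cvg_cst.
by apply: le_Rintegral => // x; rewrite /= in_itv /= => /fk.
Qed.

End SegmentIntegral.

(** * Goursat's theorem on rectangles, with one exceptional point allowed *)

Section Goursat.
Variable R : realType.
Local Notation C := R[i].
Local Notation mu := (@lebesgue_measure R).
Implicit Types (q : C -> C).

(* The imaginary part of the contour integral of [q] along the boundary of the
   rectangle [[a, b] x [c, d]]; the argument below only needs imaginary parts. *)
Definition im_contour q (a b c d : R) : R :=
  ((\int[mu]_(x in `[a, b]) (complex.Im (q (x +i* c)) - complex.Im (q (x +i* d)))) +
   (\int[mu]_(y in `[c, d]) (complex.Re (q (b +i* y)) - complex.Re (q (a +i* y)))))%R.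

(** Since [dw] is [dx] on horizontal and [i dy] on vertical edges, the former contribute [Im q] and
    the latter [Re q]. Opposite edges are run through in opposite directions and are merged into one
    integrand. *)
Definition hdiff q (c d x : R) := complex.Im (q (x +i* c)) - complex.Im (q (x +i* d)).
Definition vdiff q (a b y : R) := complex.Re (q (b +i* y)) - complex.Re (q (a +i* y)).

Lemma continuous_hdiff q (c d x : R) : ccont q (x +i* c) -> ccont q (x +i* d) ->
  {for x, continuous (hdiff q c d)}.
Proof.
have hp y x' : cabs ((x' +i* y) - (x +i* y)) = `|x' - x|.
  by rewrite -cabs_real; congr cabs; apply: complex_ext; rewrite !cE /= ?subrr.
have hL (w z : C) : `|complex.Im w - complex.Im z| <= cabs (w - z).
  by rewrite -ImN -ImD ler_Im_cabs.
move=> c1 c2; apply: continuousB.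
  exact: (@continuous_path R q (fun x => x +i* c) (@complex.Im R)).
exact: (@continuous_path R q (fun x => x +i* d) (@complex.Im R)).
Qed.

Lemma continuous_vdiff q (a b y : R) : ccont q (a +i* y) -> ccont q (b +i* y) ->
  {for y, continuous (vdiff q a b)}.
Proof.
have hp x y' : cabs ((x +i* y') - (x +i* y)) = `|y' - y|.
  (* The difference is [i] times a real number, and [i] enters as [cos (pi / 2) +i* sin (pi / 2)],
     of modulus 1. *)
  rewrite -[RHS]mul1r -cabs_real -[1](@cabs_cis R (pi / 2)) -cabsM cos_pihalf sin_pihalf.
  by congr cabs; apply: complex_ext; rewrite !cE /= ?subrr; ring.
have hL (w z : C) : `|complex.Re w - complex.Re z| <= cabs (w - z).
  by rewrite -ReN -ReD ler_Re_cabs.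
move=> c1 c2; apply: continuousB.
  exact: (@continuous_path R q (fun y => b +i* y) (@complex.Re R)).
exact: (@continuous_path R q (fun y => a +i* y) (@complex.Re R)).
Qed.

Definition on_rect (P : C -> Prop) (a b c d : R) :=
  forall x y, a <= x <= b -> c <= y <= d -> P (x +i* y).

Lemma on_rectS (P : C -> Prop) (a b c d a' b' c' d' : R) :
  a' <= a -> b <= b' -> c' <= c -> d <= d' ->
  on_rect P a' b' c' d' -> on_rect P a b c d.
Proof.
move=> aa bb cc dd H x y /andP[ax xb] /andP[cy yd]; apply: H.
  by rewrite (le_trans aa)// (le_trans xb).
by rewrite (le_trans cc)// (le_trans yd).
Qed.

Lemma integrable_hdiff q (a b c d : R) : c <= d -> on_rect (ccont q) a b c d ->
  mu.-integrable `[a, b] (EFin \o hdiff q c d).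
Proof.
move=> cd cq; apply: integrable_segment => x xab.
by apply: continuous_hdiff; apply: cq; rewrite // lexx cd.
Qed.

Lemma integrable_vdiff q (a b c d : R) : a <= b -> on_rect (ccont q) a b c d ->
  mu.-integrable `[c, d] (EFin \o vdiff q a b).
Proof.
move=> ab cq; apply: integrable_segment => x xab.
by apply: continuous_vdiff; apply: cq; rewrite // lexx ab.
Qed.

Lemma im_contour_splitx q (a m b c d : R) : a <= m -> m <= b -> c <= d ->
  on_rect (ccont q) a b c d ->
  im_contour q a b c d = im_contour q a m c d + im_contour q m b c d.
Proof.
move=> am mb cd cq; have ab := le_trans am mb.
rewrite /im_contour (@Rintegral_segment_split _ (hdiff q c d) a m b)//; last first.
  exact: integrable_hdiff.
have -> : (\int[mu]_(y in `[c, d]) (complex.Re (q (b +i* y)) - complex.Re (q (a +i* y))) =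
  \int[mu]_(y in `[c, d]) (vdiff q a m y + vdiff q m b y))%R.
  by apply: eq_Rintegral => y _; rewrite /vdiff; ring.
rewrite RintegralD//; first by rewrite /hdiff /vdiff; ring.
- by apply: integrable_vdiff => //; apply: on_rectS cq.
- by apply: integrable_vdiff => //; apply: on_rectS cq.
Qed.

Lemma im_contour_splity q (a b c m d : R) : a <= b -> c <= m -> m <= d ->
  on_rect (ccont q) a b c d ->
  im_contour q a b c d = im_contour q a b c m + im_contour q a b m d.
Proof.
move=> ab cm md cq; have cd := le_trans cm md.
rewrite /im_contour (@Rintegral_segment_split _ (vdiff q a b) c m d)//; last first.
  exact: integrable_vdiff.
have -> : (\int[mu]_(x in `[a, b]) (complex.Im (q (x +i* c)) - complex.Im (q (x +i* d))) =
  \int[mu]_(x in `[a, b]) (hdiff q c m x + hdiff q m d x))%R.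
  by apply: eq_Rintegral => y _; rewrite /hdiff; ring.
rewrite RintegralD//; first by rewrite /hdiff /vdiff; ring.
- by apply: integrable_hdiff => //; apply: on_rectS cq.
- by apply: integrable_hdiff => //; apply: on_rectS cq.
Qed.

Lemma holomorphic_linear q s : holomorphic_at q s ->
  exists l : C, forall e : R, 0 < e -> exists2 r : R, 0 < r & forall w,
    cabs (w - s) < r -> cabs (q w - q s - l * (w - s)) <= e * cabs (w - s).
Proof.
move=> /holomorphicP[phi /ccontP cphi qE]; exists (phi s) => e e0.
have [r r0 rP] := cphi _ e0; exists r => // w /rP wr.
by rewrite qE -mulrBl cabsM ler_wpM2r ?cabs_ge0 ?ltW.
Qed.

(** The affine part of [q] at [p], with slope [l], contributes [- Re l * (d - c) * (b - a)] along
    the horizontal edges and the opposite along the vertical ones. Only the first-order remainder is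
    left, and it is small compared with the half-perimeter. *)
Lemma im_contour_local q (p : C) : holomorphic_at q p -> forall e : R, 0 < e ->
  exists2 r : R, 0 < r & forall a b c d : R,
    a <= complex.Re p <= b -> c <= complex.Im p <= d ->
    on_rect (ccont q) a b c d -> b - a < r -> d - c < r ->
    `|im_contour q a b c d| <= e * (b - a + (d - c)) ^+ 2.
Proof.
move=> /holomorphic_linear[l lP] e e0.
(* Each integrand is a difference of two edge values, hence the half. *)
have e2 : 0 < e / 2 by lra.
have [r r0 rP] := lP _ e2.
(* The sum of both sides, which bounds the distance to [p], has to stay below [r]. *)
exists (r / 2); first by lra.
move=> a b c d /andP[ap pb] /andP[cp pd] cq bar dcr.
have ab : a <= b by lra.
have cd : c <= d by lra.
set D := b - a + (d - c).
have bound x y : a <= x <= b -> c <= y <= d ->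
    cabs (q (x +i* y) - q p - l * ((x +i* y) - p)) <= e / 2 * D.
  move=> /andP[ax xb] /andP[cy yd].
  have hD : cabs ((x +i* y) - p) <= D.
    apply: le_trans (cabs_leD _) _; rewrite !cE /=.
    by apply: lerD; rewrite ler_norml; apply/andP; split; lra.
  apply: (@le_trans _ _ (e / 2 * cabs ((x +i* y) - p))).
    by apply: rP; apply: le_lt_trans hD _; rewrite /D; lra.
  by rewrite ler_wpM2l//; lra.
have ec : c <= c <= d by rewrite lexx.
have ed : c <= d <= d by rewrite lexx cd.
have ea : a <= a <= b by rewrite lexx.
have eb : a <= b <= b by rewrite lexx ab.
have hb x : a <= x <= b -> `|hdiff q c d x + complex.Re l * (d - c)| <= e * D.
  move=> xab; have h1 := bound _ _ xab ec; have h2 := bound _ _ xab ed.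
  have {}h1 := le_trans (ler_Im_cabs _) h1; have {}h2 := le_trans (ler_Im_cabs _) h2.
  move: h1 h2; rewrite !cE /= /hdiff !ler_norml => /andP[? ?] /andP[? ?].
  by apply/andP; split; lra.
have vb y : c <= y <= d -> `|vdiff q a b y - complex.Re l * (b - a)| <= e * D.
  move=> ycd; have h1 := bound _ _ ea ycd; have h2 := bound _ _ eb ycd.
  have {}h1 := le_trans (ler_Re_cabs _) h1; have {}h2 := le_trans (ler_Re_cabs _) h2.
  move: h1 h2; rewrite !cE /= /vdiff !ler_norml => /andP[? ?] /andP[? ?].
  by apply/andP; split; lra.
have ih := integrable_hdiff cd cq; have iv := integrable_vdiff ab cq.
have h1 : (\int[mu]_(x in `[a, b]) hdiff q c d x)%R
    <= (e * D - complex.Re l * (d - c)) * (b - a).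
  by apply: Rintegral_segment_le => // x /hb; rewrite ler_norml => /andP[? ?]; lra.
have h2 : (- (e * D) - complex.Re l * (d - c)) * (b - a) <=
    (\int[mu]_(x in `[a, b]) hdiff q c d x)%R.
  by apply: Rintegral_segment_ge => // x /hb; rewrite ler_norml => /andP[? ?]; lra.
have h3 : (\int[mu]_(x in `[c, d]) vdiff q a b x)%R
    <= (e * D + complex.Re l * (b - a)) * (d - c).
  by apply: Rintegral_segment_le => // x /vb; rewrite ler_norml => /andP[? ?]; lra.
have h4 : (- (e * D) + complex.Re l * (b - a)) * (d - c) <=
    (\int[mu]_(x in `[c, d]) vdiff q a b x)%R.
  by apply: Rintegral_segment_ge => // x /vb; rewrite ler_norml => /andP[? ?]; lra.
have -> : e * D ^+ 2 = e * D * (b - a) + e * D * (d - c) by rewrite /D; ring.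
rewrite /im_contour -/(hdiff q c d) -/(vdiff q a b) ler_norml.
move: h1 h2 h3 h4; rewrite /hdiff /vdiff.
set I1 := Rintegral _ _ _; set I2 := Rintegral _ _ _ => h1 h2 h3 h4.
have E : complex.Re l * (d - c) * (b - a) = complex.Re l * (b - a) * (d - c) by ring.
by apply/andP; split; lra.
Qed.

Theorem goursat q (a b c d : R) : a <= b -> c <= d ->
  on_rect (holomorphic_at q) a b c d -> im_contour q a b c d = 0.
Proof.
move=> ab cd hq.
have cq : on_rect (ccont q) a b c d.
  by move=> x y xab ycd; apply: holomorphic_continuous; exact: hq.
apply/eqP; rewrite -normr_le0.
apply: (@bisection _ (fun a b c d => `|im_contour q a b c d|)) => //.
- move=> a' b' c' d' aa ab' bb cc cd' dd.
  set m := (a' + b') / 2; set n := (c' + d') / 2.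
  have [am mb cn nd] : [/\ a' <= m, m <= b', c' <= n & n <= d'].
    by rewrite /m /n; split; lra.
  have cq' : on_rect (ccont q) a' b' c' d' by apply: on_rectS cq.
  rewrite (im_contour_splity ab' cn nd cq').
  rewrite (im_contour_splitx am mb cn); last first.
    by apply: on_rectS cq' => //; exact: lexx.
  rewrite (im_contour_splitx am mb nd); last first.
    by apply: on_rectS cq' => //; exact: lexx.
  rewrite addrA (le_trans (ler_normD _ _))// lerD2r.
  by rewrite (le_trans (ler_normD _ _))// lerD2r ler_normD.
- move=> x y xab ycd e e0.
  have [r r0 rP] := im_contour_local (hq _ _ xab ycd) e0.
  exists r => // a' b' c' d' h1 h2 h3 h4 h5 h6 h7 h8 h9 h10.
  apply: rP => //=; rewrite ?h2 ?h3 ?h6 ?h7//.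
  by apply: on_rectS cq.
Qed.

(** A small square of half-side [k] is cut out around the exceptional point. The four surrounding
    rectangles contribute zero by [goursat], the square at most [8 * M * k]: perimeter [8 * k] times
    the bound [M]. *)
Lemma goursat_bounded q (a b c d x0 y0 M r : R) :
  a < x0 < b -> c < y0 < d -> 0 < r ->
  on_rect (fun w => w != x0 +i* y0 -> holomorphic_at q w) a b c d ->
  ccont q (x0 +i* y0) ->
  (forall w, cabs (w - (x0 +i* y0)) < r -> cabs (q w) <= M) ->
  im_contour q a b c d = 0.
Proof.
move=> /andP[ax xb] /andP[cy yd] r0 hq cq0 qM.
have M0 : 0 <= M.
  have := qM (x0 +i* y0); rewrite subrr cabs0 => /(_ r0).
  exact: le_trans (cabs_ge0 _).
have cq : on_rect (ccont q) a b c d.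
  move=> x y xab ycd; have [->//|ne] := eqVneq (x +i* y) (x0 +i* y0).
  by apply: holomorphic_continuous; exact: hq.
have key e : 0 < e -> `|im_contour q a b c d| <= 8 * M * e.
  move=> e0.
  (* [r / 3] keeps the square inside the disc where [M] is valid, as its points are within [2 * k]
     of the centre; the last four terms keep it inside the rectangle. *)
  pose k := Num.min (Num.min e (r / 3)) (Num.min (Num.min (x0 - a) (b - x0)) (Num.min (y0 - c) (d - y0))).
  have k0 : 0 < k by rewrite !lt_min e0 divr_gt0//= !subr_gt0 ax xb cy yd.
  have : k <= k by [].
  rewrite {2}/k !le_min => /andP[/andP[ke kr] /andP[/andP[ka kb] /andP[kc kd]]].
  have hqS a' b' c' d' : a <= a' -> b' <= b -> c <= c' -> d' <= d -> a' <= b' -> c' <= d' ->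
      (x0 < a' \/ b' < x0 \/ y0 < c' \/ d' < y0) -> im_contour q a' b' c' d' = 0.
    move=> h1 h2 h3 h4 h5 h6 h7; apply: goursat => // x y /andP[ax' xb'] /andP[cy' yd'].
    apply: hq.
    - by rewrite (le_trans h1)// (le_trans xb').
    - by rewrite (le_trans h3)// (le_trans yd').
    - by rewrite eq_complex /=; apply/negP => /andP[/eqP xx /eqP yy]; lra.
  rewrite (@im_contour_splitx q a (x0 - k) b c d); [|lra|lra|lra|exact: cq].
  rewrite (hqS a (x0 - k) c d); [|lra|lra|lra|lra|lra|lra|lra].
  rewrite add0r.
  rewrite (@im_contour_splitx q (x0 - k) (x0 + k) b c d);
    [|lra|lra|lra|by apply: on_rectS cq; lra].
  rewrite (hqS (x0 + k) b c d); [|lra|lra|lra|lra|lra|lra|lra].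
  rewrite addr0.
  rewrite (@im_contour_splity q (x0 - k) (x0 + k) c (y0 - k) d);
    [|lra|lra|lra|by apply: on_rectS cq; lra].
  rewrite (hqS (x0 - k) (x0 + k) c (y0 - k)); [|lra|lra|lra|lra|lra|lra|lra].
  rewrite add0r.
  rewrite (@im_contour_splity q (x0 - k) (x0 + k) (y0 - k) (y0 + k) d);
    [|lra|lra|lra|by apply: on_rectS cq; lra].
  rewrite (hqS (x0 - k) (x0 + k) (y0 + k) d); [|lra|lra|lra|lra|lra|lra|lra].
  rewrite addr0.
  have qb x y : x0 - k <= x <= x0 + k -> y0 - k <= y <= y0 + k -> cabs (q (x +i* y)) <= M.
    move=> /andP[h1 h2] /andP[h3 h4]; apply: qM.
    apply: le_lt_trans (cabs_leD _) _; rewrite !cE /=.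
    have h5 : `|x - x0| <= k by rewrite ler_norml; apply/andP; split; lra.
    have h6 : `|y - y0| <= k by rewrite ler_norml; apply/andP; split; lra.
    lra.
  have cq' : on_rect (ccont q) (x0 - k) (x0 + k) (y0 - k) (y0 + k).
    by apply: on_rectS cq; lra.
  have xk : x0 - k <= x0 + k by lra.
  have yk : y0 - k <= y0 + k by lra.
  have ih := integrable_hdiff yk cq'; have iv := integrable_vdiff xk cq'.
  have hb x : x0 - k <= x <= x0 + k -> `|hdiff q (y0 - k) (y0 + k) x| <= 2 * M.
    move=> xx; rewrite /hdiff (le_trans (ler_normB _ _))//.
    have -> : 2 * M = M + M by ring.
    by rewrite lerD// (le_trans (ler_Im_cabs _))// qb// lexx yk.
  have vb y : y0 - k <= y <= y0 + k -> `|vdiff q (x0 - k) (x0 + k) y| <= 2 * M.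
    move=> xx; rewrite /vdiff (le_trans (ler_normB _ _))//.
    have -> : 2 * M = M + M by ring.
    by rewrite lerD// (le_trans (ler_Re_cabs _))// qb// lexx xk.
  have := Rintegral_segment_le xk ih (fun x hx => (ler_normlW (hb x hx))).
  have := Rintegral_segment_le yk iv (fun x hx => (ler_normlW (vb x hx))).
  have := @Rintegral_segment_ge _ _ _ _ (- (2 * M)) xk ih.
  have := @Rintegral_segment_ge _ _ _ _ (- (2 * M)) yk iv.
  rewrite /im_contour /hdiff /vdiff.
  set I1 := Rintegral _ _ _; set I2 := Rintegral _ _ _ => h1 h2 h3 h4.
  have {}h1 := h1 (fun x hx => lerNnormlW (vb x hx)).
  have {}h2 := h2 (fun x hx => lerNnormlW (hb x hx)).
  have kM : M * k <= M * e by rewrite ler_wpM2l.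
  by rewrite ler_norml; apply/andP; split; lra.
apply/eqP; rewrite -normr_le0; apply/ler_addgt0Pr => e e0; rewrite add0r.
have e1 : 0 < e / (8 * M + 1) by apply: divr_gt0 => //; lra.
have := key _ e1.
move=> /le_trans; apply; rewrite mulrA ler_pdivrMr; last by lra.
by rewrite mulrC ler_wpM2l; lra.
Qed.

End Goursat.

(** * The identity theorem on the right half-plane *)

Section Identity.
Variable R : realType.
Local Notation C := R[i].
Implicit Types (h q : C -> C) (s w c : C).

Lemma cabs_lipschitz w s : `|cabs w - cabs s| <= cabs (w - s).
Proof.
have := ler_cabsD (w - s) s; have := ler_cabsD (s - w) w.
rewrite !subrK (cabsB s) => h1 h2.
by rewrite ler_norml; apply/andP; split; lra.
Qed.

Lemma bounded_path h (phi : R -> C) (a b : R) : a <= b ->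
  (forall x x', cabs (phi x' - phi x) = `|x' - x|) ->
  (forall x, a <= x <= b -> ccont h (phi x)) ->
  exists M : R, forall x, a <= x <= b -> cabs (h (phi x)) <= M.
Proof.
move=> ab hphi ch.
have cf : {within `[a, b], continuous (fun x => cabs (h (phi x)))}.
  apply: continuous_in_subspaceT => x; rewrite inE /= in_itv /= => xab.
  exact: (continuous_path (hphi x) cabs_lipschitz (ch _ xab)).
have [x _ xP] := EVT_max ab cf.
by exists (cabs (h (phi x))) => y yab; apply: xP; rewrite in_itv.
Qed.

Lemma bounded_edges h (a b c d : R) : a <= b -> c <= d -> on_rect (ccont h) a b c d ->
  exists M : R, (forall x, a <= x <= b -> cabs (h (x +i* c)) <= M /\ cabs (h (x +i* d)) <= M)
   /\ (forall y, c <= y <= d -> cabs (h (a +i* y)) <= M /\ cabs (h (b +i* y)) <= M).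
Proof.
move=> ab cd ch.
have hx (y x x' : R) : cabs ((x' +i* y) - (x +i* y)) = `|x' - x|.
  by rewrite -cabs_real; congr cabs; apply: complex_ext; rewrite !cE /= ?subrr.
have hy (x y y' : R) : cabs ((x +i* y') - (x +i* y)) = `|y' - y|.
  rewrite -[RHS]mul1r -cabs_real -[1](@cabs_cis R (pi / 2)) -cabsM cos_pihalf sin_pihalf.
  by congr cabs; apply: complex_ext; rewrite !cE /= ?subrr; ring.
have [M1 h1] := bounded_path ab (hx c) (fun x xab => ch x c xab ltac:(by rewrite lexx cd)).
have [M2 h2] := bounded_path ab (hx d) (fun x xab => ch x d xab ltac:(by rewrite lexx cd)).
have [M3 h3] := bounded_path cd (hy a) (fun y ycd => ch a y ltac:(by rewrite lexx ab) ycd).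
have [M4 h4] := bounded_path cd (hy b) (fun y ycd => ch b y ltac:(by rewrite lexx ab) ycd).
exists (Num.max (Num.max M1 M2) (Num.max M3 M4)).
by split => [x xab|y ycd]; rewrite !le_max ?h1 ?h2 ?h3 ?h4 ?orbT.
Qed.

Lemma ReV s : complex.Re s^-1 = complex.Re s / cabs s ^+ 2.
Proof. by rewrite cabs_sqr; case: s. Qed.

Lemma ImV s : complex.Im s^-1 = - (complex.Im s / cabs s ^+ 2).
Proof. by rewrite cabs_sqr; case: s. Qed.

Lemma geometric_lt (M t e : R) : 0 <= t -> t < 1 -> 0 < e -> exists n, M * t ^+ n < e.
Proof.
move=> t0 t1 e0; have [M0|M0] := leP M 0.
  by exists 0%N; rewrite expr0 mulr1 (le_lt_trans M0).
have /cvgrPdist_lt/(_ (e / M) (divr_gt0 e0 M0))[N _ NP] : t ^+ n @[n --> \oo] --> (0 : R).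
  by apply: cvg_expr; rewrite ger0_norm.
exists N; have := NP N (leqnn N); rewrite /= sub0r normrN ger0_norm ?exprn_ge0//.
by rewrite ltr_pdivlMr// mulrC.
Qed.

(* Cauchy's formula for [h w * ((s0 - c) / (w - c)) ^ n], which is holomorphic
   because [h] vanishes near [c], represents [h s0] by a contour integral that
   tends to [0] with [n]. *)
Lemma vanish_in_square h c s0 (rho delta : R) : 0 < delta ->
  on_rect (holomorphic_at h) (complex.Re c - rho) (complex.Re c + rho)
    (complex.Im c - rho) (complex.Im c + rho) ->
  (forall w, cabs (w - c) < delta -> h w = 0) ->
  cabs (s0 - c) < rho -> h s0 = 0.
Proof.
move=> delta0 hh h0 s0rho; apply/eqP; apply: contraT => hs0.
have rho0 : 0 < rho by exact: le_lt_trans (cabs_ge0 _) s0rho.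
have s0c : s0 - c != 0.
  apply/eqP => E; move: hs0; rewrite h0 ?eqxx//.
  by rewrite E cabs0.
set x1 := complex.Re c - rho; set x2 := complex.Re c + rho.
set y1 := complex.Im c - rho; set y2 := complex.Im c + rho.
have x12 : x1 <= x2 by rewrite /x1 /x2; lra.
have y12 : y1 <= y2 by rewrite /y1 /y2; lra.
have ch : on_rect (ccont h) x1 x2 y1 y2.
  by move=> x y hx hy; apply: holomorphic_continuous; exact: hh.
have [M [Mx My]] := bounded_edges x12 y12 ch.
(* A lower bound for the distance of [s0] from the edges of the square. *)
set k := rho - cabs (s0 - c).
have k0 : 0 < k by rewrite subr_gt0.
set t := cabs (s0 - c) / rho.
have t0 : 0 <= t by rewrite divr_ge0 ?cabs_ge0 ?ltW.
have t1 : t < 1 by rewrite ltr_pdivrMr// mul1r.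
have kr0 : 0 < k ^+ 2 / (3 * rho) ^+ 2 by rewrite divr_gt0// exprn_gt0// mulr_gt0.
(* On the edges [|w - s0|] lies between [k] and [3 * rho]. Thus [f w / (w - s0)] is at most
   [eta / k], while the dominant part of [1 / (w - s0)] is at least [k / (3 * rho) ^+ 2]; [n] makes
   the former smaller. *)
have [n nP] := geometric_lt (M / cabs (h s0)) t0 t1 kr0.
set eta := M / cabs (h s0) * t ^+ n in nP.
(* Normalized to [f s0 = 1]. The singular factor at [c] is harmless because [h] vanishes near
   [c]. *)
pose f w := h w * ((s0 - c) ^+ n / h s0) * ((w - c)^-1) ^+ n.
have fs0 : f s0 = 1.
  by rewrite /f exprVn; field; rewrite hs0 expf_neq0.
have fhol w : holomorphic_at h w -> holomorphic_at f w.
  move=> hw; have [->|wc] := eqVneq w c.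
    apply: (@holomorphic_near _ (fun=> 0) _ _ delta) => //.
      by move=> w' /h0 E; rewrite /f E !mul0r.
    exact: holomorphic_cst.
  apply: holomorphicM; first by apply: holomorphicM => //; exact: holomorphic_cst.
  apply: holomorphicX; apply: holomorphicV.
    by apply: holomorphicB; [exact: holomorphic_id|exact: holomorphic_cst].
  by rewrite subr_eq0.
have fedge w : cabs (h w) <= M -> rho <= cabs (w - c) -> cabs (f w) <= eta.
  move=> hM wr; rewrite /f !cabsM !cabsX !cabsV /eta /t expr_div_n.
  have -> : M / cabs (h s0) * (cabs (s0 - c) ^+ n / rho ^+ n) =
     M * (cabs (s0 - c) ^+ n / cabs (h s0)) * (rho^-1) ^+ n.
    by rewrite exprVn; ring.
  have c0 : 0 <= cabs (s0 - c) ^+ n / cabs (h s0).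
    by rewrite divr_ge0 ?cabs_ge0 ?exprn_ge0 ?cabs_ge0.
  apply: ler_pM.
  - by rewrite mulr_ge0 ?cabs_ge0.
  - by rewrite exprn_ge0// invr_ge0 cabs_ge0.
  - by rewrite ler_wpM2r.
  - apply: lerXn2r; rewrite ?nnegrE ?invr_ge0 ?cabs_ge0 ?(ltW rho0)//.
    by rewrite lef_pV2 ?posrE// (lt_le_trans rho0).
have s0in : complex.Re c - rho < complex.Re s0 < complex.Re c + rho /\
            complex.Im c - rho < complex.Im s0 < complex.Im c + rho.
  have := le_lt_trans (ler_Re_cabs _) s0rho; have := le_lt_trans (ler_Im_cabs _) s0rho.
  rewrite !cE !ltr_norml => /andP[? ?] /andP[? ?].
  by split; apply/andP; split; lra.
have hols0 : holomorphic_at f s0.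
  apply: fhol; case: (s0) s0in => /= a b [/andP[? ?] /andP[? ?]].
  by apply: hh; apply/andP; split; apply: ltW.
(* [phi] is [(f w - 1) / (w - s0)], extended continuously to [s0]. Its contour integral vanishes,
   although it differs little from [- 1 / (w - s0)] on the edges. *)
have [phi cphi phiE] := (holomorphicP f s0).1 hols0.
have phiE' w : w != s0 -> phi w = (f w - 1) / (w - s0).
  by move=> ws; rewrite -fs0 phiE mulfK// subr_eq0.
have [r r0 rP] := (ccontP _ _).1 cphi 1 ltr01.
have s0E : s0 = complex.Re s0 +i* complex.Im s0 by case: (s0).
have W0 : im_contour phi x1 x2 y1 y2 = 0.
  apply: (@goursat_bounded R phi x1 x2 y1 y2 (complex.Re s0) (complex.Im s0) (1 + cabs (phi s0)) r).
  - by case: s0in.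
  - by case: s0in.
  - by [].
  - move=> x y hx hy; rewrite -s0E; set w := x +i* y => ws.
    apply: (@holomorphic_near _ (fun w' => (f w' - 1) * (w' - s0)^-1) _ _ (cabs (w - s0))).
    + by rewrite cabs_gt0 subr_eq0.
    + move=> w' h'; rewrite phiE'//; apply/eqP => E; move: h'.
      by rewrite E cabsB ltxx.
    + apply: holomorphicM.
        by apply: holomorphicB; [apply: fhol; exact: hh|exact: holomorphic_cst].
      apply: holomorphicV; last by rewrite subr_eq0.
      by apply: holomorphicB; [exact: holomorphic_id|exact: holomorphic_cst].
  - by rewrite -s0E.
  - move=> w; rewrite -s0E => /rP wr; rewrite -(subrK (phi s0) (phi w)).
    by rewrite (le_trans (ler_cabsD _ _))// lerD2r ltW.
have eta0 : eta / k < k / (3 * rho) ^+ 2.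
  by rewrite ltr_pdivrMr// mulrAC -expr2.
set tau := k / (3 * rho) ^+ 2 - eta / k.
have tau0 : 0 < tau by rewrite subr_gt0.
(* The four clauses serve the right, left, top and bottom edge. With [u = w - s0], [Re (1 / u)] has
   the sign of [Re u] and [Im (1 / u)] the sign opposite to [Im u]. *)
have edge w : cabs (h w) <= M -> rho <= cabs (w - c) -> cabs (w - c) <= 2 * rho ->
   [/\ k <= complex.Re (w - s0) -> complex.Re (phi w) <= - tau,
       complex.Re (w - s0) <= - k -> tau <= complex.Re (phi w),
       k <= complex.Im (w - s0) -> tau <= complex.Im (phi w) &
       complex.Im (w - s0) <= - k -> complex.Im (phi w) <= - tau].
  move=> hM wr wr2.
  have fw := fedge _ hM wr.
  have uk : k <= cabs (w - s0).
    have := ler_cabs_dist w c s0; rewrite /k; lra.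
  have u3 : cabs (w - s0) <= 3 * rho.
    have := ler_cabs_dist w s0 c; rewrite (cabsB c); lra.
  have u0 : 0 < cabs (w - s0) by exact: lt_le_trans uk.
  have ws : w != s0 by rewrite -subr_eq0 -cabs_gt0.
  rewrite phiE'// mulrBl mul1r.
  have Fu : cabs (f w / (w - s0)) <= eta / k.
    rewrite cabsM cabsV; apply: ler_pM; rewrite ?cabs_ge0 ?invr_ge0 ?cabs_ge0//.
    by rewrite lef_pV2.
  have := le_trans (ler_Re_cabs _) Fu; have := le_trans (ler_Im_cabs _) Fu.
  have big A : k <= A -> k / (3 * rho) ^+ 2 <= A / cabs (w - s0) ^+ 2.
    move=> kA; apply: ler_pM => //; first by exact: ltW.
      by rewrite invr_ge0 exprn_ge0// mulr_ge0 ?ltW.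
    rewrite lef_pV2 ?posrE ?exprn_gt0 ?mulr_gt0//.
    by apply: lerXn2r; rewrite ?nnegrE ?cabs_ge0// mulr_ge0 ?ltW.
  set F := f w / (w - s0); set u := w - s0 in big *.
  rewrite (ReD F) (ImD F) (ReN u^-1) (ImN u^-1) ReV ImV !ler_norml => /andP[? ?] /andP[? ?].
  split => hA.
  - by have := big _ hA; rewrite /tau; lra.
  - have : k <= - complex.Re u by lra.
    by move=> /big; rewrite mulNr /tau; lra.
  - by have := big _ hA; rewrite /tau; lra.
  - have : k <= - complex.Im u by lra.
    by move=> /big; rewrite mulNr /tau; lra.
have bnd x y : x1 <= x <= x2 -> y1 <= y <= y2 -> cabs ((x +i* y) - c) <= 2 * rho.
  rewrite /x1 /x2 /y1 /y2 => /andP[? ?] /andP[? ?].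
  apply: le_trans (cabs_leD _) _; rewrite !cE /=.
  have h5 : `|x - complex.Re c| <= rho by rewrite ler_norml; apply/andP; split; lra.
  have h6 : `|y - complex.Im c| <= rho by rewrite ler_norml; apply/andP; split; lra.
  lra.
have hs := ler_Re_cabs (s0 - c); have hs' := ler_Im_cabs (s0 - c).
move: hs hs'; rewrite !cE !ler_norml => /andP[rs1 rs2] /andP[is1 is2].
have farx x y : x = x1 \/ x = x2 -> rho <= cabs ((x +i* y) - c).
  move=> hx; apply: le_trans (ler_Re_cabs _); rewrite !cE /= ler_normr.
  by case: hx => ->; apply/orP; [right|left]; rewrite /x1 /x2; lra.
have fary x y : y = y1 \/ y = y2 -> rho <= cabs ((x +i* y) - c).
  move=> hx; apply: le_trans (ler_Im_cabs _); rewrite !cE /= ler_normr.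
  by case: hx => ->; apply/orP; [right|left]; rewrite /y1 /y2; lra.
have y1in : y1 <= y1 <= y2 by rewrite lexx.
have y2in : y1 <= y2 <= y2 by rewrite lexx y12.
have x1in : x1 <= x1 <= x2 by rewrite lexx.
have x2in : x1 <= x2 <= x2 by rewrite lexx x12.
have hd x : x1 <= x <= x2 -> hdiff phi y1 y2 x <= - (2 * tau).
  move=> xx; have [m1 m2] := Mx _ xx; rewrite /hdiff.
  have [_ _ _ e1] := edge _ m1 (fary _ _ (or_introl erefl)) (bnd _ _ xx y1in).
  have [_ _ e2 _] := edge _ m2 (fary _ _ (or_intror erefl)) (bnd _ _ xx y2in).
  have {}e1 : complex.Im (phi (x +i* y1)) <= - tau.
    by apply: e1; rewrite !cE /= /y1 /k; lra.
  have {}e2 : tau <= complex.Im (phi (x +i* y2)).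
    by apply: e2; rewrite !cE /= /y2 /k; lra.
  lra.
have vd y : y1 <= y <= y2 -> vdiff phi x1 x2 y <= - (2 * tau).
  move=> yy; have [m1 m2] := My _ yy; rewrite /vdiff.
  have [_ e1 _ _] := edge _ m1 (farx _ _ (or_introl erefl)) (bnd _ _ x1in yy).
  have [e2 _ _ _] := edge _ m2 (farx _ _ (or_intror erefl)) (bnd _ _ x2in yy).
  have {}e1 : tau <= complex.Re (phi (x1 +i* y)).
    by apply: e1; rewrite !cE /= /x1 /k; lra.
  have {}e2 : complex.Re (phi (x2 +i* y)) <= - tau.
    by apply: e2; rewrite !cE /= /x2 /k; lra.
  lra.
have cphi' : on_rect (ccont phi) x1 x2 y1 y2.
  move=> x y xx yy; have [->//|ws] := eqVneq (x +i* y) s0.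
  apply: holomorphic_continuous.
  apply: (@holomorphic_near _ (fun w' => (f w' - 1) * (w' - s0)^-1) _ _ (cabs ((x +i* y) - s0))).
  + by rewrite cabs_gt0 subr_eq0.
  + move=> w' h'; rewrite phiE'//; apply/eqP => E; move: h'.
    by rewrite E cabsB ltxx.
  + apply: holomorphicM.
      by apply: holomorphicB; [apply: fhol; exact: hh|exact: holomorphic_cst].
    apply: holomorphicV; last by rewrite subr_eq0.
    by apply: holomorphicB; [exact: holomorphic_id|exact: holomorphic_cst].
(* Both integrals are at most [- 4 * tau * rho], which contradicts [W0]. *)
have := Rintegral_segment_le x12 (integrable_hdiff y12 cphi') hd.
have := Rintegral_segment_le y12 (integrable_vdiff x12 cphi') vd.
have xw : x2 - x1 = 2 * rho by rewrite /x1 /x2; ring.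
have yw : y2 - y1 = 2 * rho by rewrite /y1 /y2; ring.
move: W0; rewrite /im_contour /hdiff /vdiff xw yw.
set I1 := Rintegral _ _ _; set I2 := Rintegral _ _ _ => W0 h1 h2.
have := mulr_gt0 tau0 rho0 => tr0.
exfalso; lra.
Qed.

(* Squares of a fixed half-side stay in [Re > 0], off the real axis, while their
   centres move from [Re w = 2] to the left in steps of half that size. *)
Lemma vanish_right_half_plane h :
  (forall s, 0 < complex.Re s -> complex.Im s != 0 -> holomorphic_at h s) ->
  (forall s, 1 < complex.Re s -> complex.Im s != 0 -> h s = 0) ->
  forall s, 0 < complex.Re s -> complex.Im s != 0 -> h s = 0.
Proof.
move=> hh h1 s s0 t0.
(* The three terms keep every square in [Re > 0], the first disc in [Re > 1], and all squares off
   the real axis. *)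
pose rho := Num.min (Num.min (complex.Re s) 1) `|complex.Im s| / 2.
have rho0 : 0 < rho by rewrite divr_gt0// !lt_min s0 ltr01 normr_gt0.
have [r1 r2 r3] : [/\ 2 * rho <= complex.Re s, 2 * rho <= 1 & 2 * rho <= `|complex.Im s|].
  have E : 2 * rho = Num.min (Num.min (complex.Re s) 1) `|complex.Im s|.
    by rewrite /rho; field.
  have : 2 * rho <= 2 * rho by [].
  by rewrite {2}E !le_min => /andP[/andP[-> ->] ->].
pose c k : C := (2 - k%:R * (rho / 2)) +i* complex.Im s.
have ck k : complex.Re s <= complex.Re (c k) -> forall w, cabs (w - c k) < rho -> h w = 0.
  elim: k => [|k IH] hk w wk.
    apply: h1.
      have := le_lt_trans (ler_Re_cabs _) wk; rewrite !cE /= ltr_norml => /andP[? ?].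
      lra.
    have := le_lt_trans (ler_Im_cabs _) wk; rewrite !cE /= => hw.
    apply/eqP => w0; move: hw; rewrite w0 add0r normrN; lra.
  have step : complex.Re (c k) = complex.Re (c k.+1) + rho / 2.
    by rewrite /c /= -natr1; ring.
  have hk' : complex.Re s <= complex.Re (c k) by rewrite step; lra.
  have h0 := IH hk'.
  (* The disc of radius [rho / 2] about the next centre lies in the disc of radius [rho] about the
     current one. *)
  have {}IH v : cabs (v - c k.+1) < rho / 2 -> h v = 0.
    move=> hv; apply: h0; apply: le_lt_trans (ler_cabs_dist _ _ (c k.+1)) _.
    have -> : cabs (c k.+1 - c k) = rho / 2.
      rewrite cabsB (_ : c k - c k.+1 = (rho / 2)%:C) ?cabs_real ?gtr0_norm//; first lra.
      by apply: complex_ext; rewrite !cE ?step /c /= ?subrr//; ring.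
    lra.
  apply: (@vanish_in_square h (c k.+1) w rho (rho / 2)) => //; first lra.
  move=> x y /andP[hx hx'] /andP[hy hy']; apply: hh => /=; first by lra.
  apply/eqP => y0; move: hy hy'; rewrite y0 /c /= => hy hy'.
  by move: r3; rewrite leNgt => /negP; apply; rewrite ltr_norml; apply/andP; split; lra.
(* Index of the last centre not to the left of [s]; it is closer to [s] than [rho / 2]. *)
pose k := Num.truncn ((2 - complex.Re s) / (rho / 2)).
have [s2|s2] := ltP 1 (complex.Re s); first by exact: h1.
have q0 : 0 <= (2 - complex.Re s) / (rho / 2) by rewrite divr_ge0//; lra.
have /andP[k1 k2] := truncn_itv q0.
have r20 : 0 < rho / 2 by lra.
rewrite -/k ler_pdivlMr// in k1.
have {}k2 : 2 - complex.Re s < (k%:R + 1) * (rho / 2).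
  by rewrite -ltr_pdivrMr// natr1.
apply: (ck k); first by rewrite /c /=; lra.
have -> : s - c k = (complex.Re s - (2 - k%:R * (rho / 2)))%:C.
  by apply: complex_ext; rewrite !cE /= ?subrr.
by rewrite cabs_real ltr_norml; apply/andP; split; lra.
Qed.

End Identity.

(** * Uniqueness of Fourier transforms *)

Section ExponentialIntegrals.
Variable R : realType.
Local Notation mu := (@lebesgue_measure R).
Implicit Types (f g : R -> R) (e w x y : R).

Lemma continuous_derive_at (f : R -> R) (d x : R) : is_derive x 1 f d ->
  {for x, continuous f}.
Proof. by case=> df _; apply/differentiable_continuous/derivable1_diffP. Qed.

Section half_line.
Variables (e w al be : R).
Hypotheses (e0 : 0 < e).
Let D := e ^+ 2 + w ^+ 2.
(** A primitive of [f] that tends to zero at infinity, so that the integral over the half-line is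
    [- F 0]. *)
Let F x := - (expR (- e * x) * (2 / e +
  (al * (e * cos (w * x) - w * sin (w * x)) + be * (e * sin (w * x) + w * cos (w * x))) / D)).
Let f x := expR (- e * x) * (2 + (al * cos (w * x) + be * sin (w * x))).

Let D0 : D != 0.
Proof. by rewrite gt_eqF// ltr_wpDr ?sqr_ge0// exprn_gt0. Qed.

Let dF x : is_derive x 1 F (f x).
Proof.
rewrite /F /f; apply: is_derive_eq.
have D0' : e ^+ 2 + w ^+ 2 != 0 := D0.
rewrite /D /GRing.scale /=; field.
by rewrite (gt_eqF e0) D0'.
Qed.

Let f0 x : `|al| <= 1 -> `|be| <= 1 -> 0 <= f x.
Proof.
move=> hal hbe; rewrite mulr_ge0 ?expR_ge0//.
have h1 : `|al * cos (w * x)| <= 1.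
  rewrite normrM -[leRHS]mulr1 ler_pM// ler_norml; apply/andP; split; [exact: cos_geN1|exact: cos_le1].
have h2 : `|be * sin (w * x)| <= 1.
  rewrite normrM -[leRHS]mulr1 ler_pM// ler_norml; apply/andP; split; [exact: sin_geN1|exact: sin_le1].
by move: h1 h2; rewrite !ler_norml => /andP[? ?] /andP[? ?]; lra.
Qed.

Let cf x : {for x, continuous f}.
Proof.
apply: (@continuous_derive_at _
  (- e * expR (- e * x) * (2 + (al * cos (w * x) + be * sin (w * x))) +
   expR (- e * x) * (- al * w * sin (w * x) + be * w * cos (w * x)))).
by rewrite /f; apply: is_derive_eq; rewrite /GRing.scale /=; ring.
Qed.

Lemma expR_cvg0 : expR (- e * x) @[x --> +oo] --> (0 : R).
Proof.
have -> : (fun x => expR (- e * x)) = (fun z => expR (- z)) \o (fun z => e * z).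
  by apply/funext => x; rewrite /= mulNr.
apply: (@cvg_comp _ _ _ _ _ _ (pinfty_nbhs R)); last exact: cvgr_expR.
exact: gt0_cvgMry.
Qed.

Let Fy : F x @[x --> +oo] --> (0 : R).
Proof.
rewrite -oppr0; apply: cvgN.
pose M := 2 / e + (`|al| * (e + `|w|) + `|be| * (e + `|w|)) / D.
have D1 : 0 < D by rewrite lt_def D0 addr_ge0 ?sqr_ge0.
have hM x : `|expR (- e * x) * (2 / e +
  (al * (e * cos (w * x) - w * sin (w * x)) + be * (e * sin (w * x) + w * cos (w * x))) / D)|
    <= expR (- e * x) * M.
  have cx : `|cos (w * x)| <= 1 by rewrite ler_norml cos_geN1 cos_le1.
  have sx : `|sin (w * x)| <= 1 by rewrite ler_norml sin_geN1 sin_le1.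
  rewrite normrM ger0_norm ?expR_ge0// ler_wpM2l ?expR_ge0//.
  rewrite (le_trans (ler_normD _ _))// lerD//; first by rewrite ger0_norm// divr_ge0// ltW.
  have Di : 0 <= D^-1 by rewrite invr_ge0 ltW.
  rewrite normrM (ger0_norm Di) ler_wpM2r//.
  rewrite (le_trans (ler_normD _ _))// !normrM lerD// ler_wpM2l//.
    rewrite (le_trans (ler_normB _ _))// !normrM (gtr0_norm e0).
    by rewrite lerD// -[leRHS]mulr1 ler_wpM2l// (ltW e0).
  rewrite (le_trans (ler_normD _ _))// !normrM (gtr0_norm e0).
  by rewrite lerD// -[leRHS]mulr1 ler_wpM2l// (ltW e0).
have lM : expR (- e * x) * M @[x --> +oo] --> (0 : R).
  by rewrite -[X in _ --> X](mul0r M); apply: cvgMl; exact: expR_cvg0.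
apply/norm_cvg0P; apply: (squeeze_cvgr _ (cvg_cst 0) lM).
by apply: nearW => x; rewrite normr_ge0 hM.
Qed.

(** The summand [2] dominates the trigonometric part and makes the integrand nonnegative, as the
    fundamental theorem on a half-line is used in its version for nonnegative functions. It is
    subtracted again in [Rintegral_exp_trig]. *)
Lemma integral_exp_trig_ge0 : `|al| <= 1 -> `|be| <= 1 ->
  (\int[mu]_(x in `[0%R, +oo[) (expR (- e * x) * (2 + (al * cos (w * x) + be * sin (w * x))))%R%:E
   = (2 / e + (al * e + be * w) / (e ^+ 2 + w ^+ 2))%:E)%E.
Proof.
move=> hal hbe.
rewrite (@ge0_continuous_FTC2y _ f F 0 0).
- by rewrite -EFinB /F !mulr0 expR0 cos0 sin0; congr EFin; ring.
- by move=> x _; exact: f0.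
- by apply: continuous_subspaceT => x; exact: cf.
- exact: Fy.
- by move=> x _; apply: ex_derive.
- by apply/cvg_at_right_filter; exact: (continuous_derive_at (dF 0)).
- by move=> x _; rewrite derive1E; apply: derive_val.
Qed.

End half_line.

Lemma measurable_exp_trig e w al be :
  measurable_fun setT (fun x => expR (- e * x) * (2 + (al * cos (w * x) + be * sin (w * x)))).
Proof.
apply: continuous_measurable_fun => x.
apply: (@continuous_derive_at _
  (- e * expR (- e * x) * (2 + (al * cos (w * x) + be * sin (w * x))) +
   expR (- e * x) * (- al * w * sin (w * x) + be * w * cos (w * x)))).
by apply: is_derive_eq; rewrite /GRing.scale /=; ring.
Qed.

Lemma integrable_exp_trig e w al be : 0 < e -> `|al| <= 1 -> `|be| <= 1 ->
  mu.-integrable `[0, +oo[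
   (EFin \o (fun x => expR (- e * x) * (2 + (al * cos (w * x) + be * sin (w * x))))).
Proof.
move=> e0 hal hbe; apply/integrableP; split.
  by apply/measurable_EFinP/measurable_funTS; exact: measurable_exp_trig.
have h x : 0 <= expR (- e * x) * (2 + (al * cos (w * x) + be * sin (w * x))).
  rewrite mulr_ge0 ?expR_ge0//.
  have h1 : `|al * cos (w * x)| <= 1.
    by rewrite normrM -[leRHS]mulr1 ler_pM// ler_norml cos_geN1 cos_le1.
  have h2 : `|be * sin (w * x)| <= 1.
    by rewrite normrM -[leRHS]mulr1 ler_pM// ler_norml sin_geN1 sin_le1.
  by move: h1 h2; rewrite !ler_norml => /andP[? ?] /andP[? ?]; lra.
under eq_integral do rewrite /= ger0_norm ?h//.
by rewrite integral_exp_trig_ge0// ltry.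
Qed.

Lemma integrable_exp_half e : 0 < e ->
  mu.-integrable `[0, +oo[ (EFin \o (fun x => expR (- e * x))).
Proof.
move=> e0.
have := @integrable_exp_trig e 0 0 0 e0; rewrite normr0 => /(_ ler01 ler01) h.
have := @integrableZl _ _ _ mu _ (measurable_itv _) (2^-1) _ h.
apply: eq_integrable => // x _ /=.
by rewrite -EFinM !mul0r !addr0; congr EFin; field.
Qed.

Lemma Rintegral_exp_trig e w al be : 0 < e -> `|al| <= 1 -> `|be| <= 1 ->
  (\int[mu]_(x in `[0, +oo[) (expR (- e * x) * (al * cos (w * x) + be * sin (w * x))) =
  (al * e + be * w) / (e ^+ 2 + w ^+ 2))%R.
Proof.
move=> e0 hal hbe.
have h0 : (\int[mu]_(x in `[0, +oo[) (2 * expR (- e * x)))%R = 2 / e.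
  rewrite /Rintegral; have := @integral_exp_trig_ge0 e 0 0 0 e0.
  rewrite normr0 => /(_ ler01 ler01) h.
  transitivity (fine (2 / e + (0 * e + 0 * 0) / (e ^+ 2 + 0 ^+ 2))%:E).
    rewrite -h; congr fine; apply: eq_integral => x _; congr EFin.
    by rewrite !mul0r !addr0 mulrC.
  by rewrite /= !mul0r addr0 mul0r addr0.
have h1 : (\int[mu]_(x in `[0, +oo[)
   (expR (- e * x) * (2 + (al * cos (w * x) + be * sin (w * x)))))%R =
   2 / e + (al * e + be * w) / (e ^+ 2 + w ^+ 2).
  by rewrite /Rintegral integral_exp_trig_ge0.
have i1 := @integrable_exp_trig e w al be e0 hal hbe.
have i0 : mu.-integrable `[0, +oo[ (EFin \o (fun x => 2 * expR (- e * x))).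
  have := @integrableZl _ _ _ mu _ (measurable_itv _) 2 _ (integrable_exp_half e0).
  by apply: eq_integrable => // x _ /=; rewrite EFinM.
transitivity ((\int[mu]_(x in `[0%R, +oo[)
   (expR (- e * x) * (2 + (al * cos (w * x) + be * sin (w * x))) - 2 * expR (- e * x)))%R).
  by apply: eq_Rintegral => x _; ring.
by rewrite RintegralB// h1 h0; ring.
Qed.

End ExponentialIntegrals.

Section RealLine.
Variable R : realType.
Local Notation mu := (@lebesgue_measure R).

Lemma integrable_dominated d (T : measurableType d) (m : {measure set T -> \bar R})
    (f g : T -> R) : measurable_fun setT f -> m.-integrable setT (EFin \o g) ->
  (forall x, `|f x| <= g x) -> m.-integrable setT (EFin \o f).
Proof.
move=> mf ig fg; apply: le_integrable ig => //; first exact/measurable_EFinP.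
by move=> x _ /=; rewrite lee_fin (le_trans (fg x))// ler_norm.
Qed.

Lemma continuous_exp_abs (e : R) : continuous (fun x : R => expR (- e * `|x|)).
Proof.
move=> x; apply: (@continuous_comp _ _ _ (fun x => - e * `|x|) expR).
  by apply: cvgMr; exact: norm_continuous.
exact: continuous_expR.
Qed.

Lemma continuous_cosZ (w : R) : continuous (fun x : R => cos (w * x)).
Proof.
move=> x; apply: (@continuous_comp _ _ _ ( *%R w) cos); first exact: mulrl_continuous.
exact: continuous_cos.
Qed.

Lemma integral_exp_abs_trig (e w be : R) : 0 < e -> `|be| <= 1 ->
  (\int[mu]_x (expR (- e * `|x|) * (2 + be * cos (w * x)))%R%:E
   = (2 * (2 / e + be * e / (e ^+ 2 + w ^+ 2)))%:E)%E.
Proof.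
move=> e0 hbe; rewrite ge0_symfun_integralT.
- rewrite EFinM; congr (_ * _)%E.
  have := @integral_exp_trig_ge0 R e w be 0 e0 hbe.
  rewrite normr0 => /(_ ler01); rewrite mul0r addr0 => <-.
  rewrite -set_itvcy; apply: eq_integral => x; rewrite inE /= in_itv /= andbT => x0.
  by rewrite ger0_norm// mul0r addr0.
- move=> x; rewrite mulr_ge0 ?expR_ge0//.
  have h1 : `|be * cos (w * x)| <= 1.
    by rewrite normrM -[leRHS]mulr1 ler_pM// ler_norml cos_geN1 cos_le1.
  by move: h1; rewrite !ler_norml => /andP[? ?]; lra.
- move=> x; apply: cvgM; first exact: continuous_exp_abs.
  by apply: cvgD; [exact: cvg_cst|apply: cvgMr; exact: continuous_cosZ].
- by move=> x /=; rewrite normrN mulrN cosN.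
Qed.

Lemma measurable_exp_abs (e : R) : measurable_fun setT (fun x : R => expR (- e * `|x|)).
Proof. by apply: continuous_measurable_fun; exact: continuous_exp_abs. Qed.

Lemma integrable_exp_abs (e : R) : 0 < e ->
  mu.-integrable setT (EFin \o (fun x => expR (- e * `|x|))).
Proof.
move=> e0; apply/integrableP; split.
  by apply/measurable_EFinP; exact: measurable_exp_abs.
have h := @integral_exp_abs_trig e 0 0 e0; rewrite normr0 in h; have {}h := h ler01.
apply: (@le_lt_trans _ _ (\int[mu]_x (expR (- e * `|x|) * (2 + 0 * cos (0 * x)))%R%:E)%E);
  last by rewrite h ltry.
apply: ge0_le_integral => //=.
- apply/measurable_EFinP; apply: measurableT_comp => //; exact: measurable_exp_abs.
- apply/measurable_EFinP; apply: measurable_funM; first exact: measurable_exp_abs.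
  rewrite (_ : (fun x : R => _) = cst 2) ?measurable_cst//; apply/funext => x.
  by rewrite mul0r addr0.
- move=> x _; rewrite lee_fin ger0_norm ?expR_ge0// mul0r addr0.
  by have := expR_ge0 (- e * `|x|); lra.
Qed.

(** The Poisson kernel as the Fourier transform of [exp (- e |x|)]; the auxiliary summand [2] is
    removed by taking [be = 1] minus [be = 0]. *)
Lemma Rintegral_poisson (e w : R) : 0 < e ->
  (\int[mu]_x (expR (- e * `|x|) * cos (w * x)) = 2 * e / (e ^+ 2 + w ^+ 2))%R.
Proof.
move=> e0.
have h1 : (\int[mu]_x (expR (- e * `|x|) * (2 + 1 * cos (w * x))))%R
    = 2 * (2 / e + 1 * e / (e ^+ 2 + w ^+ 2)).
  by rewrite /Rintegral integral_exp_abs_trig ?normr1.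
have h0 : (\int[mu]_x (2 * expR (- e * `|x|)))%R = 4 / e.
  transitivity (fine (2 * (2 / e + 0 * e / (e ^+ 2 + 0 ^+ 2)))%:E); last first.
    by rewrite /= !mul0r addr0; field; rewrite gt_eqF.
  rewrite -(@integral_exp_abs_trig e 0 0 e0) ?normr0//.
  by congr fine; apply: eq_integral => x _; rewrite !mul0r addr0 mulrC.
have i0 : mu.-integrable setT (EFin \o (fun x => 2 * expR (- e * `|x|))).
  have := @integrableZl _ _ _ mu _ measurableT 2 _ (integrable_exp_abs e0).
  by apply: eq_integrable => // x _ /=; rewrite EFinM.
have i1 : mu.-integrable setT (EFin \o (fun x => expR (- e * `|x|) * (2 + 1 * cos (w * x)))).
  have i3 := @integrableZl _ _ _ mu _ measurableT 3 _ (integrable_exp_abs e0).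
  apply: (@integrable_dominated _ _ mu _ (fun x => 3 * expR (- e * `|x|))).
  - apply: measurable_funM; first exact: measurable_exp_abs.
    apply: measurable_funD => //; apply: measurable_funM => //.
    exact: (continuous_measurable_fun (@continuous_cosZ w)).
  - by move: i3; apply: eq_integrable => // x _ /=; rewrite EFinM.
  - move=> x; rewrite normrM ger0_norm ?expR_ge0// mulrC ler_wpM2r ?expR_ge0// mul1r.
    by rewrite ler_norml; apply/andP; have := cos_geN1 (w * x); have := cos_le1 (w * x); split; lra.
transitivity ((\int[mu]_x (expR (- e * `|x|) * (2 + 1 * cos (w * x)) - 2 * expR (- e * `|x|)))%R).
  by apply: eq_Rintegral => x _; ring.
by rewrite RintegralB// h1 h0; field; rewrite !gt_eqF// ltr_wpDr ?sqr_ge0// exprn_gt0.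
Qed.

End RealLine.

(** * Smoothing with the Poisson kernel *)

Section FourierUniqueness.
Variable R : realType.
Local Notation mu := (@lebesgue_measure R).

Lemma integrableM_bounded d (T : measurableType d) (m : {measure set T -> \bar R})
    (q k : T -> R) (M : R) :
  m.-integrable setT (EFin \o q) -> measurable_fun setT k -> (forall x, `|k x| <= M) ->
  m.-integrable setT (EFin \o (fun x => q x * k x)).
Proof.
move=> iq mk kM.
have mq : measurable_fun setT q by apply/measurable_EFinP; exact: measurable_int iq.
have i2 := @integrableZl _ _ _ m _ measurableT M _ (integrable_norm iq).
apply: (@integrable_dominated _ _ _ m _ (fun x => M * `|q x|)).
- exact: measurable_funM.
- by move: i2; apply: eq_integrable => // x _ /=; rewrite EFinM.
- by move=> x; rewrite normrM mulrC ler_wpM2r.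
Qed.

(** A bound [b t] on the kernel that is uniform in [y] makes [q y * k y t] integrable on the
    product, by Tonelli. *)
Lemma Rintegral_fubini d1 d2 (T1 : measurableType d1) (T2 : measurableType d2)
    (m : {sigma_finite_measure set T1 -> \bar R})
    (mu : {sigma_finite_measure set T2 -> \bar R})
    (q : T1 -> R) (b : T2 -> R) (k : T1 -> T2 -> R) :
  m.-integrable setT (EFin \o q) -> mu.-integrable setT (EFin \o b) ->
  measurable_fun setT (fun yt : T1 * T2 => k yt.1 yt.2) ->
  (forall t, 0 <= b t) -> (forall y t, `|k y t| <= b t) ->
  (\int[m]_y (q y * \int[mu]_t k y t) = \int[mu]_t (\int[m]_y (q y * k y t)))%R.
Proof.
move=> iq ib mk b0 kb.
have mq : measurable_fun setT q by apply/measurable_EFinP; exact: measurable_int iq.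
have mky y : measurable_fun setT (k y).
  have := measurableT_comp mk (measurable_pair1 y); exact.
have mkt t : measurable_fun setT (k ^~ t).
  have := measurableT_comp mk (measurable_pair2 t); exact.
have iky y : mu.-integrable setT (EFin \o (k y)).
  by apply: (@integrable_dominated _ _ _ mu (k y) b) => //; exact: mky.
pose F (yt : T1 * T2) := (q yt.1 * k yt.1 yt.2)%:E.
have mF : measurable_fun setT F.
  apply/measurable_EFinP; apply: measurable_funM => //.
  by apply: measurableT_comp.
have iF : (m \x mu)%E.-integrable setT F.
  apply/integrable12ltyP => //.
  have hb : (\int[mu]_t (b t)%:E < +oo)%E.
    have := integrable_lty measurableT ib; exact.
  apply: (@le_lt_trans _ _ (\int[m]_y ((`|q y|)%:E * \int[mu]_t (b t)%:E))%E).
    apply: ge0_le_integral => //=.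
    + by move=> y _; exact: integral_ge0.
    + apply: (measurable_fun_fubini_tonelli_F (fun yt => `|F yt|%E)) => //.
      by apply: measurableT_comp.
    + apply: emeasurable_funM => //; apply/measurable_EFinP.
      exact: measurableT_comp.
    + move=> y _; rewrite -ge0_integralZl//=; last 2 first.
        exact: (measurable_int mu ib).
        by move=> t _; rewrite lee_fin.
      apply: ge0_le_integral => //=.
      * apply/measurable_EFinP; apply: measurableT_comp => //.
        by apply: measurable_funM.
      * apply/measurable_EFinP; apply: measurable_funM => //.
        by apply/measurable_EFinP; exact: measurable_int ib.
      * by move=> t _; rewrite -EFinM lee_fin normrM ler_wpM2l.
  have hq : (\int[m]_y `|q y|%:E < +oo)%E.
    by move: iq => /integrableP[].
  have bf : (\int[mu]_t (b t)%:E \is a fin_num)%E.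
    by rewrite ge0_fin_numE//; apply: integral_ge0 => t _; rewrite lee_fin.
  rewrite -(fineK bf) ge0_integralZr//=.
  - have q0 : (0 <= \int[m]_y (`|q y|)%:E)%E by apply: integral_ge0 => y _; rewrite lee_fin.
    by apply: lte_mul_pinfty => //; [rewrite ge0_fin_numE|rewrite ltry].
  - by apply/measurable_EFinP; apply: measurableT_comp.
  - by rewrite lee_fin fine_ge0//; apply: integral_ge0 => t _; rewrite lee_fin.
have := Fubini iF; rewrite /F /= => FF.
rewrite /Rintegral.
transitivity (fine (\int[m]_x \int[mu]_y (q x * k x y)%:E)).
  congr fine; apply: eq_integral => y _.
  rewrite -RintegralZl// /Rintegral fineK//; apply: integrable_fin_num => //.
  have := @integrableZl _ _ _ mu _ measurableT (q y) _ (iky y).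
  by apply: eq_integrable => // t _ /=; rewrite EFinM.
rewrite FF; congr fine; apply: eq_integral => t _.
rewrite fineK//; apply: integrable_fin_num => //.
by apply: (integrableM_bounded (M := b t)).
Qed.

Lemma cvg_sqr {T : Type} (F : set_system T) (FF : Filter F) (f : T -> R) (l : R) :
  f x @[x --> F] --> l -> f x ^+ 2 @[x --> F] --> l ^+ 2.
Proof. by move=> fl; under eq_fun do rewrite expr2; rewrite expr2; exact: cvgM. Qed.

Section smoothing.
Context d (T : measurableType d) (m : {sigma_finite_measure set T -> \bar R}).
Variables (X q : T -> R).
Hypotheses (mX : measurable_fun setT X) (iq : m.-integrable setT (EFin \o q)).

Lemma measurable_cosX t : measurable_fun setT (fun y => cos (t * X y)).
Proof.
apply: measurableT_comp; last by apply: measurable_funM.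
exact: (continuous_measurable_fun (@continuous_cos R)).
Qed.

Lemma measurable_sinX t : measurable_fun setT (fun y => sin (t * X y)).
Proof.
apply: measurableT_comp; last by apply: measurable_funM.
exact: (continuous_measurable_fun (@continuous_sin R)).
Qed.

Lemma integrable_cosX t : m.-integrable setT (EFin \o (fun y => q y * cos (t * X y))).
Proof.
apply: (integrableM_bounded (M := 1)) => //; first exact: measurable_cosX.
by move=> y; rewrite ler_norml cos_geN1 cos_le1.
Qed.

Lemma integrable_sinX t : m.-integrable setT (EFin \o (fun y => q y * sin (t * X y))).
Proof.
apply: (integrableM_bounded (M := 1)) => //; first exact: measurable_sinX.
by move=> y; rewrite ler_norml sin_geN1 sin_le1.
Qed.

(** The Poisson kernel is replaced by its Fourier integral and the integrals are exchanged. The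
    right-hand side sees [q] only through its cosine and sine transforms, which is the source of
    uniqueness. With general [m] and [X] this covers both a probability measure and a density
    against Lebesgue measure. *)
Lemma poisson_smoothing (e x : R) : 0 < e ->
  (\int[m]_y (q y * (2 * e / (e ^+ 2 + (X y - x) ^+ 2))) =
   \int[mu]_t (expR (- e * `|t|) *
     (cos (t * x) * (\int[m]_y (q y * cos (t * X y))) +
      sin (t * x) * (\int[m]_y (q y * sin (t * X y))))))%R.
Proof.
move=> e0.
transitivity (\int[m]_y (q y * \int[mu]_t (expR (- e * `|t|) * cos ((X y - x) * t))))%R.
  by apply: eq_Rintegral => y _; rewrite Rintegral_poisson.
rewrite (@Rintegral_fubini _ _ _ _ m mu q (fun t => expR (- e * `|t|))
   (fun y t => expR (- e * `|t|) * cos ((X y - x) * t))).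
- apply: eq_Rintegral => t _.
  transitivity (\int[m]_y (expR (- e * `|t|) * cos (t * x) * (q y * cos (t * X y)) +
     expR (- e * `|t|) * sin (t * x) * (q y * sin (t * X y))))%R.
    apply: eq_Rintegral => y _.
    have -> : (X y - x) * t = t * X y - t * x by ring.
    by rewrite cosB; ring.
  have iZ (k : R) (f : T -> R) : m.-integrable setT (EFin \o f) ->
      m.-integrable setT (EFin \o (fun y => k * f y)).
    move=> fi; have := @integrableZl _ _ _ m _ measurableT k _ fi.
    by apply: eq_integrable => // y _ /=; rewrite EFinM.
  have ic := integrable_cosX t; have is_ := integrable_sinX t.
  rewrite RintegralD//; [|exact: iZ|exact: iZ].
  by rewrite !RintegralZl//; ring.
- exact: iq.
- exact: integrable_exp_abs.
- apply: measurable_funM.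
    apply: (measurableT_comp (measurable_exp_abs e)); exact: measurable_snd.
  apply: measurableT_comp.
    exact: (continuous_measurable_fun (@continuous_cos R)).
  apply: measurable_funM; last exact: measurable_snd.
  apply: measurable_funB => //.
  by apply: (measurableT_comp mX); exact: measurable_fst.
- by move=> t; exact: expR_ge0.
- move=> y t; rewrite normrM ger0_norm ?expR_ge0// ler_piMr ?expR_ge0//.
  by rewrite ler_norml cos_geN1 cos_le1.
Qed.

Lemma continuous_poisson (e w : R) : 0 < e ->
  continuous (fun x : R => 2 * e / (e ^+ 2 + (w - x) ^+ 2)).
Proof.
move=> e0 x; apply: cvgM; first exact: cvg_cst.
apply: cvgV; first by rewrite gt_eqF// ltr_wpDr ?sqr_ge0// exprn_gt0.
apply: cvgD; first exact: cvg_cst.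
by apply: cvg_sqr; apply: cvgB; [exact: cvg_cst|exact: cvg_id].
Qed.

Lemma Rintegral_poisson_segment (e u v w : R) : 0 < e -> u < v ->
  (\int[mu]_(x in `[u, v]) (2 * e / (e ^+ 2 + (w - x) ^+ 2)) =
   2 * (atan ((v - w) / e) - atan ((u - w) / e)))%R.
Proof.
move=> e0 uv.
pose F x := 2 * atan ((x - w) / e).
have dF (x : R) : is_derive x 1 F (2 * e / (e ^+ 2 + (w - x) ^+ 2)).
  rewrite /F; apply: is_derive_eq; rewrite /GRing.scale /=.
  field; rewrite (gt_eqF e0) andbT.
  by rewrite gt_eqF// ltr_wpDr ?sqr_ge0// exprn_gt0.
have cF x : {for x, continuous F} by exact: (continuous_derive_at (dF x)).
rewrite /Rintegral (@continuous_FTC2 _ _ F)//.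
- by rewrite /F /=; ring.
- by apply: continuous_subspaceT => x; exact: continuous_poisson.
- split; first by move=> x _; apply: ex_derive.
    by apply/cvg_at_right_filter; exact: cF.
  by apply/cvg_at_left_filter; exact: cF.
- by move=> x _; rewrite derive1E; apply: derive_val.
Qed.

(** The smoothed function is integrated over [x] in [[u, v]]; the inner integral of the Poisson
    kernel is a difference of arctangents, a smooth approximation of an indicator. *)
Lemma atan_smoothing (e u v : R) : 0 < e -> u < v ->
  (\int[m]_y (q y * (2 * (atan ((v - X y) / e) - atan ((u - X y) / e)))) =
   \int[mu]_x (\1_(`[u, v]%classic) x *
     (\int[m]_y (q y * (2 * e / (e ^+ 2 + (X y - x) ^+ 2))))))%R.
Proof.
move=> e0 uv.
transitivity (\int[m]_y (q y * \int[mu]_x (\1_(`[u, v]%classic) x * (2 * e / (e ^+ 2 + (X y - x) ^+ 2)))))%R.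
  apply: eq_Rintegral => y _; rewrite -Rintegral_poisson_segment//.
  rewrite Rintegral_mkcond; congr (_ * _)%R; apply: eq_Rintegral => x _.
  by rewrite patchE indicE; case: ifP => _; rewrite ?mul1r ?mul0r.
(* The maximum of the Poisson kernel; it supplies the dominating function of [x] alone for
   Fubini. *)
have b2 y x : 0 <= 2 * e / (e ^+ 2 + (X y - x) ^+ 2) <= 2 / e.
  have p0 : 0 < e ^+ 2 + (X y - x) ^+ 2 by rewrite ltr_wpDr ?sqr_ge0// exprn_gt0.
  apply/andP; split; first by rewrite divr_ge0 ?mulr_ge0 ?(ltW e0) ?(ltW p0).
  rewrite ler_pdivrMr//.
  have {1}-> : 2 * e = 2 / e * e ^+ 2 by field; rewrite gt_eqF.
  by rewrite ler_wpM2l ?divr_ge0 ?(ltW e0)// lerDl sqr_ge0.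
rewrite (@Rintegral_fubini _ _ _ _ m mu q (fun x => \1_(`[u, v]%classic) x * (2 / e))
   (fun y x => \1_(`[u, v]%classic) x * (2 * e / (e ^+ 2 + (X y - x) ^+ 2)))).
- apply: eq_Rintegral => x _; rewrite -RintegralZl//.
    by apply: eq_Rintegral => y _; ring.
  apply: (integrableM_bounded (M := 2 / e)) => //.
    apply: (measurableT_comp (f := fun z : R => 2 * e / (e ^+ 2 + (z - x) ^+ 2))) => //.
    apply: continuous_measurable_fun => z.
    apply: cvgM; first exact: cvg_cst.
    apply: cvgV; first by rewrite gt_eqF// ltr_wpDr ?sqr_ge0// exprn_gt0.
    apply: cvgD; first exact: cvg_cst.
    by apply: cvg_sqr; apply: cvgB; [exact: cvg_id|exact: cvg_cst].
  by move=> y; have /andP[h1 h2] := b2 y x; rewrite ger0_norm.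
- exact: iq.
- have := @integrableZr _ _ _ mu _ measurableT (2 / e) _ (integrable_indic_itv u v true false).
  by apply: eq_integrable => // x _ /=; rewrite EFinM.
- apply: measurable_funM.
    by apply: measurableT_comp => //; exact: measurable_snd.
  apply: (measurableT_comp (f := fun z : R => 2 * e / (e ^+ 2 + z ^+ 2))).
    apply: continuous_measurable_fun => z.
    apply: cvgM; first exact: cvg_cst.
    apply: cvgV; first by rewrite gt_eqF// ltr_wpDr ?sqr_ge0// exprn_gt0.
    by apply: cvgD; [exact: cvg_cst|apply: cvg_sqr; exact: cvg_id].
  apply: measurable_funB; last exact: measurable_snd.
  by apply: (measurableT_comp mX); exact: measurable_fst.
- by move=> x; rewrite mulr_ge0 ?divr_ge0 ?(ltW e0)// indicE ler0n.
- move=> y x; have /andP[h1 h2] := b2 y x.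
  by rewrite normrM (ger0_norm h1) ger0_norm ?indicE ?ler0n// ler_wpM2l// ler0n.
Qed.

End smoothing.

End FourierUniqueness.

Section AtanLimit.
Variable R : realType.

Lemma cvg_natS_pinfty : (n.+1%:R : R) @[n --> \oo] --> +oo.
Proof.
apply/cvgryPge => A; near=> n; apply: (@le_trans _ _ n%:R); last by rewrite ler_nat.
by near: n; exact: nbhs_infty_ger.
Unshelve. all: end_near. Qed.

Lemma natS_near (A : R) : \forall n \near \oo, A <= n.+1%:R.
Proof. by move: A; apply/cvgryPge; exact: cvg_natS_pinfty. Qed.

(* The shift by [n.+1] makes the limit left-continuous in [c] at [0]. *)
Lemma cvg_atan_step (c : R) :
  atan (n.+1%:R ^+ 2 * c + n.+1%:R) @[n --> \oo] --> (if 0 <= c then pi / 2 else - (pi / 2)).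
Proof.
have [c0|c0] := leP 0 c.
  apply: (cvg_comp (fun n : nat => n.+1%:R ^+ 2 * c + n.+1%:R) (@atan R)); last exact: cvgy_atan.
  apply/cvgryPge => A; near=> n; apply: (@le_trans _ _ n.+1%:R).
    near: n; exact: natS_near.
  by rewrite lerDr mulr_ge0// exprn_ge0.
have -> : (fun n : nat => atan (n.+1%:R ^+ 2 * c + n.+1%:R)) =
          (fun n : nat => - atan (- (n.+1%:R ^+ 2 * c + n.+1%:R))).
  by apply/funext => n; rewrite atanN opprK.
apply: cvgN.
apply: (cvg_comp (fun n : nat => - (n.+1%:R ^+ 2 * c + n.+1%:R)) (@atan R)); last exact: cvgy_atan.
apply/cvgryPge => A; near=> n.
have hA : A <= n.+1%:R by near: n; exact: natS_near.
have hc : 2 / - c <= n.+1%:R by near: n; exact: natS_near.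
rewrite ler_pdivrMr in hc; last by rewrite oppr_gt0.
apply: (le_trans hA).
have -> : - (n.+1%:R ^+ 2 * c + n.+1%:R) = n.+1%:R * (n.+1%:R * - c - 1) by ring.
by rewrite -[leLHS]mulr1 ler_wpM2l//; lra.
Unshelve. all: end_near. Qed.

End AtanLimit.

Section Uniqueness.
Variable R : realType.
Local Notation mu := (@lebesgue_measure R).

(** Dominated convergence with majorant [2 * pi * |q|]. The step functions jump from [pi / 2] to
    [- (pi / 2)] just after [X y = v] and [X y = u], so [v] is included and [u] excluded. *)
Lemma atan_step_limit d (T : measurableType d) (m : {sigma_finite_measure set T -> \bar R})
    (X q : T -> R) (u v : R) : u < v ->
  measurable_fun setT X -> m.-integrable setT (EFin \o q) ->
  (\int[m]_y (q y * (2 * (atan (n.+1%:R ^+ 2 * (v - X y) + n.+1%:R) -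
      atan (n.+1%:R ^+ 2 * (u - X y) + n.+1%:R))))%:E @[n --> \oo] -->
   \int[m]_y (q y * (2 * pi * \1_(`]u, v]%classic) (X y)))%:E)%E.
Proof.
move=> uv mX iq.
have mq : measurable_fun setT q by apply/measurable_EFinP; exact: measurable_int iq.
have mstep n w : measurable_fun setT (fun y => atan (n.+1%:R ^+ 2 * (w - X y) + n.+1%:R)).
  apply: measurableT_comp.
    exact: (continuous_measurable_fun (@continuous_atan R)).
  apply: measurable_funD => //; apply: measurable_funM => //.
  exact: measurable_funB.
have pi0 : (0 : R) <= pi by exact: pi_ge0.
pose g y := (2 * pi * `|q y|)%:E.
have [] := @dominated_convergence _ _ _ m setT measurableT
  (fun n y => (q y * (2 * (atan (n.+1%:R ^+ 2 * (v - X y) + n.+1%:R) -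
      atan (n.+1%:R ^+ 2 * (u - X y) + n.+1%:R))))%:E)
  (fun y => (q y * (2 * pi * \1_(`]u, v]%classic) (X y)))%:E) g.
- move=> n; apply/measurable_EFinP; apply: measurable_funM => //.
  by apply: measurable_funM => //; exact: measurable_funB.
- apply/measurable_EFinP; apply: measurable_funM => //.
  by apply: measurable_funM => //; apply: measurableT_comp => //.
- apply: aeW => y _; apply: cvg_EFin; first exact: nearW.
  have -> : (fine \o fun n : nat => (q y * (2 * (atan (n.+1%:R ^+ 2 * (v - X y) + n.+1%:R) -
      atan (n.+1%:R ^+ 2 * (u - X y) + n.+1%:R))))%:E) =
      (fun n : nat => q y * (2 * (atan (n.+1%:R ^+ 2 * (v - X y) + n.+1%:R) -
      atan (n.+1%:R ^+ 2 * (u - X y) + n.+1%:R)))) by [].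
  apply: cvgMr.
  have -> : (2 * pi * \1_(`]u, v]%classic) (X y))%R =
    (2 * ((if 0 <= v - X y then pi / 2 else - (pi / 2)) - (if 0 <= u - X y then pi / 2 else - (pi / 2))))%R :> R.
    rewrite indicE mem_setE in_itv /= !subr_ge0 ltNge.
    have [h1|h1] := leP (X y) u => /=.
      by rewrite (le_trans h1 (ltW uv)) /= subrr !mulr0.
    by have [h2|h2] := leP (X y) v => /=; field.
  by apply: cvgMr; apply: cvgB; exact: cvg_atan_step.
- have := @integrableZl _ _ _ m _ measurableT (2 * pi) _ (integrable_norm iq).
  by apply: eq_integrable => // y _ /=; rewrite EFinM.
- apply: aeW => y n _; rewrite /g lee_fin normrM mulrC ler_wpM2r//.
  have h1 := atan_gtNpi2 (n.+1%:R ^+ 2 * (v - X y) + n.+1%:R).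
  have h2 := atan_ltpi2 (n.+1%:R ^+ 2 * (v - X y) + n.+1%:R).
  have h3 := atan_gtNpi2 (n.+1%:R ^+ 2 * (u - X y) + n.+1%:R).
  have h4 := atan_ltpi2 (n.+1%:R ^+ 2 * (u - X y) + n.+1%:R).
  by rewrite ler_norml; apply/andP; split; lra.
by [].
Qed.

(** Equal transforms give equal Poisson smoothings, hence equal arctangent smoothings, and these
    converge to [2 * pi] times the two sides. *)
Lemma fourier_uniqueness d (T : measurableType d) (m : {sigma_finite_measure set T -> \bar R})
    (X q : T -> R) d' (T' : measurableType d') (m' : {sigma_finite_measure set T' -> \bar R})
    (X' q' : T' -> R) :
  measurable_fun setT X -> m.-integrable setT (EFin \o q) ->
  measurable_fun setT X' -> m'.-integrable setT (EFin \o q') ->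
  (forall t, \int[m]_y (q y * cos (t * X y)) = \int[m']_y (q' y * cos (t * X' y)))%R ->
  (forall t, \int[m]_y (q y * sin (t * X y)) = \int[m']_y (q' y * sin (t * X' y)))%R ->
  forall u v, u < v ->
  (\int[m]_y (q y * \1_(`]u, v]%classic) (X y)) =
   \int[m']_y (q' y * \1_(`]u, v]%classic) (X' y)))%R.
Proof.
move=> mX iq mX' iq' hc hs u v uv.
have pi0 : (0 : R) < pi by exact: pi_gt0.
have smooth n : (\int[m]_y (q y * (2 * (atan (n.+1%:R ^+ 2 * (v - X y) + n.+1%:R) -
      atan (n.+1%:R ^+ 2 * (u - X y) + n.+1%:R)))) =
  \int[m']_y (q' y * (2 * (atan (n.+1%:R ^+ 2 * (v - X' y) + n.+1%:R) -
      atan (n.+1%:R ^+ 2 * (u - X' y) + n.+1%:R)))))%R.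
  (* The smoothing width [1 / (n + 1)^2] is small against the shift [1 / (n + 1)] of the endpoints,
     so that mass sitting at [u] or [v] falls on a definite side in the limit. *)
  pose e : R := (n.+1%:R ^+ 2)^-1.
  have e0 : 0 < e by rewrite invr_gt0 exprn_gt0.
  have uv' : u + n.+1%:R^-1 < v + n.+1%:R^-1 by rewrite ltrD2r.
  have E w z : n.+1%:R ^+ 2 * (w - z) + n.+1%:R = (w + n.+1%:R^-1 - z) / e.
    rewrite /e invrK; have : n.+1%:R != 0 :> R by rewrite pnatr_eq0.
    by move: (n.+1%:R : R) => N N0; field.
  transitivity (\int[m]_y (q y * (2 *
      (atan ((v + n.+1%:R^-1 - X y) / e) - atan ((u + n.+1%:R^-1 - X y) / e)))))%R.
    by apply: eq_Rintegral => y _; rewrite !E.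
  transitivity (\int[m']_y (q' y * (2 *
      (atan ((v + n.+1%:R^-1 - X' y) / e) - atan ((u + n.+1%:R^-1 - X' y) / e)))))%R; last first.
    by apply: eq_Rintegral => y _; rewrite !E.
  rewrite !atan_smoothing//; apply: eq_Rintegral => x _; congr (_ * _)%R.
  rewrite !poisson_smoothing//; apply: eq_Rintegral => t _.
  by rewrite hc hs.
have fin1 d0 (T0 : measurableType d0) (m0 : {sigma_finite_measure set T0 -> \bar R}) (X0 q0 : T0 -> R) n :
    measurable_fun setT X0 -> m0.-integrable setT (EFin \o q0) ->
  (\int[m0]_y (q0 y * (2 * (atan (n.+1%:R ^+ 2 * (v - X0 y) + n.+1%:R) -
      atan (n.+1%:R ^+ 2 * (u - X0 y) + n.+1%:R))))%:E)%E \is a fin_num.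
  move=> mX0 iq0; apply: integrable_fin_num => //.
  apply: (integrableM_bounded (M := 2 * pi)) => //.
    apply: measurable_funM => //; apply: measurable_funB;
      apply: (measurableT_comp (continuous_measurable_fun (@continuous_atan R)));
      apply: measurable_funD => //; apply: measurable_funM => //; exact: measurable_funB.
  move=> y.
  have h1 := atan_gtNpi2 (n.+1%:R ^+ 2 * (v - X0 y) + n.+1%:R).
  have h2 := atan_ltpi2 (n.+1%:R ^+ 2 * (v - X0 y) + n.+1%:R).
  have h3 := atan_gtNpi2 (n.+1%:R ^+ 2 * (u - X0 y) + n.+1%:R).
  have h4 := atan_ltpi2 (n.+1%:R ^+ 2 * (u - X0 y) + n.+1%:R).
  by rewrite ler_norml; apply/andP; split; lra.
have L1 := atan_step_limit uv mX iq.
have L2 := atan_step_limit uv mX' iq'.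
have LL : (\int[m]_y (q y * (2 * pi * \1_(`]u, v]%classic) (X y)))%:E =
           \int[m']_y (q' y * (2 * pi * \1_(`]u, v]%classic) (X' y)))%:E)%E.
  have Efun : (fun n : nat => \int[m]_y (q y * (2 * (atan (n.+1%:R ^+ 2 * (v - X y) + n.+1%:R) -
      atan (n.+1%:R ^+ 2 * (u - X y) + n.+1%:R))))%:E)%E =
    (fun n : nat => \int[m']_y (q' y * (2 * (atan (n.+1%:R ^+ 2 * (v - X' y) + n.+1%:R) -
      atan (n.+1%:R ^+ 2 * (u - X' y) + n.+1%:R))))%:E)%E.
    apply/funext => n.
    rewrite -[LHS]fineK; last exact: fin1.
    rewrite -[RHS]fineK; last exact: fin1.
    by congr EFin; exact: smooth.
  rewrite Efun in L1.
  exact: (cvg_unique _ L1 L2).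
have fin2 d0 (T0 : measurableType d0) (m0 : {sigma_finite_measure set T0 -> \bar R}) (X0 q0 : T0 -> R) :
    measurable_fun setT X0 -> m0.-integrable setT (EFin \o q0) ->
  (\int[m0]_y (q0 y * \1_(`]u, v]%classic) (X0 y)) = (2 * pi)^-1 *
   fine (\int[m0]_y (q0 y * (2 * pi * \1_(`]u, v]%classic) (X0 y)))%:E)%E)%R.
  move=> mX0 iq0.
  rewrite -/(Rintegral m0 setT (fun y => q0 y * (2 * pi * \1_(`]u, v]%classic) (X0 y)))%R).
  have -> : (\int[m0]_y (q0 y * (2 * pi * \1_(`]u, v]%classic) (X0 y))) =
    \int[m0]_y (2 * pi * (q0 y * \1_(`]u, v]%classic) (X0 y))))%R.
    by apply: eq_Rintegral => y _; ring.
  rewrite RintegralZl//; first by rewrite mulKf// mulf_neq0// gt_eqF.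
  apply: (integrableM_bounded (M := 1)) => //.
    by apply: measurableT_comp.
  by move=> y; rewrite indicE ger0_norm ?ler0n// lern1 leq_b1.
by rewrite (fin2 _ _ _ _ _ mX iq) (fin2 _ _ _ _ _ mX' iq') LL.
Qed.

End Uniqueness.

(** * Two-sided Laplace transforms *)

Section ComplexExponential.
Variable R : realType.
Local Notation C := R[i].
Implicit Types (x a b : R) (w z : C).

Lemma mvt_bound (f df : R -> R) (k x : R) : 0 <= x ->
  (forall y : R, is_derive y 1 f (df y)) -> (forall y, 0 <= y <= x -> `|df y| <= k) ->
  `|f x - f 0| <= k * x.
Proof.
move=> x0 fd dk.
have [|c cx ->] := @MVT_segment R f df 0 x x0 (fun y _ => fd y).
  by apply: continuous_subspaceT => y; exact: (continuous_derive_at (fd y)).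
by rewrite subr0 normrM (ger0_norm x0) ler_wpM2r// dk.
Qed.

Lemma ler_norm_sin x : `|sin x| <= `|x|.
Proof.
wlog x0 : x / 0 <= x.
  move=> H; have [/H//|/ltW x0] := leP 0 x.
  by rewrite -normrN -sinN -(normrN x); apply: H; rewrite oppr_ge0.
have := @mvt_bound sin cos 1 x x0.
rewrite sin0 subr0 mul1r (ger0_norm x0); apply => // y _; exact: cos_max.
Qed.

Lemma ler_norm_1Bcos x : `|cos x - 1| <= x ^+ 2.
Proof.
have -> : cos x - 1 = - (2 * sin (x / 2) ^+ 2).
  have -> : cos x = cos ((x / 2) *+ 2) by congr cos; rewrite -mulr_natr; field.
  by rewrite cos_mulr2n -mulr_natr cos2sin2; ring.
rewrite normrN normrM normrX ger0_norm//.
have h := ler_norm_sin (x / 2).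
have h2 : `|sin (x / 2)| ^+ 2 <= `|x / 2| ^+ 2 by apply: lerXn2r; rewrite ?nnegrE.
have E : `|x / 2| ^+ 2 = x ^+ 2 / 4 by rewrite real_normK ?num_real//; field.
by have := sqr_ge0 x; lra.
Qed.

Lemma ler_norm_1Bcos1 x : `|cos x - 1| <= `|x|.
Proof.
wlog x0 : x / 0 <= x.
  move=> H; have [/H//|/ltW x0] := leP 0 x.
  by rewrite -(cosN x) -(normrN x); apply: H; rewrite oppr_ge0.
have := @mvt_bound cos (fun y => - sin y) 1 x x0.
rewrite cos0 mul1r (ger0_norm x0); apply => // y _; rewrite normrN; exact: sin_max.
Qed.

Lemma ler_norm_sinB x : `|sin x - x| <= x ^+ 2.
Proof.
wlog x0 : x / 0 <= x.
  move=> H; have [/H//|/ltW x0] := leP 0 x.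
  rewrite -normrN opprD -sinN -(sqrrN x); apply: H; by rewrite oppr_ge0.
have := @mvt_bound (fun y => sin y - y) (fun y => cos y - 1) x x x0.
rewrite sin0 !subr0 -expr2; apply => y /andP[y0 yx].
apply: le_trans (ler_norm_1Bcos1 y) _.
by rewrite ger0_norm.
Qed.

Lemma ler_norm_expRB1 x : `|expR x - 1| <= `|x| * expR `|x|.
Proof.
have h1 := expR_ge1Dx x; have h2 := expR_ge1Dx (- x).
have e0 := expR_gt0 x; have e1 : expR x * expR (- x) = 1 by rewrite -expRD subrr expR0.
have [x0|x0] := leP 0 x.
  rewrite (ger0_norm x0) ger0_norm; last lra.
  have : expR x * (1 - x) <= expR x * expR (- x) by rewrite ler_wpM2l// ltW.
  by rewrite e1; lra.
rewrite (ltr0_norm x0) ler0_norm; last by rewrite subr_le0 expR_le1 ltW.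
have : - x * 1 <= - x * expR (- x).
  by apply: ler_wpM2l; lra.
lra.
Qed.

(** From [exp x * (1 - x) <= 1] follows [exp x - 1 - x <= x * (exp x - 1)], and the last factor is
    again of first order. *)
Lemma ler_norm_expRB1x x : `|expR x - 1 - x| <= x ^+ 2 * expR `|x|.
Proof.
have h1 := expR_ge1Dx x.
rewrite ger0_norm; last lra.
have h : expR x - 1 - x <= `|x| * `|expR x - 1|.
  have e0 := expR_gt0 x; have e1 : expR x * expR (- x) = 1 by rewrite -expRD subrr expR0.
  have h2 := expR_ge1Dx (- x).
  have h3 : expR x * (1 - x) <= 1 by rewrite -[leRHS]e1 ler_wpM2l// ltW.
  rewrite -normrM; apply: le_trans (ler_norm _); lra.
apply: (le_trans h).
rewrite -[x ^+ 2]real_normK ?num_real// expr2 -mulrA ler_wpM2l//.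
exact: ler_norm_expRB1.
Qed.

Lemma cabs_cexp w : cabs (cexp w) = expR (complex.Re w).
Proof. by rewrite /cexp cabsM cabs_cis cabs_real ger0_norm ?expR_ge0// mulr1. Qed.

Lemma cexpD w z : cexp (w + z) = cexp w * cexp z.
Proof.
by apply: complex_ext; rewrite /cexp !cE /= expRD ?cosD ?sinD; ring.
Qed.

(** With [w = a + i b], the real part splits as [(exp a - 1 - a) + exp a (cos b - 1)] and the
    imaginary part as [exp a (sin b - b) + b (exp a - 1)]; every summand is of second order. *)
Lemma cabs_cexpB w : cabs (cexp w - 1 - w) <= 4 * cabs w ^+ 2 * expR (cabs w).
Proof.
set a := complex.Re w; set b := complex.Im w.
have ha : `|a| <= cabs w := ler_Re_cabs w.
have hb : `|b| <= cabs w := ler_Im_cabs w.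
set E := expR (cabs w).
have E1 : 1 <= E by rewrite -expR0 ler_expR cabs_ge0.
have Ea : expR `|a| <= E by rewrite ler_expR.
have Ea' : expR a <= E by apply: le_trans Ea; rewrite ler_expR ler_norm.
have h1 : `|expR a - 1 - a| <= a ^+ 2 * E.
  by apply: le_trans (ler_norm_expRB1x a) _; rewrite ler_wpM2l// sqr_ge0.
have h2 : `|expR a * (cos b - 1)| <= E * b ^+ 2.
  by rewrite normrM (ger0_norm (expR_ge0 _)) ler_pM ?expR_ge0// ler_norm_1Bcos.
have h3 : `|expR a * (sin b - b)| <= E * b ^+ 2.
  by rewrite normrM (ger0_norm (expR_ge0 _)) ler_pM ?expR_ge0// ler_norm_sinB.
have h4 : `|b * (expR a - 1)| <= `|b| * (`|a| * E).
  rewrite normrM ler_wpM2l//; apply: le_trans (ler_norm_expRB1 a) _.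
  by rewrite ler_wpM2l.
have hab : `|b| * `|a| <= cabs w ^+ 2.
  by rewrite expr2 ler_pM.
have hw := cabs_sqr w; rewrite -/a -/b in hw.
have a2 := sqr_ge0 a; have b2 := sqr_ge0 b.
apply: le_trans (cabs_leD _) _; rewrite /cexp !cE /= -/a -/b.
have -> : expR a * cos b - 0 * sin b - 1 - a =
  (expR a - 1 - a) + expR a * (cos b - 1) by ring.
have -> : expR a * sin b + 0 * cos b - 0 - b =
  expR a * (sin b - b) + b * (expR a - 1) by ring.
have k1 := ler_normD (expR a - 1 - a) (expR a * (cos b - 1)).
have k2 := ler_normD (expR a * (sin b - b)) (b * (expR a - 1)).
have k3 : `|b| * (`|a| * E) <= cabs w ^+ 2 * E by rewrite mulrA ler_wpM2r// (le_trans ler01).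
have k4 : a ^+ 2 * E + E * b ^+ 2 + E * b ^+ 2 <= 2 * (cabs w ^+ 2 * E).
  rewrite hw; have : 0 <= a ^+ 2 * E by rewrite mulr_ge0// (le_trans ler01).
  lra.
have k5 : 0 <= cabs w ^+ 2 * E by rewrite mulr_ge0 ?sqr_ge0// (le_trans ler01).
lra.
Qed.

End ComplexExponential.

(** * Componentwise integration of complex-valued functions *)

Section ComplexIntegral.
Variable R : realType.
Local Notation C := R[i].
Local Notation mu := (@lebesgue_measure R).
Implicit Types (f g k : R -> C) (s w : C).

Definition cint f : C :=
  (\int[mu]_y (complex.Re (f y)))%R +i* (\int[mu]_y (complex.Im (f y)))%R.

Definition cmeas f := measurable_fun setT (fun y => complex.Re (f y)) /\
  measurable_fun setT (fun y => complex.Im (f y)).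

Definition cintegrable f := mu.-integrable setT (EFin \o (fun y => complex.Re (f y))) /\
  mu.-integrable setT (EFin \o (fun y => complex.Im (f y))).

Lemma integrableZ_EFin (k : R) (f : R -> R) : mu.-integrable setT (EFin \o f) ->
  mu.-integrable setT (EFin \o (fun y => k * f y)).
Proof.
move=> fi; have := @integrableZl _ _ _ mu _ measurableT k _ fi.
by apply: eq_integrable => // y _ /=; rewrite EFinM.
Qed.

Lemma integrableD_EFin (f g : R -> R) : mu.-integrable setT (EFin \o f) ->
  mu.-integrable setT (EFin \o g) -> mu.-integrable setT (EFin \o (fun y => f y + g y)).
Proof.
move=> fi gi; have := integrableD measurableT fi gi.
by apply: eq_integrable.
Qed.

Lemma integrableB_EFin (f g : R -> R) : mu.-integrable setT (EFin \o f) ->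
  mu.-integrable setT (EFin \o g) -> mu.-integrable setT (EFin \o (fun y => f y - g y)).
Proof.
move=> fi gi; have := integrableB measurableT fi gi.
by apply: eq_integrable.
Qed.

Lemma cintD f g : cintegrable f -> cintegrable g ->
  cint (fun y => f y + g y) = cint f + cint g.
Proof.
move=> [f1 f2] [g1 g2]; apply: complex_ext; rewrite !cE /cint /= -RintegralD//.
- by apply: eq_Rintegral => y _; rewrite cE.
- by apply: eq_Rintegral => y _; rewrite cE.
Qed.

Lemma cintZ (k : C) f : cintegrable f -> cint (fun y => k * f y) = k * cint f.
Proof.
move=> [f1 f2]; apply: complex_ext; rewrite !cE /cint /= -!RintegralZl//.
- rewrite -RintegralB//; [|exact: integrableZ_EFin|exact: integrableZ_EFin].
  by apply: eq_Rintegral => y _; rewrite cE.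
- rewrite -RintegralD//; [|exact: integrableZ_EFin|exact: integrableZ_EFin].
  by apply: eq_Rintegral => y _; rewrite cE.
Qed.

Lemma cintegrableD f g : cintegrable f -> cintegrable g -> cintegrable (fun y => f y + g y).
Proof.
move=> [f1 f2] [g1 g2]; split.
- by under eq_fun do rewrite ReD; exact: integrableD_EFin.
- by under eq_fun do rewrite ImD; exact: integrableD_EFin.
Qed.

Lemma cintegrableZ (k : C) f : cintegrable f -> cintegrable (fun y => k * f y).
Proof.
move=> [f1 f2]; split.
- by under eq_fun do rewrite ReM; apply: integrableB_EFin; exact: integrableZ_EFin.
- by under eq_fun do rewrite ImM; apply: integrableD_EFin; exact: integrableZ_EFin.
Qed.

Lemma cintB f g : cintegrable f -> cintegrable g ->
  cint (fun y => f y - g y) = cint f - cint g.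
Proof.
move=> hf hg; have E : (fun y => f y - g y) = (fun y => f y + (-1) * g y).
  by apply/funext => y; rewrite mulN1r.
by rewrite E cintD ?cintZ ?mulN1r//; exact: cintegrableZ.
Qed.

Lemma cintegrableB f g : cintegrable f -> cintegrable g -> cintegrable (fun y => f y - g y).
Proof.
move=> hf hg; have -> : (fun y => f y - g y) = (fun y => f y + (-1) * g y).
  by apply/funext => y; rewrite mulN1r.
by apply: cintegrableD => //; exact: cintegrableZ.
Qed.

Lemma cintegrable_dominated f (h : R -> R) : cmeas f -> mu.-integrable setT (EFin \o h) ->
  (forall y, cabs (f y) <= h y) -> cintegrable f.
Proof.
move=> [m1 m2] ih fh; split.
- apply: (@integrable_dominated _ _ _ mu _ h) => // y.
  exact: le_trans (ler_Re_cabs _) (fh y).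
- apply: (@integrable_dominated _ _ _ mu _ h) => // y.
  exact: le_trans (ler_Im_cabs _) (fh y).
Qed.

Lemma Rintegral_abs_le (f h : R -> R) : mu.-integrable setT (EFin \o f) ->
  mu.-integrable setT (EFin \o h) -> (forall y, `|f y| <= h y) ->
  `|\int[mu]_y f y| <= \int[mu]_y h y.
Proof.
move=> fi hi fh; apply: le_trans (le_normr_Rintegral _ fi) _ => //.
by apply: le_Rintegral => //; exact: integrable_norm.
Qed.

(** The factor [2] comes from bounding real and imaginary part separately. *)
Lemma cabs_cint f (h : R -> R) : cintegrable f -> mu.-integrable setT (EFin \o h) ->
  (forall y, cabs (f y) <= h y) -> cabs (cint f) <= 2 * \int[mu]_y h y.
Proof.
move=> [f1 f2] ih fh; apply: le_trans (cabs_leD _) _; rewrite /cint /=.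
have h1 : `|\int[mu]_y complex.Re (f y)| <= \int[mu]_y h y.
  by apply: Rintegral_abs_le => // y; exact: le_trans (ler_Re_cabs _) (fh y).
have h2 : `|\int[mu]_y complex.Im (f y)| <= \int[mu]_y h y.
  by apply: Rintegral_abs_le => // y; exact: le_trans (ler_Im_cabs _) (fh y).
by rewrite mulr_natl mulr2n lerD.
Qed.

Lemma cmeasM f g : cmeas f -> cmeas g -> cmeas (fun y => f y * g y).
Proof.
move=> [f1 f2] [g1 g2]; split.
- under eq_fun do rewrite ReM.
  by apply: measurable_funB; apply: measurable_funM.
- under eq_fun do rewrite ImM.
  by apply: measurable_funD; apply: measurable_funM.
Qed.

Lemma cmeasD f g : cmeas f -> cmeas g -> cmeas (fun y => f y + g y).
Proof.
move=> [f1 f2] [g1 g2]; split.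
- by under eq_fun do rewrite ReD; exact: measurable_funD.
- by under eq_fun do rewrite ImD; exact: measurable_funD.
Qed.

Lemma measurable_cabs f : cmeas f -> measurable_fun setT (fun y => cabs (f y)).
Proof.
move=> [f1 f2].
have -> : (fun y => cabs (f y)) = (fun y => Num.sqrt (complex.Re (f y) ^+ 2 + complex.Im (f y) ^+ 2)).
  by apply/funext => y; rewrite -cabs_sqr sqrtr_sqr ger0_norm// cabs_ge0.
apply: measurableT_comp; first exact: (continuous_measurable_fun (@sqrt_continuous R)).
by apply: measurable_funD; apply: measurable_funX.
Qed.

Lemma cmeas_cst (k : C) : cmeas (fun=> k).
Proof. by split; exact: measurable_cst. Qed.

Lemma cmeasB f g : cmeas f -> cmeas g -> cmeas (fun y => f y - g y).
Proof.
move=> hf hg; have -> : (fun y => f y - g y) = (fun y => f y + (-1) * g y).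
  by apply/funext => y; rewrite mulN1r.
by apply: cmeasD => //; apply: cmeasM => //; exact: cmeas_cst.
Qed.

Lemma cmeas_real (f : R -> R) : measurable_fun setT f -> cmeas (fun y => (f y)%:C).
Proof. by move=> mf; split => //=; exact: measurable_cst. Qed.

Lemma cmeas_cexp s : cmeas (fun y => cexp (s * y%:C)).
Proof.
have E y : s * y%:C = (complex.Re s * y) +i* (complex.Im s * y).
  by apply: complex_ext; rewrite !cE /=; ring.
have h1 : measurable_fun setT (fun y : R => expR (complex.Re s * y)).
  by apply: measurableT_comp => //; exact: measurable_funM.
split.
- under eq_fun do rewrite E /cexp cE /= mul0r subr0.
  apply: measurable_funM => //.
  by apply: continuous_measurable_fun; exact: continuous_cosZ.
- under eq_fun do rewrite E /cexp cE /= mul0r addr0.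
  apply: measurable_funM => //.
  apply: (measurableT_comp (continuous_measurable_fun (@continuous_sin R))).
  exact: measurable_funM.
Qed.

End ComplexIntegral.

(** * Holomorphy of two-sided Laplace transforms *)

Section Laplace.
Variable R : realType.
Local Notation C := R[i].
Local Notation mu := (@lebesgue_measure R).
Implicit Types (k : R -> C) (s w : C) (al : R).

Definition laplace k s : C := cint (fun y => cexp (s * y%:C) * k y).

(** [al] bounds the abscissa of absolute convergence from above; there is no bound on the right. *)
Definition laplace_dom al k := cmeas k /\ forall sg : R, al < sg ->
  mu.-integrable setT (EFin \o (fun y => expR (sg * y) * cabs (k y))).

Lemma cabs_cexp_real s (y : R) : cabs (cexp (s * y%:C)) = expR (complex.Re s * y).
Proof. by rewrite cabs_cexp !cE /= mulr0 subr0. Qed.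

Lemma cintegrable_laplace al k s : laplace_dom al k -> al < complex.Re s ->
  cintegrable (fun y => cexp (s * y%:C) * k y).
Proof.
move=> [mk ik] als.
apply: (cintegrable_dominated (h := fun y => expR (complex.Re s * y) * cabs (k y))).
- by apply: cmeasM => //; exact: cmeas_cexp.
- exact: ik.
- by move=> y; rewrite cabsM cabs_cexp_real.
Qed.

(* The quadratic factor of Taylor's bound is absorbed by [exp (2 delta |y|)]. *)
Lemma cexp_remainder (w : C) (y delta : R) : 0 < delta -> cabs w <= delta ->
  cabs (cexp (w * y%:C) - 1 - w * y%:C) <=
  cabs w ^+ 2 * (16 / delta ^+ 2) * (expR (2 * delta * y) + expR (- (2 * delta * y))).
Proof.
move=> d0 wd; apply: le_trans (cabs_cexpB _) _.
rewrite cabsM cabs_real exprMn.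
have h1 : expR (cabs w * `|y|) <= expR (delta * `|y|) by rewrite ler_expR ler_wpM2r.
have h2 : delta ^+ 2 * `|y| ^+ 2 <= 4 * expR (delta * `|y|).
  have := expR_ge1Dx (delta * `|y| / 2) => h.
  have dy : 0 <= delta * `|y| by rewrite mulr_ge0// ltW.
  have E : expR (delta * `|y|) = expR (delta * `|y| / 2) ^+ 2.
    by rewrite -expRM_natl; congr expR; field.
  have : (delta * `|y| / 2) ^+ 2 <= expR (delta * `|y| / 2) ^+ 2.
    by apply: lerXn2r; rewrite ?nnegrE ?expR_ge0//; lra.
  by rewrite -E !exprMn; lra.
have h3 : expR (delta * `|y|) * expR (delta * `|y|) <= expR (2 * delta * y) + expR (- (2 * delta * y)).
  rewrite -expRD; have [y0|y0] := leP 0 y.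
    have -> : delta * `|y| + delta * `|y| = 2 * delta * y by rewrite ger0_norm//; ring.
    by rewrite lerDl expR_ge0.
  have -> : delta * `|y| + delta * `|y| = - (2 * delta * y) by rewrite ltr0_norm//; ring.
  by rewrite lerDr expR_ge0.
have h4 : `|y| ^+ 2 <= 4 / delta ^+ 2 * expR (delta * `|y|).
  by rewrite mulrAC ler_pdivlMr ?exprn_gt0// mulrC.
have -> : 4 * (cabs w ^+ 2 * `|y| ^+ 2) * expR (cabs w * `|y|) =
  cabs w ^+ 2 * (4 * (`|y| ^+ 2 * expR (cabs w * `|y|))) by ring.
rewrite -[leRHS]mulrA ler_wpM2l ?sqr_ge0//.
have -> : 16 / delta ^+ 2 = 4 * (4 / delta ^+ 2) by field; rewrite gt_eqF.
rewrite -[leRHS]mulrA ler_wpM2l//.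
apply: (@le_trans _ _ (4 / delta ^+ 2 * expR (delta * `|y|) * expR (delta * `|y|))).
  by apply: ler_pM => //; rewrite ?expR_ge0 ?exprn_ge0.
by rewrite -mulrA ler_wpM2l// divr_ge0// exprn_ge0// ltW.
Qed.

(** The derivative is the transform of [y * k y]. The Taylor remainder of the exponential costs two
    extra exponentials, at abscissas [Re s + 2 delta] and [Re s - 2 delta], and is quadratic in
    [w - s]. *)
Lemma holomorphic_laplace al k s : laplace_dom al k -> al < complex.Re s ->
  holomorphic_at (laplace k) s.
Proof.
move=> kd als; have [mk ik] := kd.
(* The quarter leaves [Re s - 2 * delta] strictly to the right of [al]. *)
pose delta := (complex.Re s - al) / 4.
have d0 : 0 < delta by rewrite /delta; lra.
pose sg := complex.Re s.
have i1 := ik (sg + 2 * delta) ltac:(by rewrite /sg /delta; lra).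
have i2 := ik (sg - 2 * delta) ltac:(by rewrite /sg /delta; lra).
pose h y := (expR ((sg + 2 * delta) * y) * cabs (k y)) + (expR ((sg - 2 * delta) * y) * cabs (k y)).
have ih : mu.-integrable setT (EFin \o h) by exact: integrableD_EFin.
have hE y : h y = expR (sg * y) * (expR (2 * delta * y) + expR (- (2 * delta * y))) * cabs (k y).
  by rewrite /h mulrDr -!expRD mulrDl; congr (expR _ * _ + expR _ * _); ring.
have h0 y : 0 <= h y by rewrite addr_ge0// mulr_ge0 ?expR_ge0 ?cabs_ge0.
have cI : cintegrable (fun y => cexp (s * y%:C) * (y%:C * k y)).
  apply: (cintegrable_dominated (h := fun y => (4 / delta) * h y)).
  - apply: cmeasM; first exact: cmeas_cexp.
    by apply: cmeasM => //; apply: cmeas_real; exact: measurable_id.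
  - exact: integrableZ_EFin.
  - move=> y; rewrite cabsM cabs_cexp_real cabsM cabs_real hE -/sg.
    have hy : `|y| <= 4 / delta * (expR (2 * delta * y) + expR (- (2 * delta * y))).
      rewrite mulrAC ler_pdivlMr//.
      have a1 := expR_ge1Dx (2 * delta * y); have a2 := expR_ge1Dx (- (2 * delta * y)).
      have a3 := expR_ge0 (2 * delta * y); have a4 := expR_ge0 (- (2 * delta * y)).
      by have [y0|y0] := leP 0 y; rewrite ?(ger0_norm y0) ?(ltr0_norm y0); lra.
    rewrite [leLHS](_ : _ = expR (sg * y) * `|y| * cabs (k y)); last by ring.
    rewrite [leRHS](_ : _ = expR (sg * y) * (4 / delta *
      (expR (2 * delta * y) + expR (- (2 * delta * y)))) * cabs (k y)); last by ring.
    by rewrite ler_wpM2r ?cabs_ge0// ler_wpM2l ?expR_ge0.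
set l := cint (fun y => cexp (s * y%:C) * (y%:C * k y)).
pose K := 2 * (16 / delta ^+ 2 * \int[mu]_y h y).
have K0 : 0 <= K.
  apply: mulr_ge0 => //; apply: mulr_ge0; first by rewrite divr_ge0// exprn_ge0// ltW.
  by apply: Rintegral_ge0 => y _; exact: h0.
have bound w : cabs (w - s) < delta ->
    cabs (laplace k w - laplace k s - (w - s) * l) <= K * cabs (w - s) ^+ 2.
  move=> wd.
  have wal : al < complex.Re w.
    have := le_lt_trans (ler_Re_cabs _) wd; rewrite !cE ltr_norml => /andP[+ _].
    by rewrite /delta; lra.
  have c1 := cintegrable_laplace kd wal; have c2 := cintegrable_laplace kd als.
  rewrite /laplace -cintB// -cintZ// -cintB//; [|exact: cintegrableB|exact: cintegrableZ].
  have -> : K * cabs (w - s) ^+ 2 =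
      2 * \int[mu]_y (cabs (w - s) ^+ 2 * (16 / delta ^+ 2) * h y).
    by rewrite RintegralZl// /K; ring.
  apply: cabs_cint.
  - by apply: cintegrableB; [exact: cintegrableB|exact: cintegrableZ].
  - exact: integrableZ_EFin.
  move=> y.
  have -> : cexp (w * y%:C) * k y - cexp (s * y%:C) * k y - (w - s) * (cexp (s * y%:C) * (y%:C * k y))
     = cexp (s * y%:C) * (cexp ((w - s) * y%:C) - 1 - (w - s) * y%:C) * k y.
    have -> : w * y%:C = s * y%:C + (w - s) * y%:C by ring.
    by rewrite cexpD; ring.
  rewrite cabsM cabsM cabs_cexp_real hE -/sg.
  rewrite [leRHS](_ : _ = expR (sg * y) * (cabs (w - s) ^+ 2 *
      (16 / delta ^+ 2) * (expR (2 * delta * y) + expR (- (2 * delta * y)))) * cabs (k y));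
      last by ring.
  by rewrite ler_wpM2r ?cabs_ge0// ler_wpM2l ?expR_ge0// cexp_remainder// ltW.
exists l => e e0.
exists (Num.min delta (e / (K + 1))); split.
  by rewrite lt_min d0 divr_gt0//; lra.
move=> w /andP[ws0]; rewrite lt_min => /andP[wd we].
have ws : w - s != 0 by rewrite -cabs_gt0.
have -> : (laplace k w - laplace k s) / (w - s) - l =
   (laplace k w - laplace k s - (w - s) * l) / (w - s) by field.
rewrite cabsM cabsV ltr_pdivrMr//.
apply: le_lt_trans (bound _ wd) _.
rewrite expr2 mulrA ltr_pM2r//.
rewrite ltr_pdivlMr in we; last by lra.
by apply: le_lt_trans we; rewrite mulrC ler_wpM2l ?cabs_ge0//; lra.
Qed.

End Laplace.

(** * Mellin representations of [Gamma(s) Phi(s, a, z)] *)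

Section ExpSubstitution.
Variable R : realType.
Local Notation mu := (@lebesgue_measure R).
Implicit Types (G H : R -> R) (x y : R).

Lemma derive1_expR : (@expR R)^`() = @expR R.
Proof. by apply/funext => x; rewrite derive1E; apply: derive_val. Qed.

Lemma natP (x : R) : exists n : nat, x <= n%:R.
Proof.
by exists (Num.bound `|x|); rewrite (le_trans (ler_norm x))// ltW// archi_boundP.
Qed.

(** Substitution on the compact intervals [[exp (- n), exp n]] and [[- n, n]], followed by monotone
    passage to their unions. *)
Lemma ge0_integral_exp_substitution G : (forall x, 0 < x -> {for x, continuous G}) ->
  (forall x, 0 < x -> 0 <= G x) ->
  (\int[mu]_(x in `]0%R, +oo[) (G x)%:E = \int[mu]_y (G (expR y) * expR y)%:E)%E.
Proof.
move=> cG G0.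
pose A (n : nat) : set R := `[expR (- n%:R), expR n%:R]%classic.
pose B (n : nat) : set R := `[(- n%:R), n%:R]%classic.
have nm (m n : nat) : (m <= n)%N -> (m%:R : R) <= n%:R by rewrite ler_nat.
have ndA : nondecreasing_seq A.
  move=> m n mn; rewrite subsetEset => x; rewrite /A /= !in_itv /= => /andP[h1 h2].
  apply/andP; split.
    by apply: le_trans h1; rewrite ler_expR lerN2 nm.
  by apply: (le_trans h2); rewrite ler_expR nm.
have ndB : nondecreasing_seq B.
  move=> m n mn; rewrite subsetEset => x; rewrite /B /= !in_itv /= => /andP[h1 h2].
  apply/andP; split.
    by apply: le_trans h1; rewrite lerN2 nm.
  by apply: (le_trans h2); rewrite nm.
have UA : \bigcup_n A n = `]0, +oo[%classic.
  apply/seteqP; split => [x [n _]|x]; rewrite /A /= !in_itv /= ?andbT.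
    by move=> /andP[h1 _]; apply: lt_le_trans h1; exact: expR_gt0.
  move=> x0; have [n hn] := natP `|ln x|.
  exists n => //; rewrite /A /= in_itv /= -(lnK x0) !ler_expR.
  by rewrite -ler_norml.
have UB : \bigcup_n B n = setT.
  apply/seteqP; split => // x _; have [n hn] := natP `|x|.
  by exists n => //; rewrite /B /= in_itv /= -ler_norml.
have cGE y : {for y, continuous (fun y => G (expR y) * expR y)}.
  apply: cvgM; last exact: continuous_expR.
  apply: (@continuous_comp _ _ _ (@expR R) G); first exact: continuous_expR.
  by apply: cG; exact: expR_gt0.
have eqn n : (\int[mu]_(x in A n) (G x)%:E = \int[mu]_(y in B n) (G (expR y) * expR y)%:E)%E.
  have n0 : (- n%:R : R) <= n%:R by rewrite -subr_ge0 opprK addr_ge0.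
  rewrite /A /B (@integration_by_substitution_increasing R (@expR R) G (- n%:R) n%:R n0).
  - by rewrite derive1_expR.
  - by move=> x y _ _; rewrite ltr_expR.
  - by move=> x _; rewrite derive1_expR; exact: continuous_expR.
  - by rewrite derive1_expR; apply/cvg_ex; exists (expR (- n%:R)); apply: cvg_at_right_filter; exact: continuous_expR.
  - by rewrite derive1_expR; apply/cvg_ex; exists (expR n%:R); apply: cvg_at_left_filter; exact: continuous_expR.
  - split => [x _||]; first exact: derivable_expR.
    + by apply: cvg_at_right_filter; exact: continuous_expR.
    + by apply: cvg_at_left_filter; exact: continuous_expR.
  - apply: continuous_in_subspaceT => x; rewrite inE ?/A /= in_itv /= => /andP[h1 _].
    by apply: cG; apply: lt_le_trans h1; exact: expR_gt0.
have mA : forall i, measurable_fun (A i) (fun x => (G x)%:E).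
  move=> i; have cGi : {within A i, continuous G}.
    apply: continuous_in_subspaceT => x; rewrite inE ?/A /= in_itv /= => /andP[h1 _].
    by apply: cG; apply: lt_le_trans h1; exact: expR_gt0.
  apply/measurable_EFinP.
  exact: (subspace_continuous_measurable_fun (measurable_itv _) cGi).
have L1 := @ge0_nondecreasing_set_cvg_integral _ (measurableTypeR R) R A (fun x => (G x)%:E) mu ndA
   (fun i => measurable_itv _) mA.
have {}L1 : (\int[mu]_(x in A i) (G x)%:E @[i --> \oo] --> \int[mu]_(x in \bigcup_i A i) (G x)%:E)%E.
  apply: L1 => i x; rewrite /A /= in_itv /= => /andP[h1 _].
  by rewrite lee_fin G0//; apply: lt_le_trans h1; exact: expR_gt0.
have mB : forall i, measurable_fun (B i) (fun y => (G (expR y) * expR y)%:E).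
  move=> i; apply/measurable_EFinP/measurable_funTS.
  by apply: continuous_measurable_fun => y; exact: cGE.
have L2 := @ge0_nondecreasing_set_cvg_integral _ (measurableTypeR R) R B (fun y => (G (expR y) * expR y)%:E) mu ndB
   (fun i => measurable_itv _) mB.
have {}L2 : (\int[mu]_(y in B i) (G (expR y) * expR y)%:E @[i --> \oo] -->
   \int[mu]_(y in \bigcup_i B i) (G (expR y) * expR y)%:E)%E.
  by apply: L2 => i x _; rewrite lee_fin mulr_ge0 ?expR_ge0// G0// expR_gt0.
have E : (fun i => \int[mu]_(x in A i) (G x)%:E)%E = (fun i => \int[mu]_(y in B i) (G (expR y) * expR y)%:E)%E.
  by apply/funext => n; exact: eqn.
rewrite E in L1; rewrite -UA; move: L2; rewrite UB => L2.
exact: (cvg_unique _ L1 L2).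
Qed.

(** Signed [G] is written as [(G + H) - H], a difference of nonnegative functions. *)
Lemma Rintegral_exp_substitution G H : (forall x, 0 < x -> {for x, continuous G}) ->
  (forall x, 0 < x -> {for x, continuous H}) ->
  (forall x, 0 < x -> `|G x| <= H x) ->
  mu.-integrable setT (EFin \o (fun y => H (expR y) * expR y)) ->
  (\int[mu]_(x in `]0, +oo[) G x = \int[mu]_y (G (expR y) * expR y))%R.
Proof.
move=> cG cH GH iH.
have H0 x : 0 < x -> 0 <= H x by move=> /GH; exact: le_trans.
have GH0 x : 0 < x -> 0 <= G x + H x.
  by move=> /GH; rewrite ler_norml => /andP[h _]; lra.
have cGH x : 0 < x -> {for x, continuous (fun x => G x + H x)}.
  by move=> x0; apply: cvgD; [exact: cG|exact: cH].
have s1 := ge0_integral_exp_substitution cGH GH0.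
have s2 := ge0_integral_exp_substitution cH H0.
have cE (K : R -> R) : (forall x, 0 < x -> {for x, continuous K}) ->
    measurable_fun setT (fun y => K (expR y) * expR y).
  move=> cK; apply: continuous_measurable_fun => y; apply: cvgM; last exact: continuous_expR.
  apply: (@continuous_comp _ _ _ (@expR R) K); first exact: continuous_expR.
  by apply: cK; exact: expR_gt0.
have iGe : mu.-integrable setT (EFin \o (fun y => G (expR y) * expR y)).
  apply: (@integrable_dominated _ _ _ mu _ (fun y => H (expR y) * expR y)) => //.
    exact: cE.
  by move=> y; rewrite normrM (ger0_norm (expR_ge0 y)) ler_wpM2r ?expR_ge0// GH// expR_gt0.
have iGHe : mu.-integrable setT (EFin \o (fun y => (G (expR y) + H (expR y)) * expR y)).
  under eq_fun do rewrite mulrDl.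
  exact: integrableD_EFin.
have fin (K : R -> R) : (forall x, 0 < x -> {for x, continuous K}) ->
    (forall x, 0 < x -> 0 <= K x) ->
    mu.-integrable setT (EFin \o (fun y => K (expR y) * expR y)) ->
    mu.-integrable `]0, +oo[ (EFin \o K).
  move=> cK K0 iK; apply/integrableP; split.
    have cKi : {within `]0, +oo[, continuous K}.
      by apply: continuous_in_subspaceT => x; rewrite inE /= in_itv /= andbT => /cK.
    apply/measurable_EFinP.
    exact: (subspace_continuous_measurable_fun (measurable_itv _) cKi).
  have -> : (\int[mu]_(x in `]0%R, +oo[) `|(EFin \o K) x| = \int[mu]_(x in `]0%R, +oo[) (K x)%:E)%E.
    apply: eq_integral => x; rewrite inE /= in_itv /= andbT => x0.
    by rewrite ger0_norm// K0.
  rewrite ge0_integral_exp_substitution//.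
  exact: (integrable_lty measurableT iK).
have i1 := fin _ cGH GH0 iGHe; have i2 := fin _ cH H0 iH.
transitivity (\int[mu]_(x in `]0%R, +oo[) ((G x + H x) - H x))%R.
  by apply: eq_Rintegral => x _; rewrite addrK.
rewrite RintegralB// /Rintegral s1 s2.
rewrite -/(Rintegral mu setT (fun y => (G (expR y) + H (expR y)) * expR y)%R).
rewrite -/(Rintegral mu setT (fun y => H (expR y) * expR y)%R).
rewrite -RintegralB//.
by apply: eq_Rintegral => y _; rewrite mulrDl addrK.
Qed.

End ExpSubstitution.

Section Shift.
Variable R : realType.
Local Notation mu := (@lebesgue_measure R).
Implicit Types (G : R -> R).

Lemma ge0_integral_shift G (c : R) : continuous G -> (forall x, 0 <= G x) ->
  (\int[mu]_x (G x)%:E = \int[mu]_x (G (x + c)%R)%:E)%E.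
Proof.
move=> cG G0.
pose F (x : R) := x + c.
have F' : F^`() = cst (1 : R).
  apply/funext => x; rewrite derive1E.
  have h : is_derive x 1 F 1 by apply: is_derive_eq; rewrite addr0.
  by rewrite derive_val.
rewrite (@increasing_ge0_integration_by_substitutionT R F G) //.
- by apply: eq_integral => x _; rewrite /= F' /= mulr1.
- by move=> x y; rewrite /F ltrD2r.
- by rewrite F' => x; exact: cvg_cst.
- by rewrite F'; exact: is_cvg_cst.
- by rewrite F'; exact: is_cvg_cst.
- exact: cvg_addrr_Ny.
- exact: cvg_addrr.
Qed.

(** Reduced to nonnegative functions by [G = (G + |G|) - |G|]. *)
Lemma Rintegral_shift G (c : R) : continuous G -> mu.-integrable setT (EFin \o G) ->
  (\int[mu]_x G x = \int[mu]_x G (x + c))%R.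
Proof.
move=> cG iG.
have cN : continuous (fun x => `|G x|).
  by move=> x; apply: cvg_norm; exact: cG.
have cS : continuous (fun x => G x + `|G x|) by move=> x; apply: cvgD; [exact: cG|exact: cN].
have S0 x : 0 <= G x + `|G x| by have := ler_norm (- G x); rewrite normrN; lra.
have csh : forall K : R -> R, continuous K -> continuous (fun x => K (x + c)).
  move=> K cK x; apply: (@continuous_comp _ _ _ (fun x => x + c) K); last exact: cK.
  by apply: cvgD; [exact: cvg_id|exact: cvg_cst].
have ish : forall f : R -> R, continuous f -> (forall x, 0 <= f x) ->
    mu.-integrable setT (EFin \o f) -> mu.-integrable setT (EFin \o (fun x => f (x + c))).
  move=> f cf f0 fi; apply/integrableP; split.
    by apply/measurable_EFinP; exact: (continuous_measurable_fun (csh _ cf)).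
  have -> : (\int[mu]_x `|(EFin \o (fun x : R => f (x + c)%R)) x| = \int[mu]_x (f (x + c)%R)%:E)%E.
    by apply: eq_integral => x _ /=; rewrite ger0_norm.
  rewrite -ge0_integral_shift//; exact: (integrable_lty measurableT fi).
have iN : mu.-integrable setT (EFin \o (fun x => `|G x|)) by exact: (integrable_norm iG).
have iS : mu.-integrable setT (EFin \o (fun x => G x + `|G x|)) by exact: integrableD_EFin.
have sN := ge0_integral_shift c cN (fun x => normr_ge0 (G x)).
have sS := ge0_integral_shift c cS S0.
have := ish _ cN (fun x => normr_ge0 _) iN; have := ish _ cS S0 iS => iS' iN'.
transitivity (\int[mu]_x ((G x + `|G x|) - `|G x|))%R.
  by apply: eq_Rintegral => x _; rewrite addrK.
transitivity (\int[mu]_x ((G (x + c) + `|G (x + c)|) - `|G (x + c)|))%R; last first.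
  by apply: eq_Rintegral => x _; rewrite addrK.
by rewrite RintegralB// RintegralB// /Rintegral sN sS.
Qed.

End Shift.

(** * Euler's integral as a Laplace transform *)

Section Gamma.
Variable R : realType.
Local Notation C := R[i].
Local Notation mu := (@lebesgue_measure R).
Implicit Types (s : C) (b sg y : R).

Lemma integrable_gamma_kernel sg b : 0 < sg -> 0 < b ->
  mu.-integrable setT (EFin \o (fun y => expR (sg * y) * expR (- (b * expR y)))).
Proof.
move=> sg0 b0.
(* For [y >= 0], [exp y >= (y / 2)^2]; completing the square in [b (y / 2)^2 - (sg + 1) y] leaves
   the constant [K]. *)
pose K := (sg + 1) ^+ 2 / b.
have K0 : 0 <= K by rewrite divr_ge0 ?sqr_ge0// ltW.
pose delta := Num.min sg 1.
have d0 : 0 < delta by rewrite lt_min sg0 ltr01.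
apply: (@integrable_dominated _ _ _ mu _ (fun y => expR K * expR (- delta * `|y|))).
- apply: measurable_funM.
    by apply: measurableT_comp => //; exact: measurable_funM.
  apply: measurableT_comp => //; apply: measurableT_comp => //.
  by apply: measurable_funM => //; exact: measurable_expR.
- by apply: integrableZ_EFin; exact: integrable_exp_abs.
move=> y; rewrite -!expRD ger0_norm ?expR_ge0// ler_expR.
have [dsg d1] : delta <= sg /\ delta <= 1 by rewrite /delta !ge_min !lexx orbT.
have e0 := expR_ge0 y.
have [y0|y0] := leP 0 y.
  rewrite (ger0_norm y0).
  have h1 : (y / 2) ^+ 2 <= expR y.
    have -> : expR y = expR (y / 2) ^+ 2 by rewrite -expRM_natl; congr expR; field.
    have := expR_ge1Dx (y / 2) => h.
    by apply: lerXn2r; rewrite ?nnegrE ?expR_ge0//; lra.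
  have h2 : b * (y / 2) ^+ 2 <= b * expR y by rewrite ler_wpM2l// ltW.
  have h3 : b * (y / 2) ^+ 2 - (sg + 1) * y + K = (b * y / 2 - (sg + 1)) ^+ 2 / b.
    by rewrite /K; field; rewrite gt_eqF.
  have h4 : 0 <= (b * y / 2 - (sg + 1)) ^+ 2 / b by rewrite divr_ge0 ?sqr_ge0// ltW.
  have h5 : delta * y <= y by rewrite ler_piMl.
  lra.
rewrite (ltr0_norm y0).
have h1 : 0 <= b * expR y by rewrite mulr_ge0// ltW.
have h2 : sg * y <= delta * y by rewrite ler_wnM2r// ltW.
lra.
Qed.

Definition gamma_ker b y : C := (expR (- (b * expR y)))%:C.

Lemma continuous_gamma_ker b : continuous (fun y : R => expR (- (b * expR y))).
Proof.
move=> y; apply: (@continuous_derive_at _ _ (- (b * expR y) * expR (- (b * expR y)))).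
by apply: is_derive_eq; rewrite /GRing.scale /=; ring.
Qed.

Lemma laplace_dom_gamma b : 0 < b -> laplace_dom 0 (gamma_ker b).
Proof.
move=> b0; split.
  by apply: cmeas_real; exact: (continuous_measurable_fun (@continuous_gamma_ker b)).
move=> sg sg0; have := integrable_gamma_kernel sg0 b0.
by apply: eq_integrable => // y _ /=; rewrite expr0n/= addr0 sqrtr_sqr ger0_norm// expR_ge0.
Qed.

Lemma Re_cexp_real s y : complex.Re (cexp (s * y%:C)) =
  expR (complex.Re s * y) * cos (complex.Im s * y).
Proof. by rewrite /cexp !cE /= !mulr0 !subr0 mul0r subr0 add0r. Qed.

Lemma Im_cexp_real s y : complex.Im (cexp (s * y%:C)) =
  expR (complex.Re s * y) * sin (complex.Im s * y).
Proof. by rewrite /cexp !cE /= !mulr0 !subr0 mul0r addr0 add0r. Qed.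

Lemma cGamma_laplace s : 0 < complex.Re s -> cGamma s = laplace (gamma_ker 1) s.
Proof.
move=> s0; set sg := complex.Re s; set t := complex.Im s.
have cpow x : 0 < x -> {for x, continuous (fun x : R => x `^ (sg - 1) * expR (- x))}.
  move=> x0; apply: cvgM.
    exact: (continuous_derive_at (is_derive1_powR (sg - 1) x0)).
  apply: (@continuous_comp _ _ _ (@GRing.opp R) (@expR R)); first exact: opp_continuous.
  exact: continuous_expR.
have ctr (f : R -> R) x : continuous f -> 0 < x -> {for x, continuous (fun x => f (t * ln x))}.
  move=> cf x0; apply: (@continuous_comp _ _ _ (fun x => t * ln x) f); last exact: cf.
  by apply: cvgMr; exact: continuous_ln.
have pe y : expR y `^ (sg - 1) * expR (- expR y) * expR y = expR (sg * y) * expR (- (1 * expR y)).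
  by rewrite -expRM mul1r -!expRD; congr expR; ring.
have iH : mu.-integrable setT (EFin \o (fun y => expR y `^ (sg - 1) * expR (- expR y) * expR y)).
  by under eq_fun do rewrite pe; exact: integrable_gamma_kernel.
have H0 x : 0 <= x `^ (sg - 1) * expR (- x) by rewrite mulr_ge0 ?powR_ge0 ?expR_ge0.
have key (f : R -> R) : continuous f -> (forall x, `|f x| <= 1) ->
  (\int[mu]_(x in `]0, +oo[) (x `^ (sg - 1) * expR (- x) * f (t * ln x)) =
   \int[mu]_y (expR (sg * y) * f (t * y) * expR (- (1 * expR y))))%R.
  move=> cf f1.
  rewrite (@Rintegral_exp_substitution R _ (fun x => x `^ (sg - 1) * expR (- x)))//.
  - by apply: eq_Rintegral => y _; rewrite expRK mulrAC pe mulrAC.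
  - by move=> x x0; apply: cvgM; [exact: cpow|exact: ctr].
  - by move=> x x0; rewrite normrM (ger0_norm (H0 x)) ler_piMr.
rewrite /cGamma /laplace /cint; congr (_ +i* _).
- rewrite key; [|exact: continuous_cos|exact: cos_max].
  by apply: eq_Rintegral => y _; rewrite ReM Re_cexp_real /= mulr0 subr0.
- rewrite key; [|exact: continuous_sin|exact: sin_max].
  by apply: eq_Rintegral => y _; rewrite ImM Im_cexp_real /= mulr0 add0r.
Qed.

(** Scaling [x] by [b] is the shift of [y = ln x] by [ln b]; with [b = n + a] this produces the
    general term of the Dirichlet series. *)
Lemma laplace_gamma_scale s b : 0 < complex.Re s -> 0 < b ->
  laplace (gamma_ker b) s = cpowN b s * cGamma s.
Proof.
move=> s0 b0; rewrite cGamma_laplace// /laplace.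
have [i1 i2] := cintegrable_laplace (laplace_dom_gamma b0) s0.
rewrite -cintZ; last exact: (cintegrable_laplace (laplace_dom_gamma ltr01) s0).
have E y : cexp (s * (y + - ln b)%:C) * gamma_ker b (y + - ln b) =
    cpowN b s * (cexp (s * y%:C) * gamma_ker 1 y).
  rewrite /cpowN mulrA -cexpD; congr (_ * _).
    by congr cexp; rewrite rmorphD rmorphN mulrDr mulrN addrC.
  rewrite /gamma_ker (expRD y) (expRN (ln b)) lnK ?posrE// mul1r; by congr (expR (- _))%:C; field; rewrite gt_eqF.
have cg (f : R -> R) : continuous f ->
    continuous (fun y => expR (complex.Re s * y) * f (complex.Im s * y) * expR (- (b * expR y))).
  move=> cf y; apply: cvgM; last exact: continuous_gamma_ker.
  apply: cvgM.
    apply: (@continuous_comp _ _ _ ( *%R (complex.Re s)) (@expR R)); first exact: mulrl_continuous.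
    exact: continuous_expR.
  by apply: (@continuous_comp _ _ _ ( *%R (complex.Im s)) f); [exact: mulrl_continuous|exact: cf].
have ReE y : complex.Re (cexp (s * y%:C) * gamma_ker b y) =
   expR (complex.Re s * y) * cos (complex.Im s * y) * expR (- (b * expR y)).
  by rewrite ReM Re_cexp_real /= mulr0 subr0.
have ImE y : complex.Im (cexp (s * y%:C) * gamma_ker b y) =
   expR (complex.Re s * y) * sin (complex.Im s * y) * expR (- (b * expR y)).
  by rewrite ImM Im_cexp_real /= mulr0 add0r.
rewrite /cint; congr (_ +i* _).
- rewrite (@Rintegral_shift R _ (- ln b)).
  + by apply: eq_Rintegral => y _; rewrite E.
  + by under eq_fun do rewrite ReE; apply: cg; exact: continuous_cos.
  + exact: i1.
- rewrite (@Rintegral_shift R _ (- ln b)).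
  + by apply: eq_Rintegral => y _; rewrite E.
  + by under eq_fun do rewrite ImE; apply: cg; exact: continuous_sin.
  + exact: i2.
Qed.

End Gamma.

Section ContinuousComplex.
Variable R : realType.
Local Notation C := R[i].
Implicit Types (f g : R -> C).

Definition rcont f := continuous (fun y => complex.Re (f y)) /\
  continuous (fun y => complex.Im (f y)).

Lemma rcont_cst (k : C) : rcont (fun=> k).
Proof. by split => x; exact: cvg_cst. Qed.

Lemma rcont_real (f : R -> R) : continuous f -> rcont (fun y => (f y)%:C).
Proof. by move=> cf; split => //= x; exact: cvg_cst. Qed.

Lemma rcontD f g : rcont f -> rcont g -> rcont (fun y => f y + g y).
Proof.
move=> [f1 f2] [g1 g2]; split.
- by under eq_fun do rewrite ReD; move=> x; apply: cvgD; [exact: f1|exact: g1].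
- by under eq_fun do rewrite ImD; move=> x; apply: cvgD; [exact: f2|exact: g2].
Qed.

Lemma rcontM f g : rcont f -> rcont g -> rcont (fun y => f y * g y).
Proof.
move=> [f1 f2] [g1 g2]; split.
- under eq_fun do rewrite ReM; move=> x; apply: cvgB; apply: cvgM;
    [exact: f1|exact: g1|exact: f2|exact: g2].
- under eq_fun do rewrite ImM; move=> x; apply: cvgD; apply: cvgM;
    [exact: f1|exact: g2|exact: f2|exact: g1].
Qed.

Lemma rcontV f : (forall y, f y != 0) -> rcont f -> rcont (fun y => (f y)^-1).
Proof.
move=> f0 [f1 f2].
have cD : continuous (fun y => (cabs (f y) ^+ 2)^-1).
  move=> x; apply: cvgV; first by rewrite expf_neq0// cabs_eq0.
  under eq_fun do rewrite cabs_sqr; rewrite cabs_sqr.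
  by apply: cvgD; apply: cvg_sqr; [exact: f1|exact: f2].
split.
- by under eq_fun do rewrite ReV; move=> x; apply: cvgM; [exact: f1|exact: cD].
- under eq_fun do rewrite ImV; move=> x; apply: cvgN.
  by apply: cvgM; [exact: f2|exact: cD].
Qed.

Lemma rcont_cmeas f : rcont f -> cmeas f.
Proof. by move=> [f1 f2]; split; apply: continuous_measurable_fun. Qed.

Lemma rcont_cexp (s : C) : rcont (fun y => cexp (s * y%:C)).
Proof.
have h1 : continuous (fun y : R => expR (complex.Re s * y)).
  move=> y; apply: (@continuous_comp _ _ _ ( *%R (complex.Re s)) (@expR R)).
    exact: mulrl_continuous.
  exact: continuous_expR.
split.
- under eq_fun do rewrite Re_cexp_real; move=> y; apply: cvgM; first exact: h1.
  exact: continuous_cosZ.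
- under eq_fun do rewrite Im_cexp_real; move=> y; apply: cvgM; first exact: h1.
  apply: (@continuous_comp _ _ _ ( *%R (complex.Im s)) (@sin R)).
    exact: mulrl_continuous.
  exact: continuous_sin.
Qed.

End ContinuousComplex.

(** * Bounds for the kernel [exp (- a x) / (1 - z exp (- x))] *)

Section LerchKernel.
Variable R : realType.
Local Notation C := R[i].
Local Notation mu := (@lebesgue_measure R).
Variables (a : R) (z : C).
Hypotheses (a0 : 0 < a) (z1 : cabs z <= 1).

Definition lerch_ker (y : R) : C :=
  gamma_ker a y * (1 - z * (expR (- expR y))%:C)^-1.

Let q y := expR (- expR y : R).

Lemma q_lt1 y : 0 < q y < 1.
Proof. by rewrite expR_gt0 expR_lt1 oppr_lt0 expR_gt0. Qed.

Lemma cabs_gamma_ker y : cabs (gamma_ker a y) = expR (- (a * expR y)).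
Proof. by rewrite cabs_real ger0_norm// expR_ge0. Qed.

Lemma lerch_denom_ge y : 1 - q y <= cabs (1 - z * (q y)%:C).
Proof.
have /andP[q0 q1] := q_lt1 y.
have := ler_cabsD (1 - z * (q y)%:C) (z * (q y)%:C).
rewrite subrK cabs1 cabsM cabs_real (gtr0_norm q0) => h.
have : cabs z * q y <= 1 * q y by rewrite ler_wpM2r// ltW.
lra.
Qed.

Lemma lerch_denom_neq0 y : 1 - z * (q y)%:C != 0.
Proof.
rewrite -cabs_gt0; apply: lt_le_trans (lerch_denom_ge y).
by have /andP[_ q1] := q_lt1 y; rewrite subr_gt0.
Qed.

(** The denominator is at least [1 - q] and at least [|1 - z| - (1 - q)]; adding the two bounds
    removes [q]. This uniform bound is why the abscissa drops from 1 to 0 when [z <> 1]. *)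
Lemma lerch_denom_ge_half y : cabs (1 - z) / 2 <= cabs (1 - z * (q y)%:C).
Proof.
have /andP[q0 q1] := q_lt1 y.
have h1 := lerch_denom_ge y.
have := ler_cabsD (1 - z * (q y)%:C) (- (z * (1 - q y)%:C)).
have -> : 1 - z * (q y)%:C + - (z * (1 - q y)%:C) = 1 - z.
  by rewrite rmorphB rmorph1; ring.
rewrite cabsN cabsM cabs_real ger0_norm; last by rewrite subr_ge0 ltW.
move=> h2.
have : cabs z * (1 - q y) <= 1 * (1 - q y) by rewrite ler_wpM2r// subr_ge0 ltW.
lra.
Qed.

(** With [x = exp y] this is [1 / (1 - exp (- x)) <= 1 + 1 / x], a form of [exp x >= 1 + x]. *)
Lemma inv_1Bq y : (1 - q y)^-1 <= 1 + expR (- y).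
Proof.
have x0 := expR_gt0 y.
have h1 := expR_ge1Dx (expR y).
have /andP[q0 q1] := q_lt1 y.
have qE : q y * expR (expR y) = 1 by rewrite /q -expRD addNr expR0.
have yE : expR (- y) * expR y = 1 by rewrite -expRD addNr expR0.
have h2 : q y * (1 + expR y) <= 1 by rewrite -[leRHS]qE ler_wpM2l// ltW.
rewrite -[leLHS]mul1r ler_pdivrMr; last by rewrite subr_gt0.
have e0 := expR_gt0 (- y).
have : expR (- y) * (q y * (1 + expR y)) <= expR (- y) * 1 by rewrite ler_wpM2l// ltW.
have -> : expR (- y) * (q y * (1 + expR y)) = q y * expR (- y) + q y * (expR (- y) * expR y) by ring.
rewrite yE; lra.
Qed.

Lemma cabs_lerch_ker y : cabs (lerch_ker y) <= expR (- (a * expR y)) * (1 + expR (- y)).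
Proof.
rewrite /lerch_ker cabsM cabs_gamma_ker cabsV ler_wpM2l ?expR_ge0//.
apply: le_trans (inv_1Bq y); have /andP[q0 q1] := q_lt1 y.
rewrite lef_pV2 ?posrE ?subr_gt0//; first exact: lerch_denom_ge.
by rewrite cabs_gt0 lerch_denom_neq0.
Qed.

Lemma cabs_lerch_ker_neq1 y : z != 1 ->
  cabs (lerch_ker y) <= 2 / cabs (1 - z) * expR (- (a * expR y)).
Proof.
move=> zn1; have z0 : 0 < cabs (1 - z) by rewrite cabs_gt0 subr_eq0 eq_sym.
rewrite /lerch_ker cabsM cabs_gamma_ker cabsV mulrC ler_wpM2r ?expR_ge0//.
have -> : 2 / cabs (1 - z) = (cabs (1 - z) / 2)^-1 by rewrite invf_div.
rewrite lef_pV2 ?posrE ?divr_gt0//; first exact: lerch_denom_ge_half.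
by rewrite cabs_gt0 lerch_denom_neq0.
Qed.

Lemma rcont_lerch_ker : rcont lerch_ker.
Proof.
apply: rcontM; first by apply: rcont_real; exact: continuous_gamma_ker.
apply: rcontV; first exact: lerch_denom_neq0.
have := @rcont_real R q; rewrite /q.
have cq : continuous (fun y : R => expR (- expR y)).
  by have := @continuous_gamma_ker R 1; under eq_fun do rewrite mul1r.
move=> /(_ cq) rq.
have -> : (fun y : R => 1 - z * (expR (- expR y))%:C) = (fun y => 1 + (- z) * (expR (- expR y))%:C).
  by apply/funext => y; rewrite mulNr.
by apply: rcontD; [exact: rcont_cst|apply: rcontM => //; exact: rcont_cst].
Qed.

(** The possible singularity [1 / x = exp (- y)] at [x = 0] lowers the exponent by one, whence the
    abscissa 1. *)
Lemma laplace_dom_lerch1 : laplace_dom 1 lerch_ker.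
Proof.
have mk := rcont_cmeas rcont_lerch_ker; split => // sg sg1.
have i1 : mu.-integrable setT (EFin \o (fun y => expR (sg * y) * expR (- (a * expR y)))).
  by apply: integrable_gamma_kernel => //; lra.
have i2 : mu.-integrable setT (EFin \o (fun y => expR ((sg - 1) * y) * expR (- (a * expR y)))).
  by apply: integrable_gamma_kernel => //; lra.
apply: (@integrable_dominated _ _ _ mu _ (fun y => expR (sg * y) * expR (- (a * expR y)) +
   expR ((sg - 1) * y) * expR (- (a * expR y)))).
- apply: measurable_funM.
    by apply: measurableT_comp => //; exact: measurable_funM.
  exact: measurable_cabs.
- exact: integrableD_EFin.
move=> y; rewrite normrM ger0_norm ?expR_ge0// ger0_norm ?cabs_ge0//.
have -> : expR ((sg - 1) * y) = expR (sg * y) * expR (- y).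
  by rewrite -expRD; congr expR; ring.
apply: (@le_trans _ _ (expR (sg * y) * (expR (- (a * expR y)) * (1 + expR (- y))))).
  by rewrite ler_wpM2l ?expR_ge0// cabs_lerch_ker.
by rewrite le_eqVlt; apply/orP; left; apply/eqP; ring.
Qed.

Lemma laplace_dom_lerch0 : z != 1 -> laplace_dom 0 lerch_ker.
Proof.
move=> zn1; have mk := rcont_cmeas rcont_lerch_ker; split => // sg sg0.
have i1 := integrable_gamma_kernel sg0 a0.
apply: (@integrable_dominated _ _ _ mu _ (fun y => 2 / cabs (1 - z) *
   (expR (sg * y) * expR (- (a * expR y))))).
- apply: measurable_funM.
    by apply: measurableT_comp => //; exact: measurable_funM.
  exact: measurable_cabs.
- exact: integrableZ_EFin.
move=> y; rewrite normrM ger0_norm ?expR_ge0// ger0_norm ?cabs_ge0//.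
rewrite mulrCA ler_wpM2l ?expR_ge0//; exact: cabs_lerch_ker_neq1.
Qed.

End LerchKernel.

(** * Termwise integration of the geometric series for [Re s > 1] *)

Section DirichletSeries.
Variable R : realType.
Local Notation C := R[i].
Local Notation mu := (@lebesgue_measure R).
Variables (a : R) (z : C).
Hypotheses (a0 : 0 < a) (z1 : cabs z <= 1).

Let q y := expR (- expR y : R).
Let part N (y : R) : C := \sum_(0 <= n < N) z ^+ n * gamma_ker (n%:R + a) y.

Lemma gamma_kerD (n : nat) (y : R) :
  gamma_ker (n%:R + a) y = gamma_ker a y * (q y)%:C ^+ n.
Proof.
rewrite /gamma_ker /q -rmorphXn -rmorphM; congr (_%:C).
by rewrite -expRM_natl -expRD; congr expR; ring.
Qed.

(** The remainder of a geometric series is its sum times the next power of the ratio [z * q y]. *)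
Lemma lerch_ker_partial N y : lerch_ker a z y - part N y =
  (z * (q y)%:C) ^+ N * lerch_ker a z y.
Proof.
elim: N => [|N IH]; first by rewrite /part big_geq// subr0 expr0 mul1r.
have -> : part N.+1 y = part N y + z ^+ N * gamma_ker (N%:R + a) y.
  by rewrite /part big_nat_recr.
rewrite opprD addrA IH gamma_kerD.
have d0 := lerch_denom_neq0 z1 y.
rewrite exprS exprMn /lerch_ker -/(q y).
rewrite -/(q y) in d0; field; exact: d0.
Qed.

Lemma laplace_partial N s : 0 < complex.Re s ->
  cintegrable (fun y => cexp (s * y%:C) * part N y) /\
  laplace (part N) s = cGamma s * HLZ_partial s a z N.
Proof.
move=> s0; rewrite /laplace; elim: N => [|N [IH1 IH2]].
  have -> : (fun y => cexp (s * y%:C) * part 0 y) = (fun=> 0 * (0 : C)).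
    by apply/funext => y; rewrite /part big_geq// mulr0 mul0r.
  have i0 : cintegrable (fun _ : R => 0 : C).
    by split; apply: (@eq_integrable _ _ _ _ _ measurableT (cst 0%E)) => //; exact: integrable0.
  by split; [exact: cintegrableZ|rewrite cintZ// mul0r /HLZ_partial big_geq// mulr0].
have Na0 : 0 < N%:R + a by rewrite ltr_wpDl.
have iN := cintegrable_laplace (laplace_dom_gamma Na0) s0.
have E : (fun y => cexp (s * y%:C) * part N.+1 y) = (fun y => cexp (s * y%:C) * part N y +
    z ^+ N * (cexp (s * y%:C) * gamma_ker (N%:R + a) y)).
  by apply/funext => y; rewrite /part big_nat_recr//=; ring.
rewrite E; split; first by apply: cintegrableD => //; exact: cintegrableZ.
rewrite cintD//; last exact: cintegrableZ.
rewrite cintZ// IH2 -/(laplace _ s) laplace_gamma_scale//.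
by rewrite /HLZ_partial big_nat_recr//=; ring.
Qed.

(** By [lerch_ker_partial] the remainder is at most [q y ^+ n] times the kernel, with [q y < 1];
    dominated convergence covers [|z| = 1] as well. *)
Lemma laplace_partial_cvg s : 1 < complex.Re s ->
  forall e : R, 0 < e -> exists N : nat, forall n, (N <= n)%N ->
    cabs (laplace (lerch_ker a z) s - laplace (part n) s) < e.
Proof.
move=> s1 e e0; have s0 : 0 < complex.Re s by lra.
have kd := laplace_dom_lerch1 a0 z1.
have ik := cintegrable_laplace kd s1.
pose h y := expR (complex.Re s * y) * cabs (lerch_ker a z y).
have ih : mu.-integrable setT (EFin \o h) by have [_] := kd; apply.
have mh : measurable_fun setT h by apply/measurable_EFinP; exact: measurable_int ih.
have h0 y : 0 <= h y by rewrite mulr_ge0 ?expR_ge0 ?cabs_ge0.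
have q01 y : 0 < q y < 1 := q_lt1 y.
have mq n : measurable_fun setT (fun y => q y ^+ n).
  apply: measurable_funX; apply: continuous_measurable_fun.
  by have := @continuous_gamma_ker R 1; under eq_fun do rewrite mul1r.
have hq n y : `|h y * q y ^+ n| <= h y.
  have /andP[q0 q1] := q01 y.
  rewrite normrM (ger0_norm (h0 y)) normrX (gtr0_norm q0) ler_piMr//.
  by rewrite exprn_ile1// ltW.
have iq n : mu.-integrable setT (EFin \o (fun y => h y * q y ^+ n)).
  apply: (@integrable_dominated _ _ _ mu _ h) => //.
  by apply: measurable_funM; [exact: mh|exact: mq].
have bound n : cabs (laplace (lerch_ker a z) s - laplace (part n) s) <=
    2 * \int[mu]_y (h y * q y ^+ n).
  have [ip _] := laplace_partial n s0.
  rewrite /laplace -cintB//; apply: cabs_cint => //; first exact: cintegrableB.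
  move=> y; rewrite -mulrBr lerch_ker_partial cabsM cabs_cexp_real cabsM cabsX cabsM cabs_real.
  have /andP[q0 q1] := q01 y.
  rewrite (gtr0_norm q0) /h -mulrA ler_wpM2l ?expR_ge0// mulrC ler_wpM2l ?cabs_ge0//.
  apply: lerXn2r; rewrite ?nnegrE ?mulr_ge0 ?cabs_ge0 ?(ltW q0)//.
  by rewrite ler_piMl// ltW.
have cvg0 : (\int[mu]_y (h y * q y ^+ n)%:E @[n --> \oo] --> 0)%E.
  have [] := @dominated_convergence _ _ _ mu setT measurableT
    (fun n y => (h y * q y ^+ n)%:E) (fun=> 0%E) (fun y => (h y)%:E).
  - by move=> n; apply/measurable_EFinP; apply: measurable_funM; [exact: mh|exact: mq].
  - exact: measurable_cst.
  - apply: aeW => y _; apply: cvg_EFin; first exact: nearW.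
    have -> : (fine \o (fun n : nat => (h y * q y ^+ n)%:E)) = (fun n : nat => h y * q y ^+ n) by [].
    rewrite -[X in _ --> X](mulr0 (h y)); apply: cvgMr.
    by apply: cvg_expr; have /andP[q0 q1] := q01 y; rewrite gtr0_norm.
  - exact: ih.
  - by apply: aeW => y n _; rewrite lee_fin; exact: hq.
  by move=> _ _; rewrite integral0.
have {}cvg0 : (\int[mu]_y (h y * q y ^+ n))%R @[n --> \oo] --> (0 : R).
  by apply: (@fine_cvg _ _ _ _ _ 0).
have e2 : 0 < e / 2 by lra.
move/cvgrPdist_lt : cvg0 => /(_ _ e2)[N _ NP].
exists N => n Nn; apply: le_lt_trans (bound n) _.
have := NP n Nn; rewrite /= sub0r normrN ltr_norml => /andP[_ lt2].
by rewrite mulrC -ltr_pdivlMr.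
Qed.

Lemma Gamma_mul_HLZ g s : is_HLZ a z g -> 1 < complex.Re s ->
  cGamma s * g s = laplace (lerch_ker a z) s.
Proof.
move=> [gs _] s1; have s0 : 0 < complex.Re s by lra.
apply/eqP; rewrite -subr_eq0 -cabs_eq0; apply/eqP/le_anti.
rewrite cabs_ge0 andbT; apply/ler_addgt0Pr => e e0; rewrite add0r.
have G0 : 0 < cabs (cGamma s) + 1 by rewrite ltr_wpDl ?cabs_ge0.
have e1 : 0 < e / 2 / (cabs (cGamma s) + 1) by rewrite !divr_gt0.
have e2 : 0 < e / 2 by rewrite divr_gt0.
have [N1 h1] := gs s s1 _ e1; have [N2 h2] := laplace_partial_cvg s1 e2.
have {}h1 := h1 (N1 + N2)%N (leq_addr _ _).
have {}h2 := h2 (N1 + N2)%N (leq_addl _ _).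
have [_ E] := laplace_partial (N1 + N2) s0.
apply: le_trans (ler_cabs_dist _ _ (laplace (part (N1 + N2)) s)) _.
rewrite (cabsB _ (laplace (lerch_ker a z) s)).
have : cabs (cGamma s * g s - laplace (part (N1 + N2)) s) <= e / 2.
  rewrite E -mulrBr cabsM (cabsB (g s)).
  rewrite ltr_pdivlMr// in h1; apply: le_trans (ltW h1); rewrite mulrC ler_wpM2l ?cabs_ge0//.
  by rewrite lerDl.
lra.
Qed.

End DirichletSeries.

(** * Continuation to [Re s > 0] for [z <> 1] *)

Section Continuation.
Variable R : realType.
Local Notation C := R[i].
Local Notation mu := (@lebesgue_measure R).

(** A real point is approached vertically, through [s + i d / 2]. *)
Lemma vanish_off_axis_continuous (h : C -> C) s :
  (forall w, 0 < complex.Re w -> complex.Im w != 0 -> h w = 0) ->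
  0 < complex.Re s -> ccont h s -> h s = 0.
Proof.
move=> h0 s0; have [t0|t0] := eqVneq (complex.Im s) 0; last by move=> _; exact: h0.
move=> /ccontP ch; apply/eqP; rewrite -cabs_eq0; apply/eqP/le_anti.
rewrite cabs_ge0 andbT; apply/ler_addgt0Pr => e e0; rewrite add0r.
have [d d0 dP] := ch _ e0.
have := dP (s + (0 +i* (d / 2))).
have -> : s + (0 +i* (d / 2)) - s = (0 +i* 1) * (d / 2)%:C.
  by apply: complex_ext; rewrite !cE /=; ring.
rewrite cabsM cabs_real /cabs /= expr0n /= expr1n add0r sqrtr1 mul1r gtr0_norm ?divr_gt0//.
move=> h1; have {}h1 : cabs (h (s + (0 +i* (d / 2))) - h s) < e by apply: h1; lra.
rewrite h0 in h1; first by rewrite sub0r cabsN in h1; exact: ltW.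
  by rewrite cE /= addr0.
by rewrite cE /= t0 add0r gt_eqF// divr_gt0.
Qed.

Lemma HLZ_laplace (a : R) (z : C) (g : C -> C) s : 0 < a -> cabs z <= 1 -> z != 1 ->
  is_HLZ a z g -> 0 < complex.Re s -> cGamma s * g s = laplace (lerch_ker a z) s.
Proof.
move=> a0 z1 zn1 hg s0; have [_ gh] := hg.
(* Gamma is written as a Laplace transform, whose holomorphy is known; it equals [cGamma] on
   [Re w > 0]. *)
pose h w := laplace (gamma_ker 1) w * g w - laplace (lerch_ker a z) w.
have hh w : 0 < complex.Re w -> holomorphic_at h w.
  move=> w0; apply: holomorphicB; last exact: (holomorphic_laplace (laplace_dom_lerch0 a0 z1 zn1) w0).
  apply: holomorphicM; first exact: (holomorphic_laplace (laplace_dom_gamma ltr01) w0).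
  by apply: gh; rewrite zn1.
suff : h s = 0 by rewrite /h -cGamma_laplace// => /eqP; rewrite subr_eq0 => /eqP.
apply: vanish_off_axis_continuous => //; last by apply: holomorphic_continuous; exact: hh.
apply: vanish_right_half_plane => w w0 _; first exact: hh.
have w0' : 0 < complex.Re w by lra.
by rewrite /h -cGamma_laplace// (Gamma_mul_HLZ a0 z1 hg w0) subrr.
Qed.

End Continuation.

Section NegativeHalfLine.
Variable R : realType.
Local Notation mu := (@lebesgue_measure R).
Implicit Types (e w al be : R).

Lemma continuous_exp_trig e w al be :
  continuous (fun x : R => expR (e * x) * (2 + (al * cos (w * x) + be * sin (w * x)))).
Proof.
move=> x; apply: (@continuous_derive_at _ _
  (e * expR (e * x) * (2 + (al * cos (w * x) + be * sin (w * x))) +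
   expR (e * x) * (- al * w * sin (w * x) + be * w * cos (w * x)))).
by apply: is_derive_eq; rewrite /GRing.scale /=; ring.
Qed.

Lemma exp_trig_ge0 e w al be (x : R) : `|al| <= 1 -> `|be| <= 1 ->
  0 <= expR (e * x) * (2 + (al * cos (w * x) + be * sin (w * x))).
Proof.
move=> hal hbe; rewrite mulr_ge0 ?expR_ge0//.
have h1 : `|al * cos (w * x)| <= 1.
  by rewrite normrM -[leRHS]mulr1 ler_pM// ler_norml cos_geN1 cos_le1.
have h2 : `|be * sin (w * x)| <= 1.
  by rewrite normrM -[leRHS]mulr1 ler_pM// ler_norml sin_geN1 sin_le1.
by move: h1 h2; rewrite !ler_norml => /andP[? ?] /andP[? ?]; lra.
Qed.

Lemma integral_exp_trig_neg e w al be : 0 < e -> `|al| <= 1 -> `|be| <= 1 ->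
  (\int[mu]_(x in `]-oo, 0%R]) (expR (e * x) * (2 + (al * cos (w * x) + be * sin (w * x))))%R%:E
   = (2 / e + (al * e - be * w) / (e ^+ 2 + w ^+ 2))%R%:E)%E.
Proof.
move=> e0 hal hbe; rewrite -{1}oppr0 ge0_integration_by_substitutionNy.
- have hbe' : `|- be| <= 1 by rewrite normrN.
  have := integral_exp_trig_ge0 w e0 hal hbe'; rewrite mulNr => <-.
  apply: eq_integral => x _ /=; congr EFin.
  by rewrite !mulrN cosN sinN !mulNr mulrN.
- by apply: continuous_subspaceT; exact: continuous_exp_trig.
- by move=> x _; exact: exp_trig_ge0.
Qed.

Lemma integrable_exp_trig_neg e w al be : 0 < e -> `|al| <= 1 -> `|be| <= 1 ->
  mu.-integrable `]-oo, 0]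
   (EFin \o (fun x => expR (e * x) * (2 + (al * cos (w * x) + be * sin (w * x))))).
Proof.
move=> e0 ha hb; apply/integrableP; split.
  apply/measurable_EFinP/measurable_funTS.
  by apply: continuous_measurable_fun; exact: continuous_exp_trig.
under eq_integral do rewrite /= ger0_norm ?exp_trig_ge0//.
by rewrite integral_exp_trig_neg// ltry.
Qed.

Lemma integrable_trig_neg e w al be : 0 < e -> `|al| <= 1 -> `|be| <= 1 ->
  mu.-integrable `]-oo, 0]
   (EFin \o (fun x => expR (e * x) * (al * cos (w * x) + be * sin (w * x)))).
Proof.
move=> e0 ha hb; have n1 : `|0 : R| <= 1 by rewrite normr0.
have := integrableB _ (integrable_exp_trig_neg w e0 ha hb)
  (integrable_exp_trig_neg 0 e0 n1 n1).
move=> /(_ (measurable_itv _)); apply: eq_integrable; first exact: measurable_itv.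
by move=> x _; rewrite /= -EFinB; congr EFin; ring.
Qed.

Lemma Rintegral_exp_trig_neg e w al be : 0 < e -> `|al| <= 1 -> `|be| <= 1 ->
  (\int[mu]_(x in `]-oo, 0]) (expR (e * x) * (al * cos (w * x) + be * sin (w * x))) =
  (al * e - be * w) / (e ^+ 2 + w ^+ 2))%R.
Proof.
move=> e0 hal hbe.
have n1 : `|0 : R| <= 1 by rewrite normr0.
have I0 := integral_exp_trig_neg 0 e0 n1 n1.
have I1 := integral_exp_trig_neg w e0 hal hbe.
transitivity ((\int[mu]_(x in `]-oo, 0%R])
   (expR (e * x) * (2 + (al * cos (w * x) + be * sin (w * x))) -
    expR (e * x) * (2 + (0 * cos (0 * x) + 0 * sin (0 * x)))))%R).
  by apply: eq_Rintegral => x _; ring.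
rewrite RintegralB//; [|exact: integrable_exp_trig_neg|exact: integrable_exp_trig_neg].
by rewrite /Rintegral I0 I1 /= !mul0r subrr mul0r addr0; ring.
Qed.

End NegativeHalfLine.

(** * Continuation to the strip [0 < Re s < 1] for [z = 1] *)

Section HurwitzKernel.
Variable R : realType.
Local Notation C := R[i].
Local Notation mu := (@lebesgue_measure R).

(** The transform of [exp (- y) = 1 / x] converges nowhere, so the function is split at [y = 0]:
    [cut] has a transform for [Re s > 1], [tail] for [Re s < 1]. *)
Definition cut (y : R) : R := \1_(`]-oo, 0[%classic) y * expR (- y).
Definition tail (y : R) : R := \1_(`[0, +oo[%classic) y * expR (- y).

Lemma measurable_expRN : measurable_fun setT (fun y : R => expR (- y)).
Proof. by apply: measurableT_comp => //; exact: measurableT_comp. Qed.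

Lemma measurable_cut : measurable_fun setT cut.
Proof. by apply: measurable_funM => //; exact: measurable_expRN. Qed.

Lemma measurable_tail : measurable_fun setT tail.
Proof. by apply: measurable_funM => //; exact: measurable_expRN. Qed.

Lemma cut_tail y : cut y + tail y = expR (- y).
Proof.
rewrite /cut /tail -mulrDl !indicE !mem_setE !in_itv /= andbT ltNge.
by case: (0 <= y) => /=; rewrite ?addr0 ?add0r mul1r.
Qed.

Lemma cut_lt0 y : y < 0 -> cut y = expR (- y).
Proof. by move=> y0; rewrite /cut indicE mem_setE in_itv /= y0 mul1r. Qed.

Lemma cut_ge0 y : 0 <= y -> cut y = 0.
Proof. by move=> y0; rewrite /cut indicE mem_setE in_itv /= ltNge y0 mul0r. Qed.

Lemma tail_lt0 y : y < 0 -> tail y = 0.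
Proof. by move=> y0; rewrite /tail indicE mem_setE in_itv /= andbT leNgt y0 mul0r. Qed.

Lemma tail_ge0 y : 0 <= y -> tail y = expR (- y).
Proof. by move=> y0; rewrite /tail indicE mem_setE in_itv /= andbT y0 mul1r. Qed.

Lemma cintegrable_cut (s : C) : 1 < complex.Re s ->
  cintegrable (fun y => cexp (s * y%:C) * (cut y)%:C).
Proof.
move=> s1; pose e := complex.Re s - 1.
have e0 : 0 < e by rewrite subr_gt0.
apply: (cintegrable_dominated (h := fun y => expR (- e * `|y|))).
- by apply: cmeasM; [exact: cmeas_cexp|apply: cmeas_real; exact: measurable_cut].
- exact: integrable_exp_abs.
move=> y; rewrite cabsM cabs_cexp_real cabs_real.
have [y0|y0] := leP 0 y; first by rewrite cut_ge0// normr0 mulr0 expR_ge0.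
rewrite cut_lt0// ger0_norm ?expR_ge0// -expRD ler_expR ltr0_norm// /e.
by rewrite le_eqVlt; apply/orP; left; apply/eqP; ring.
Qed.

Lemma cintegrable_tail (s : C) : complex.Re s < 1 ->
  cintegrable (fun y => cexp (s * y%:C) * (tail y)%:C).
Proof.
move=> s1; pose e := 1 - complex.Re s.
have e0 : 0 < e by rewrite subr_gt0.
apply: (cintegrable_dominated (h := fun y => expR (- e * `|y|))).
- by apply: cmeasM; [exact: cmeas_cexp|apply: cmeas_real; exact: measurable_tail].
- exact: integrable_exp_abs.
move=> y; rewrite cabsM cabs_cexp_real cabs_real.
have [y0|y0] := leP 0 y; last by rewrite tail_lt0// normr0 mulr0 expR_ge0.
rewrite tail_ge0// ger0_norm ?expR_ge0// -expRD ler_expR ger0_norm// /e.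
by rewrite le_eqVlt; apply/orP; left; apply/eqP; ring.
Qed.

Lemma laplace_cut (s : C) : 1 < complex.Re s ->
  laplace (fun y => (cut y)%:C) s = (s - 1)^-1.
Proof.
move=> s1; set e := complex.Re s - 1; set t := complex.Im s.
have e0 : 0 < e by rewrite subr_gt0.
have ED : cabs (s - 1) ^+ 2 = e ^+ 2 + t ^+ 2 by rewrite cabs_sqr !cE /= subr0.
have key al be : `|al| <= 1 -> `|be| <= 1 ->
  (\int[mu]_y (\1_(`]-oo, 0[%classic) y * (expR (e * y) * (al * cos (t * y) + be * sin (t * y)))) =
    (al * e - be * t) / (e ^+ 2 + t ^+ 2))%R.
  move=> ha hb; rewrite -Rintegral_exp_trig_neg// -Rintegral_itv_bndo_bndc.
    rewrite [RHS]Rintegral_mkcond; apply: eq_Rintegral => y _.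
    by rewrite patchE indicE; case: ifP => _; rewrite ?mul1r ?mul0r.
  apply: integrableS (integrable_trig_neg t e0 ha hb) => //.
  by apply: subset_itvl; rewrite bnd_simp.
have n0 : `|0 : R| <= 1 by rewrite normr0.
have n1 : `|1 : R| <= 1 by rewrite normr1.
have kE y : expR (complex.Re s * y) * cut y = \1_(`]-oo, 0[%classic) y * expR (e * y).
  rewrite /cut mulrCA -expRD; congr (_ * expR _); rewrite /e; ring.
have RE : (s - 1)^-1 = complex.Re (s - 1)^-1 +i* complex.Im (s - 1)^-1 by case: (_^-1).
rewrite RE /laplace /cint; congr (_ +i* _); rewrite ?ReV ?ImV ED.
- transitivity (\int[mu]_y (\1_(`]-oo, 0[%classic) y * (expR (e * y) * (1 * cos (t * y) + 0 * sin (t * y)))))%R.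
    apply: eq_Rintegral => y _.
    by rewrite ReM Re_cexp_real /= mulr0 subr0 mulrAC kE mul1r mul0r addr0; ring.
  by rewrite key// !cE /= -/e; ring.
- transitivity (\int[mu]_y (\1_(`]-oo, 0[%classic) y * (expR (e * y) * (0 * cos (t * y) + 1 * sin (t * y)))))%R.
    apply: eq_Rintegral => y _.
    by rewrite ImM Im_cexp_real /= mulr0 add0r mulrAC kE mul1r mul0r add0r; ring.
  by rewrite key// !cE /= -/t; ring.
Qed.

Lemma laplace_tail (s : C) : complex.Re s < 1 ->
  laplace (fun y => (tail y)%:C) s = - (s - 1)^-1.
Proof.
move=> s1; set e := 1 - complex.Re s; set t := complex.Im s.
have e0 : 0 < e by rewrite subr_gt0.
have ED : cabs (s - 1) ^+ 2 = e ^+ 2 + t ^+ 2.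
  by rewrite cabs_sqr !cE /= subr0 /e -(sqrrN (1 - _)) opprB.
have key al be : `|al| <= 1 -> `|be| <= 1 ->
  (\int[mu]_y (\1_(`[0, +oo[%classic) y * (expR (- e * y) * (al * cos (t * y) + be * sin (t * y)))) =
    (al * e + be * t) / (e ^+ 2 + t ^+ 2))%R.
  move=> ha hb; rewrite -Rintegral_exp_trig//.
  rewrite [RHS]Rintegral_mkcond; apply: eq_Rintegral => y _.
  by rewrite patchE indicE; case: ifP => _; rewrite ?mul1r ?mul0r.
have n0 : `|0 : R| <= 1 by rewrite normr0.
have n1 : `|1 : R| <= 1 by rewrite normr1.
have tE y : expR (complex.Re s * y) * tail y = \1_(`[0, +oo[%classic) y * expR (- e * y).
  rewrite /tail mulrCA -expRD; congr (_ * expR _); rewrite /e; ring.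
have RE : - (s - 1)^-1 = complex.Re (- (s - 1)^-1) +i* complex.Im (- (s - 1)^-1).
  by case: (- _).
rewrite RE /laplace /cint; congr (_ +i* _); rewrite ?ReN ?ImN ?ReV ?ImV ED.
- transitivity (\int[mu]_y (\1_(`[0, +oo[%classic) y * (expR (- e * y) * (1 * cos (t * y) + 0 * sin (t * y)))))%R.
    apply: eq_Rintegral => y _.
    by rewrite ReM Re_cexp_real /= mulr0 subr0 mulrAC tE mul1r mul0r addr0; ring.
  by rewrite key// !cE /= /e; ring.
- transitivity (\int[mu]_y (\1_(`[0, +oo[%classic) y * (expR (- e * y) * (0 * cos (t * y) + 1 * sin (t * y)))))%R.
    apply: eq_Rintegral => y _.
    by rewrite ImM Im_cexp_real /= mulr0 add0r mulrAC tE mul1r mul0r add0r; ring.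
  by rewrite key// !cE /= /t; ring.
Qed.

Variable a : R.
Hypotheses (a0 : 0 < a) (a1 : a <= 1).

Let k1 := lerch_ker a (1 : C).
Let one1 : cabs (1 : C) <= 1. Proof. by rewrite cabs1. Qed.

Definition hurwitz_real (y : R) : R := expR (- (a * expR y)) / (1 - expR (- expR y)).

Lemma lerch_ker1E y : k1 y = (hurwitz_real y)%:C.
Proof.
rewrite /k1 /lerch_ker /gamma_ker /hurwitz_real mul1r.
by rewrite -(rmorph1 (real_complex R)) -rmorphB -fmorphV -rmorphM.
Qed.

(** For [0 < x < 1] the kernel lies between [(1 - x) / x] and [1 + 1 / x]: the numerator is at least
    [1 - a x >= 1 - x], the denominator at most [x]. *)
Lemma hurwitz_bound_lt0 y : y < 0 -> `|hurwitz_real y - expR (- y)| <= 1.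
Proof.
move=> y0; have x0 := expR_gt0 y.
have x1 : expR y < 1 by rewrite expR_lt1.
have := q_lt1 y; set q := expR (- expR y) => /andP[q0 q1].
have h1 := inv_1Bq y; rewrite -/q in h1.
have h2 := expR_ge1Dx (- (a * expR y)); have h3 := expR_ge1Dx (- expR y); rewrite -/q in h3.
have ax : a * expR y <= expR y by rewrite ler_piMl// ltW.
have E1 : expR (- (a * expR y)) <= 1 by rewrite expR_le1 oppr_le0 mulr_ge0// ltW.
have V0 : 0 < (1 - q)^-1 by rewrite invr_gt0 subr_gt0.
have Vx : expR (- y) <= (1 - q)^-1.
  by rewrite expRN lef_pV2 ?posrE ?subr_gt0//; lra.
have yE : expR (- y) * expR y = 1 by rewrite -expRD addNr expR0.
have e0 := expR_gt0 (- y).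
have u1 : hurwitz_real y <= 1 * (1 - q)^-1 by rewrite /hurwitz_real -/q ler_wpM2r// ltW.
have u2 : (1 - expR y) * expR (- y) <= hurwitz_real y.
  rewrite /hurwitz_real -/q; apply: ler_pM => //.
  - by rewrite subr_ge0 ltW.
  - by lra.
rewrite mulrBl mul1r [expR y * _]mulrC yE in u2.
by rewrite ler_norml; apply/andP; split; lra.
Qed.

Lemma hurwitz_ge0 y : 0 <= hurwitz_real y.
Proof.
have /andP[q0 q1] := q_lt1 y.
by rewrite /hurwitz_real divr_ge0 ?expR_ge0// subr_ge0 ltW.
Qed.

Lemma hurwitz_bound_ge0 y : 0 <= y -> `|hurwitz_real y| <= 2 * expR (- (a * expR y)).
Proof.
move=> y0; have h1 := inv_1Bq y.
have e1 : expR (- y) <= 1 by rewrite expR_le1 oppr_le0.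
rewrite ger0_norm ?hurwitz_ge0// /hurwitz_real mulrC ler_wpM2r ?expR_ge0//; lra.
Qed.

(** Subtracting [cut] removes the singularity at [x = 0]. The constant [2 * exp a] serves both
    sides: for [y < 0] the bound 1 is below [exp a * exp (- a exp y)]. *)
Lemma laplace_dom_hurwitz : laplace_dom 0 (fun y => k1 y - (cut y)%:C).
Proof.
have mk : cmeas (fun y => k1 y - (cut y)%:C).
  apply: cmeasB; first by apply: rcont_cmeas; exact: rcont_lerch_ker.
  by apply: cmeas_real; exact: measurable_cut.
split => // sg sg0.
have i1 := integrable_gamma_kernel sg0 a0.
apply: (@integrable_dominated _ _ _ mu _ (fun y => (2 * expR a) *
   (expR (sg * y) * expR (- (a * expR y))))).
- apply: measurable_funM.
    by apply: measurableT_comp => //; exact: measurable_funM.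
  exact: measurable_cabs.
- exact: integrableZ_EFin.
move=> y; rewrite normrM ger0_norm ?expR_ge0// ger0_norm ?cabs_ge0//.
rewrite mulrCA ler_wpM2l ?expR_ge0// lerch_ker1E -rmorphB cabs_real.
have ea : 1 <= expR a by rewrite -expR0 ler_expR ltW.
have [y0|y0] := leP 0 y.
  rewrite cut_ge0// subr0; apply: le_trans (hurwitz_bound_ge0 y0) _.
  by rewrite ler_wpM2r ?expR_ge0//; lra.
rewrite cut_lt0//; apply: le_trans (hurwitz_bound_lt0 y0) _.
have h : 1 <= expR a * expR (- (a * expR y)).
  rewrite -expRD -expR0 ler_expR; have : a * expR y <= a * 1.
    by rewrite ler_wpM2l ?(ltW a0)// expR_le1 ltW.
  lra.
rewrite -mulrA; lra.
Qed.

Lemma Hurwitz_laplace (g : C -> C) s : is_HLZ a 1 g -> 0 < complex.Re s < 1 ->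
  cintegrable (fun y => cexp (s * y%:C) * (hurwitz_real y - expR (- y))%:C) /\
  cGamma s * g s = laplace (fun y => (hurwitz_real y - expR (- y))%:C) s.
Proof.
move=> hg /andP[s0 s1]; have [_ gh] := hg.
have kd := laplace_dom_hurwitz.
have sn1 : s != 1.
  by apply/eqP => E; move: s1; rewrite E /= ltxx.
(* The pole is carried explicitly. For [Re w > 1], [(w - 1)^-1] is the transform of [cut]; in the
   strip it is minus the transform of [tail]. *)
pose h w := laplace (gamma_ker 1) w * g w - laplace (fun y => k1 y - (cut y)%:C) w - (w - 1)^-1.
have hh w : 0 < complex.Re w -> w != 1 -> holomorphic_at h w.
  move=> w0 w1; apply: holomorphicB.
    apply: holomorphicB; last exact: (holomorphic_laplace kd w0).
    apply: holomorphicM; first exact: (holomorphic_laplace (laplace_dom_gamma ltr01) w0).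
    by apply: gh; rewrite w1 orbT.
  apply: holomorphicV; last by rewrite subr_eq0.
  by apply: holomorphicB; [exact: holomorphic_id|exact: holomorphic_cst].
have hs : h s = 0.
  apply: vanish_off_axis_continuous => //; last by apply: holomorphic_continuous; exact: hh.
  apply: vanish_right_half_plane => w w0 t0.
    by apply: hh => //; apply/eqP => E; move: t0; rewrite E /= eqxx.
  have w0' : 0 < complex.Re w by lra.
  have ck := cintegrable_laplace (laplace_dom_lerch1 a0 one1) w0.
  have cc := cintegrable_cut w0.
  rewrite /h -cGamma_laplace// (Gamma_mul_HLZ a0 one1 hg w0) -laplace_cut// /laplace.
  have -> : cint (fun y => cexp (w * y%:C) * (k1 y - (cut y)%:C)) =
     cint (fun y => cexp (w * y%:C) * k1 y - cexp (w * y%:C) * (cut y)%:C).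
    by congr cint; apply/funext => y; rewrite mulrBr.
  by rewrite cintB//; ring.
have c1 := cintegrable_laplace kd s0; have c2 := cintegrable_tail s1.
have E : (fun y => cexp (s * y%:C) * (hurwitz_real y - expR (- y))%:C) =
  (fun y => cexp (s * y%:C) * (k1 y - (cut y)%:C) - cexp (s * y%:C) * (tail y)%:C).
  apply/funext => y; rewrite -mulrBr lerch_ker1E -cut_tail !(rmorphB, rmorphD)/=.
  by congr (_ * _); ring.
rewrite /laplace E; split; first exact: cintegrableB.
rewrite cintB// -/(laplace _ s) -[X in _ - X]/(laplace (fun y => (tail y)%:C) s) laplace_tail//.
move: hs; rewrite /h -cGamma_laplace// => /eqP; rewrite subr_eq0 subr_eq => /eqP ->.
by rewrite opprK addrC.
Qed.

End HurwitzKernel.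

(** * Characteristic functions and densities *)

Section DensityMeasure.
Context d (T : measurableType d) (R : realType) (m : {measure set T -> \bar R}) (p : T -> R).

(** The proofs [p0] and [mp] are arguments so that the measure structure can be attached to the
    term. *)
Definition density (p0 : forall x, 0 <= p x) (mp : measurable_fun setT p) : set T -> \bar R :=
  fun A => (\int[m]_(x in A) (p x)%:E)%E.

Hypotheses (p0 : forall x, 0 <= p x) (mp : measurable_fun setT p).

Let density_set0 : density p0 mp set0 = 0%E.
Proof. by rewrite /density integral_set0. Qed.

Let density_ge0 A : (0 <= density p0 mp A)%E.
Proof. by apply: integral_ge0 => x _; rewrite lee_fin. Qed.

Let density_sigma_additive : semi_sigma_additive (density p0 mp).
Proof.
move=> F mF tF mUF; rewrite /density; apply: cvg_toP.
  apply: ereal_nondecreasing_is_cvgn => i j ij.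
  by apply: lee_sum_nneg_natr => // k _ _; exact: density_ge0.
rewrite ge0_integral_bigcup//=.
- by apply/measurable_EFinP; exact: measurable_funTS.
- by move=> x _; rewrite lee_fin.
Qed.

HB.instance Definition _ := isMeasure.Build _ _ _ (density p0 mp)
  density_set0 density_ge0 density_sigma_additive.

Let integral_density_indic E : measurable E ->
  (\int[density p0 mp]_x (\1_E x)%:E = \int[m]_x ((\1_E x)%:E * (p x)%:E))%E.
Proof.
move=> mE; rewrite integral_indic//= /density setIT [LHS]integral_mkcond/=.
apply: eq_integral => x _; rewrite patchE indicE.
by case: ifPn => xE; rewrite ?mul1e ?mul0e.
Qed.

Import HBNNSimple.

Let integral_density_nnsfun (f : {nnsfun T >-> R}) :
  (\int[density p0 mp]_x (f x)%:E = \int[m]_x ((f x)%:E * (p x)%:E))%E.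
Proof.
under [LHS]eq_integral do rewrite fimfunE -fsumEFin//.
rewrite [LHS]ge0_integral_fsum//; last 2 first.
  - by move=> r; exact/measurable_EFinP/measurableT_comp.
  - by move=> n x _; rewrite EFinM nnfun_muleindic_ge0.
under [RHS]eq_integral.
  move=> x xD; rewrite fimfunE -fsumEFin// ge0_mule_fsuml; last first.
    by move=> r; rewrite EFinM nnfun_muleindic_ge0.
  over.
rewrite [RHS]ge0_integral_fsum//; last 2 first.
  - move=> r; apply: emeasurable_funM.
      by apply/measurable_EFinP; do 2 apply/measurableT_comp => //.
    exact/measurable_EFinP.
  - move=> n x _; rewrite mule_ge0//; last by rewrite lee_fin.
    by rewrite EFinM nnfun_muleindic_ge0.
apply: eq_fsbigr => r _.
rewrite (_ : (fun x => _) = (fun x => r%:E * (\1_(f @^-1` [set r]) x)%:E)%E); last first.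
  by apply/funext => x; rewrite EFinM.
have [r0|r0] := leP 0 r; last first.
  have -> : f @^-1` [set r] = set0.
    apply/seteqP; split => // x /= fx; move: r0; rewrite -fx ltNge; by rewrite fun_ge0.
  rewrite [LHS]integral0_eq; last by move=> x _; rewrite indicE in_set0 mule0.
  by rewrite integral0_eq// => x _; rewrite indicE in_set0 mulr0 mul0e.
rewrite ge0_integralZl//; last exact/measurable_EFinP.
rewrite integral_density_indic// -ge0_integralZl//.
- by apply: eq_integral => x _; rewrite EFinM muleA.
- apply: emeasurable_funM; exact/measurable_EFinP.
- by move=> x _; rewrite mule_ge0 ?lee_fin.
Qed.

(** The change of measure passes from indicators to simple functions and then, by monotone
    convergence on both sides, to [f]. *)
Lemma integral_density (f : T -> \bar R) :
  measurable_fun setT f -> (forall x, 0 <= f x)%E ->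
  (\int[density p0 mp]_x f x = \int[m]_x (f x * (p x)%:E))%E.
Proof.
move=> mf f0.
pose f_ := nnsfun_approx measurableT mf.
transitivity (lim (\int[density p0 mp]_x (f_ n x)%:E @[n --> \oo])%E).
  rewrite -monotone_convergence//=.
  - apply: eq_integral => ? /[!inE] xD; apply/esym/cvg_lim => //=.
    exact: cvg_nnsfun_approx.
  - by move=> n; exact/measurable_EFinP/measurable_funTS.
  - by move=> n ? _; rewrite lee_fin.
  - by move=> ? _ ? ? mn; rewrite lee_fin; exact/lefP/nd_nnsfun_approx.
transitivity (lim (\int[m]_x ((f_ n x)%:E * (p x)%:E) @[n --> \oo])%E).
  by apply: congr_lim; apply/funext => n /=; exact: integral_density_nnsfun.
rewrite -monotone_convergence//=.
- apply: eq_integral => x _; apply/cvg_lim => //.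
  apply: cvgeZr => //.
  exact: cvg_nnsfun_approx.
- move=> n; apply: emeasurable_funM; exact/measurable_EFinP.
- by move=> n x _; rewrite mule_ge0 ?lee_fin.
- by move=> x _ i j ij; rewrite lee_wpmul2r ?lee_fin//; exact/lefP/nd_nnsfun_approx.
Qed.

End DensityMeasure.

(** * From a characteristic function to its density *)

Section CharacteristicFunctions.
Variable R : realType.
Local Notation C := R[i].
Local Notation mu := (@lebesgue_measure R).

(** If [f x < 0], then [f <= f x / 2] on a short interval ending at [x], and its integral there is
    negative. *)
Lemma nonneg_of_intervals (f : R -> R) : continuous f ->
  (forall u v, u < v -> 0 <= \int[mu]_y (f y * \1_(`]u, v]%classic) y)) ->
  forall x, 0 <= f x.
Proof.
move=> cf fuv x; rewrite leNgt; apply/negP => fx.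
have e0 : 0 < - f x / 2 by rewrite divr_gt0 ?oppr_gt0.
have /cvgrPdist_lt/(_ _ e0)/nbhs_ballP[d d0 dP] := cf x.
have d20 : 0 < d / 2 by rewrite divr_gt0.
have uv : x - d / 2 < x by rewrite ltrBlDr ltrDl.
have int : mu.-integrable `[x - d / 2, x] (EFin \o f).
  by apply: integrable_segment => y _; exact: cf.
have := fuv _ _ uv.
have -> : (\int[mu]_y (f y * \1_(`]x - d / 2, x]%classic) y) =
    \int[mu]_(y in `[x - (d / 2)%R, x]) f y)%R.
  rewrite -Rintegral_itv_obnd_cbnd.
    rewrite [RHS]Rintegral_mkcond; apply: eq_Rintegral => y _.
    by rewrite patchE indicE; case: ifP => _; rewrite ?mulr1 ?mulr0.
  by apply: integrableS int => //; apply: subset_itvr; rewrite bnd_simp.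
apply/negP; rewrite -ltNge.
have h : forall y, x - d / 2 <= y <= x -> f y <= f x / 2.
  move=> y /andP[y1 y2].
  have : ball x d y by rewrite /ball /= ger0_norm ?subr_ge0//; lra.
  by move=> /dP; rewrite /= ltr_norml => /andP[h1 _]; lra.
apply: le_lt_trans (Rintegral_segment_le (ltW uv) int h) _.
by rewrite opprB addrC subrK nmulr_rlt0// ?divr_gt0//; lra.
Qed.

Lemma Rintegral_cosN (f : R -> R) (t : R) :
  (\int[mu]_y (f y * cos (- t * y)) = \int[mu]_y (f y * cos (t * y)))%R.
Proof. by apply: eq_Rintegral => y _; rewrite mulNr cosN. Qed.

Lemma Rintegral_sinN (f : R -> R) (t : R) : mu.-integrable setT (EFin \o f) ->
  (\int[mu]_y (f y * sin (- t * y)) = - \int[mu]_y (f y * sin (t * y)))%R.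
Proof.
move=> fi; rewrite -[RHS]mulN1r -RintegralZl//.
  by apply: eq_Rintegral => y _; rewrite mulNr sinN; ring.
by apply: (@integrable_sinX R _ _ mu idfun f _ fi t); exact: measurable_id.
Qed.

Lemma charfun_intervals (P : probability R R) (p : R -> C) : cintegrable p ->
  (forall t, charfun P t = cint (fun y => cexp ((0 +i* t) * y%:C) * p y)) ->
  forall u v, u < v ->
  (P `]u, v]%classic = (\int[mu]_y (complex.Re (p y) * \1_(`]u, v]%classic) y))%:E)%E /\
  (\int[mu]_y (complex.Im (p y) * \1_(`]u, v]%classic) y) = 0)%R.
Proof.
move=> [i1 i2] hP u v uv.
have icos f t : mu.-integrable setT (EFin \o f) ->
    mu.-integrable setT (EFin \o (fun y => f y * cos (t * y))).
  by move=> fi; apply: (@integrable_cosX R _ _ mu idfun f _ fi t); exact: measurable_id.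
have isin f t : mu.-integrable setT (EFin \o f) ->
    mu.-integrable setT (EFin \o (fun y => f y * sin (t * y))).
  by move=> fi; apply: (@integrable_sinX R _ _ mu idfun f _ fi t); exact: measurable_id.
pose A1 t := (\int[mu]_y (complex.Re (p y) * cos (t * y)))%R.
pose A2 t := (\int[mu]_y (complex.Im (p y) * cos (t * y)))%R.
pose B1 t := (\int[mu]_y (complex.Re (p y) * sin (t * y)))%R.
pose B2 t := (\int[mu]_y (complex.Im (p y) * sin (t * y)))%R.
pose M1 t := (\int[P]_y cos (t * y))%R.
pose M2 t := (\int[P]_y sin (t * y))%R.
have E0 t y : cexp ((0 +i* t) * y%:C) = cos (t * y) +i* sin (t * y).
  by apply: complex_ext; rewrite ?Re_cexp_real ?Im_cexp_real /= mul0r expR0 mul1r.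
have E1 t : M1 t = A1 t - B2 t.
  have := congr1 (@complex.Re R) (hP t); rewrite /= => E; rewrite [LHS]E /A1 /B2 -RintegralB//;
    [|exact: icos|exact: isin].
  by apply: eq_Rintegral => y _; rewrite E0 ReM /=; ring.
have E2 t : M2 t = A2 t + B1 t.
  have := congr1 (@complex.Im R) (hP t); rewrite /= => E; rewrite [LHS]E /A2 /B1 -RintegralD//;
    [|exact: icos|exact: isin].
  by apply: eq_Rintegral => y _; rewrite E0 ImM /=; ring.
have A1N t : A1 (- t) = A1 t by exact: Rintegral_cosN.
have A2N t : A2 (- t) = A2 t by exact: Rintegral_cosN.
have B1N t : B1 (- t) = - B1 t by exact: Rintegral_sinN.
have B2N t : B2 (- t) = - B2 t by exact: Rintegral_sinN.
have M1N t : M1 (- t) = M1 t.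
  by apply: eq_Rintegral => y _; rewrite mulNr cosN.
have mid : measurable_fun setT (idfun : R -> R) by exact: measurable_id.
have icst : P.-integrable setT (EFin \o (fun=> 1 : R)).
  by have := @finite_measure_integrable_cst _ _ R P setT 1; exact.
have M2N t : M2 (- t) = - M2 t.
  rewrite /M2 -[RHS]mulN1r -RintegralZl//.
    by apply: eq_Rintegral => y _; rewrite mulNr sinN; ring.
  have := @integrable_sinX R _ _ P idfun (fun=> 1) mid icst t.
  by apply: eq_integrable => // y _ /=; rewrite mul1r.
(* [M1] and [A1] are even in [t] while [B2] is odd, so [E1] at [t] and at [- t] splits. [F2] is the
   same with odd [M2], [B1] and even [A2]. *)
have F1 t : M1 t = A1 t /\ B2 t = 0.
  have h1 := E1 t; have h2 := E1 (- t); rewrite M1N A1N B2N in h2.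
  by split; lra.
have F2 t : M2 t = B1 t /\ A2 t = 0.
  have h1 := E2 t; have h2 := E2 (- t); rewrite M2N A2N B1N in h2.
  by split; lra.
(* The identity once more, now from the measurable structure that carries Lebesgue measure. *)
have mid' : @measurable_fun _ _ (measurableTypeR R) R setT (idfun : R -> R) by exact: measurable_id.
have i0 : mu.-integrable setT (EFin \o (fun=> 0 : R)).
  by apply: (@eq_integrable _ _ _ mu _ measurableT (cst 0%E)) => //; exact: integrable0.
split; last first.
  rewrite (@fourier_uniqueness R _ _ mu idfun (fun y => complex.Im (p y))
    _ _ mu idfun (fun=> 0) mid' i2 mid' i0 _ _ u v uv).
  - by under eq_Rintegral do rewrite mul0r; rewrite Rintegral_cst//= mul0r.
  - move=> t; rewrite -/(A2 t) (F2 t).2.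
    by under eq_Rintegral do rewrite mul0r; rewrite Rintegral_cst//= mul0r.
  - move=> t; rewrite -/(B2 t) (F1 t).2.
    by under eq_Rintegral do rewrite mul0r; rewrite Rintegral_cst//= mul0r.
have <- := @fourier_uniqueness R _ _ P idfun (fun=> 1) _ _ mu idfun
  (fun y => complex.Re (p y)) mid icst mid' i1 _ _ u v uv.
- rewrite /Rintegral (_ : (\int[P]_y (1 * \1_(`]u, v]%classic) (idfun y))%:E)%E = P `]u, v]%classic).
    by rewrite fineK//; exact: fin_num_measure.
  under eq_integral do rewrite mul1r.
  by rewrite integral_indic ?setIT//; exact: measurable_itv.
- move=> t; rewrite -/(A1 t) -(F1 t).1; apply: eq_Rintegral => y _; exact: mul1r.
- move=> t; rewrite -/(B1 t) -(F2 t).1; apply: eq_Rintegral => y _; exact: mul1r.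
Qed.

(* The identity, as a measurable map between the two measurable structures that
   [R] carries: Lebesgue measure lives on [measurableTypeR R], [probability R R]
   on [R] itself. *)
Definition toR : measurableTypeR R -> R := fun x => x.

Lemma measurable_toR : measurable_fun setT toR.
Proof. exact: measurable_id. Qed.

HB.instance Definition _ := isMeasurableFun.Build _ _ _ _ toR measurable_toR.

Lemma charfun_density (P : probability R R) (p : R -> C) : rcont p -> cintegrable p ->
  (forall t, charfun P t = cint (fun y => cexp ((0 +i* t) * y%:C) * p y)) ->
  [/\ forall y, 0 <= complex.Re (p y), forall y, complex.Im (p y) = 0 &
    has_density P (fun y => complex.Re (p y))].
Proof.
move=> [c1 c2] [i1 i2] hP; have key := charfun_intervals (conj i1 i2) hP.
have p0 : forall y, 0 <= complex.Re (p y).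
  apply: nonneg_of_intervals => // u v uv.
  by have [h _] := key _ _ uv; rewrite -lee_fin -h.
have pI : forall y, complex.Im (p y) = 0.
  move=> y; apply/eqP; rewrite eq_le -oppr_ge0; apply/andP; split.
    apply: (@nonneg_of_intervals (fun y => - complex.Im (p y))).
      by move=> x; apply: cvgN; exact: c2.
    move=> u v uv; have [_ h] := key _ _ uv.
    have E : (\int[mu]_y (- complex.Im (p y) * \1_(`]u, v]%classic) y) =
        \int[mu]_y (-1 * (complex.Im (p y) * \1_(`]u, v]%classic) y)))%R.
      by apply: eq_Rintegral => x _; rewrite mulN1r mulNr.
    rewrite E RintegralZl// ?h ?mulr0//.
    apply: (integrableM_bounded (M := 1)) => //.
    by move=> x; rewrite indicE ger0_norm ?ler0n// lern1 leq_b1.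
  apply: (@nonneg_of_intervals (fun y => complex.Im (p y))) => // u v uv.
  by have [_ ->] := key _ _ uv.
split => // A mA.
have mp : @measurable_fun _ _ (measurableTypeR R) R setT (fun y => complex.Re (p y)).
  exact: (continuous_measurable_fun c1).
pose nu := pushforward (density mu p0 mp) toR.
have nuE B : nu B = (\int[mu]_(y in B) (complex.Re (p y))%:E)%E by [].
rewrite -nuE.
have nuP u v : u < v -> P `]u, v]%classic = nu `]u, v]%classic.
  move=> uv; have [-> _] := key _ _ uv.
  rewrite nuE /Rintegral (_ : (\int[mu]_(y in `]u, v]) (complex.Re (p y))%:E)%E =
     (\int[mu]_y (complex.Re (p y) * \1_(`]u, v]%classic) y)%:E)%E); last first.
    rewrite integral_mkcond; apply: eq_integral => y _.
    by rewrite patchE indicE; case: ifP => _; rewrite ?mulr1 ?mulr0.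
  rewrite fineK//; apply: integrable_fin_num => //.
  apply: (integrableM_bounded (M := 1)) => //.
  by move=> x; rewrite indicE ger0_norm ?ler0n// lern1 leq_b1.
(* Half-open intervals are stable under intersection and generate the Borel sets, and those in the
   given sequence cover the line with finite mass. *)
apply: (@measure_unique _ R R (@ocitv R) (fun k : nat => `]- (k%:R), k%:R]%classic) _ _ _ _ P nu) => //.
- exact: ocitvI.
- by move=> k; exact: is_ocitv.
- by rewrite bigcup_itvT.
- move=> _ [x _ <-]; have [xy|xy] := ltP x.1 x.2; first exact: nuP.
  by rewrite set_itv_ge ?measure0// bnd_simp -leNgt.
- by move=> k; apply: (@le_lt_trans _ _ 1%E); [exact: probability_le1|exact: ltry].
Qed.

End CharacteristicFunctions.

Section DensityProbability.
Variables (R : realType) (p : measurableTypeR R -> R).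
Local Notation mu := (@lebesgue_measure R).

(** The pushforward along [toR] only changes the measurable structure; [p1] is an argument so that
    the probability structure can be attached. *)
Definition density_prob (p0 : forall y, 0 <= p y) (mp : measurable_fun setT p)
    (p1 : (\int[mu]_y (p y)%:E = 1)%E) : set R -> \bar R :=
  pushforward (density mu p0 mp) (@toR R).

Hypotheses (p0 : forall y, 0 <= p y) (mp : measurable_fun setT p)
  (p1 : (\int[mu]_y (p y)%:E = 1)%E).

Let nu : {measure set R -> \bar R} :=
  measure_function_pushforward__canonical__measure_function_Measure
    (density mu p0 mp) (@measurable_toR R).

HB.instance Definition _ := isMeasure.Build _ _ _ (density_prob p0 mp p1)
  (measure0 nu) (measure_ge0 nu) (@measure_semi_sigma_additive _ _ _ nu).

Let density_prob_setT : density_prob p0 mp p1 setT = 1%E.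
Proof. by rewrite -p1. Qed.

HB.instance Definition _ :=
  @Measure_isProbability.Build _ _ R (density_prob p0 mp p1) density_prob_setT.

Lemma Rintegral_density_prob (h : R -> R) : measurable_fun setT h -> (forall y, `|h y| <= 1) ->
  (\int[density_prob p0 mp p1]_y h y = \int[mu]_y (h y * p y))%R.
Proof.
move=> mh h1.
have mh' : @measurable_fun _ _ (measurableTypeR R) R setT h by exact: mh.
have pi : mu.-integrable setT (EFin \o p).
  apply/integrableP; split; first exact/measurable_EFinP.
  under eq_integral do rewrite /= ger0_norm//.
  by rewrite p1 ltry.
have hpi : mu.-integrable setT (EFin \o (fun y => h y * p y)).
  have := integrableM_bounded pi mh' h1.
  by apply: eq_integrable => // y _ /=; rewrite mulrC.
have i1 : (density_prob p0 mp p1).-integrable setT (EFin \o (fun=> 1 : R)).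
  by have := @finite_measure_integrable_cst _ _ R (density_prob p0 mp p1) setT 1; exact.
have hi : (density_prob p0 mp p1).-integrable setT (EFin \o h).
  have := @integrableM_bounded _ _ _ (density_prob p0 mp p1) (fun=> 1) h 1 i1 mh h1.
  by apply: eq_integrable => // y _ /=; rewrite mul1r.
(* Adding 1, the total mass, turns [h] into the nonnegative [1 + h], to which [integral_density]
   applies. *)
apply: (@addrI _ 1).
have -> : (1 + \int[density_prob p0 mp p1]_y h y = \int[density_prob p0 mp p1]_y (1 + h y))%R.
  rewrite RintegralD// Rintegral_cst//.
  by rewrite [X in fine X]probability_setT mulr1.
have -> : (1 + \int[mu]_y (h y * p y) = \int[mu]_y (p y + h y * p y))%R.
  by rewrite RintegralD// /Rintegral p1.
rewrite /Rintegral ge0_integral_pushforward//=.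
- rewrite preimage_setT integral_density//=.
  + by congr fine; apply: eq_integral => y _; rewrite -EFinM mulrDl mul1r.
  + by apply/measurable_EFinP; exact: measurable_funD.
  + by move=> y; rewrite lee_fin; have := h1 y; rewrite ler_norml => /andP[]; rewrite /toR; lra.
- by apply/measurable_EFinP; exact: measurable_funD.
- by move=> y _; rewrite lee_fin; have := h1 y; rewrite ler_norml => /andP[]; lra.
Qed.

End DensityProbability.

Lemma charfun_exists (R : realType) (p : R -> R) : continuous p -> (forall y, 0 <= p y) ->
  lebesgue_measure.-integrable setT (EFin \o p) ->
  (\int[@lebesgue_measure R]_y p y = 1)%R ->
  is_charfun (fun t => cint (fun y => cexp ((0 +i* t) * y%:C) * (p y)%:C)).
Proof.
move=> cp p0 ip p1.
have mp : @measurable_fun _ _ (measurableTypeR R) R setT p.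
  exact: (continuous_measurable_fun cp).
have p1' : (\int[@lebesgue_measure R]_y (p y)%:E = 1)%E.
  rewrite -[LHS]fineK; last exact: integrable_fin_num.
  by rewrite [X in X%:E]p1.
exists (density_prob p0 mp p1') => t.
have -> : (fun y => cexp ((0 +i* t) * y%:C) * (p y)%:C) =
    (fun y => (cos (t * y) * p y) +i* (sin (t * y) * p y)).
  apply/funext => y; apply: complex_ext.
    by rewrite ReM Re_cexp_real Im_cexp_real /= mul0r expR0; ring.
  by rewrite ImM Re_cexp_real Im_cexp_real /= mul0r expR0; ring.
apply: complex_ext; rewrite /= Rintegral_density_prob//.
- apply: measurableT_comp; first exact: (continuous_measurable_fun (@continuous_cos R)).
  exact: measurable_funM.
- by move=> y; rewrite ler_norml cos_geN1 cos_le1.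
- apply: measurableT_comp; first exact: (continuous_measurable_fun (@continuous_sin R)).
  exact: measurable_funM.
- by move=> y; rewrite ler_norml sin_geN1 sin_le1.
Qed.

Lemma Rintegral_gt0 (R : realType) (f : R -> R) : continuous f -> (forall y, 0 < f y) ->
  lebesgue_measure.-integrable setT (EFin \o f) ->
  0 < (\int[@lebesgue_measure R]_y f y)%R.
Proof.
move=> cf f0 fi.
have [c _ cP] : exists2 c, c \in `[0 : R, 1]%R & forall t, t \in `[0 : R, 1]%R -> f c <= f t.
  by apply: (@EVT_min _ _ _ _ ler01); exact: continuous_subspaceT.
have si : (@lebesgue_measure R).-integrable `[0, 1] (EFin \o f).
  by apply: integrable_segment => x _; exact: cf.
have h1 : f c * (1 - 0) <= (\int[@lebesgue_measure R]_(y in `[0, 1]) f y)%R.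
  by apply: Rintegral_segment_ge => // x x01; apply: cP; rewrite in_itv.
apply: lt_le_trans (f0 c) _; rewrite subr0 mulr1 in h1; apply: le_trans h1 _.
apply: fine_le; [exact: integrable_fin_num|exact: integrable_fin_num|].
apply: ge0_subset_integral => //=; last by move=> y _; rewrite lee_fin ltW.
by apply/measurable_EFinP; exact: (continuous_measurable_fun cf).
Qed.

Section NormalizedLaplace.
Variable R : realType.
Local Notation C := R[i].
Local Notation mu := (@lebesgue_measure R).
Variables (g : C -> C) (sigma : R) (k : R -> C).
Hypotheses (ck : rcont k)
  (ik : forall t, cintegrable (fun y => cexp ((sigma +i* t) * y%:C) * k y))
  (fk : forall t, fHLZ g sigma t = laplace k (sigma +i* t)).

(** The only candidate for the density, complex-valued as long as nothing is known about [k] and the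
    normalizing constant. *)
Definition tilted y : C := (fHLZ g sigma 0)^-1 * (cexp ((sigma +i* 0) * y%:C) * k y).

Lemma rcont_tilted : rcont tilted.
Proof. by do 2 (apply: rcontM; [exact: rcont_cst || exact: rcont_cexp|]); exact: ck. Qed.

Lemma cintegrable_tilted : cintegrable tilted.
Proof. exact: cintegrableZ. Qed.

Lemma FHLZ_tilted t : FHLZ g sigma t = cint (fun y => cexp ((0 +i* t) * y%:C) * tilted y).
Proof.
rewrite /FHLZ fk mulrC -cintZ//; congr cint; apply/funext => y.
have -> : sigma +i* t = (0 +i* t) + (sigma +i* 0).
  by apply: complex_ext; rewrite ?ReD ?ImD /= ?add0r ?addr0.
by rewrite /tilted mulrDl cexpD; ring.
Qed.

Lemma charfun_tilted (P : probability R R) : (forall t, charfun P t = FHLZ g sigma t) ->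
  [/\ fHLZ g sigma 0 != 0, forall y, 0 <= complex.Re (tilted y),
    forall y, complex.Im (tilted y) = 0 &
    has_density P (fun y => complex.Re (tilted y))].
Proof.
move=> hP.
have [h1 h2 h3] := charfun_density rcont_tilted cintegrable_tilted
  (fun t => etrans (hP t) (FHLZ_tilted t)).
(* If the denominator were zero, [FHLZ] would be identically zero by the convention on division,
   whereas a characteristic function is 1 at the origin. *)
split => //; apply/eqP => f0; have := congr1 (@complex.Re R) (hP 0).
rewrite /FHLZ f0 mul0r /= (_ : (\int[P]_y cos (0 * y) = 1)%R).
  by move/eqP; rewrite oner_eq0.
under eq_Rintegral do rewrite mul0r cos0.
by rewrite Rintegral_cst// [X in fine X]probability_setT mulr1.
Qed.

Variable kr : R -> R.
Hypothesis krE : forall y, k y = (kr y)%:C.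

Let ckr : continuous kr.
Proof.
have -> : kr = (fun y => complex.Re (k y)) by apply/funext => y; rewrite krE.
by have [] := ck.
Qed.

Let r0 := (\int[mu]_y (expR (sigma * y) * kr y))%R.

Let kE y : cexp ((sigma +i* 0) * y%:C) * k y = (expR (sigma * y) * kr y)%:C.
Proof.
rewrite krE; apply: complex_ext.
  by rewrite ReM Re_cexp_real Im_cexp_real /= mul0r cos0 sin0; ring.
by rewrite ImM Re_cexp_real Im_cexp_real /= mul0r cos0 sin0; ring.
Qed.

Let ikr : mu.-integrable setT (EFin \o (fun y => expR (sigma * y) * kr y)).
Proof. by have [h _] := ik 0; apply: eq_integrable h => // y _ /=; rewrite kE. Qed.

Lemma fHLZ0_real : fHLZ g sigma 0 = r0%:C.
Proof.
rewrite fk; apply: complex_ext => /=.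
  by apply: eq_Rintegral => y _; rewrite kE.
under eq_Rintegral do rewrite kE.
by rewrite Rintegral_cst//= mul0r.
Qed.

Lemma Re_tilted y :
  complex.Re (tilted y) = expR (sigma * y) * kr y / complex.Re (fHLZ g sigma 0).
Proof.
by rewrite /tilted kE fHLZ0_real -fmorphV -rmorphM /= mulrC.
Qed.

(** [c] records the sign of the kernel. The normalizing integral [r0] has the same sign, so it is
    nonzero and the quotient is nonnegative in either case. *)
Lemma is_charfun_FHLZ (c : R) : (forall y, 0 < c * kr y) -> is_charfun (FHLZ g sigma).
Proof.
move=> ckr0.
have ce : continuous (fun y => expR (sigma * y) * kr y).
  move=> y; apply: cvgM; last exact: ckr.
  apply: (@continuous_derive_at _ (fun y => expR (sigma * y)) (sigma * expR (sigma * y))).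
  by apply: is_derive_eq; rewrite /GRing.scale /=; ring.
have cr0 : 0 < c * r0.
  rewrite -RintegralZl//; apply: Rintegral_gt0.
  - by move=> y; apply: cvgM; [exact: cvg_cst|exact: ce].
  - by move=> y; rewrite mulrCA mulr_gt0 ?expR_gt0.
  - exact: integrableZ_EFin.
have rn0 : r0 != 0 by apply: contraTneq cr0 => ->; rewrite mulr0 ltxx.
have pE y : tilted y = (r0^-1 * (expR (sigma * y) * kr y))%:C.
  by rewrite /tilted kE fHLZ0_real -fmorphV -rmorphM.
have -> : FHLZ g sigma = (fun t => cint (fun y => cexp ((0 +i* t) * y%:C) *
    (r0^-1 * (expR (sigma * y) * kr y))%:C)).
  by apply/funext => t; rewrite FHLZ_tilted; congr cint; apply/funext => y; rewrite pE.
have scaleE (r e x : R) : r != 0 -> c != 0 -> r^-1 * (e * x) = (c * r)^-1 * (e * (c * x)).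
  by move=> r_neq0 c_neq0; field; rewrite r_neq0 c_neq0.
apply: charfun_exists.
- by move=> y; apply: cvgM; [exact: cvg_cst|exact: ce].
- move=> y; have -> : r0^-1 * (expR (sigma * y) * kr y) = (c * r0)^-1 * (expR (sigma * y) * (c * kr y)).
    have c0 : c != 0 by apply: contraTneq cr0 => ->; rewrite mul0r ltxx.
    exact: scaleE.
  by rewrite mulr_ge0 ?invr_ge0 ?(ltW cr0)// mulr_ge0 ?expR_ge0// ltW.
- exact: integrableZ_EFin.
- by rewrite RintegralZl// mulVf.
Qed.

End NormalizedLaplace.

(** * Signs of the kernels *)

Section KernelSigns.
Variable R : realType.
Local Notation C := R[i].
Implicit Types a x y : R.

Lemma nondecreasing_from0 (f df : R -> R) x : 0 <= x ->
  (forall y, is_derive y 1 f (df y)) -> (forall y, 0 <= y -> 0 <= df y) -> f 0 <= f x.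
Proof.
move=> x0 fd df0.
have fc : {within `[0, x], continuous f}.
  by apply: continuous_subspaceT => y; exact: (continuous_derive_at (fd y)).
have [c cx E] := @MVT_segment R f df 0 x x0 (fun y _ => fd y) fc.
rewrite -subr_ge0 E subr0 mulr_ge0// df0//.
by move: cx; rewrite in_itv /= => /andP[].
Qed.

Lemma expR_ge_quadratic x : 0 <= x -> 1 + x + x ^+ 2 / 2 <= expR x.
Proof.
move=> x0.
have d y : is_derive y 1 (fun y => expR y - 1 - y - y ^+ 2 / 2) (expR y - 1 - y).
  by apply: is_derive_eq; rewrite /GRing.scale /=; field.
have := nondecreasing_from0 x0 d.
rewrite expR0 expr0n /= => h; suff : 0 <= expR x - 1 - x - x ^+ 2 / 2 by lra.
apply: le_trans (h _) => [|y _]; first by lra.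
by have := expR_ge1Dx y; lra.
Qed.

(* The bound [(2 + x) / (2 - x)] is the first Pade approximant of [exp x]. *)
Lemma expR_le_pade x : 0 <= x -> (2 - x) * expR x <= 2 + x.
Proof.
move=> x0.
have d y : is_derive y 1 (fun y => 2 + y - (2 - y) * expR y) (1 - (1 - y) * expR y).
  by apply: is_derive_eq; rewrite /GRing.scale /=; ring.
have := nondecreasing_from0 x0 d.
rewrite expR0 => h; suff : 0 <= 2 + x - (2 - x) * expR x by lra.
apply: le_trans (h _) => [|y _]; first by lra.
have h1 := expR_ge1Dx (- y); have e0 := expR_gt0 y.
have e1 : expR y * expR (- y) = 1 by rewrite -expRD subrr expR0.
by nra.
Qed.

(** With [u = x / 2], the product of [1 + u + u^2/2] and [1 - u + u^2/2] is [1 + u^4/4 > 1]. So the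
    bound [exp u >= 1 + u + u^2/2] gives [exp (- u) < 1 - u + u^2/2], and the difference exceeds
    [2 u]. *)
Lemma gt_sinh x : 0 < x -> x < expR (x / 2) - expR (- (x / 2)).
Proof.
move=> x0; have u0 : 0 <= x / 2 by lra.
have h := expR_ge_quadratic u0; have e0 := expR_gt0 (- (x / 2)).
have e1 : expR (x / 2) * expR (- (x / 2)) = 1 by rewrite -expRD subrr expR0.
move: h e1 e0; set u := x / 2; set e := expR u; set e' := expR (- u).
have -> : x = 2 * u by rewrite /u; field.
have : 0 < u by rewrite /u; lra.
move=> up h e1 e0.
have q0 : 0 < 1 + u + u ^+ 2 / 2 by nra.
have h1 : e' * (1 + u + u ^+ 2 / 2) <= 1 by nra.
have h2 : 1 < (1 + u + u ^+ 2 / 2) * (1 - u + u ^+ 2 / 2).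
  have -> : (1 + u + u ^+ 2 / 2) * (1 - u + u ^+ 2 / 2) = 1 + u ^+ 4 / 4 by field.
  by rewrite ltrDl divr_gt0// exprn_gt0.
have h3 : e' < 1 - u + u ^+ 2 / 2.
  by rewrite -(ltr_pM2r q0); apply: le_lt_trans h1 _; rewrite mulrC.
by lra.
Qed.

Lemma hurwitz_kernel_lt a x : 1 / 2 <= a -> 0 < x -> x * expR ((1 - a) * x) < expR x - 1.
Proof.
move=> a2 x0; have := gt_sinh x0; have e0 := expR_gt0 (x / 2).
have -> : expR x = expR (x / 2) * expR (x / 2) by rewrite -expRD; congr expR; field.
have e1 : expR (x / 2) * expR (- (x / 2)) = 1 by rewrite -expRD subrr expR0.
have h : expR ((1 - a) * x) <= expR (x / 2) by rewrite ler_expR; nra.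
move: e1 e0 h; set e := expR (x / 2); set e' := expR (- _); set f := expR _ => e1 e0 h g.
apply: (@le_lt_trans _ _ (x * e)); first by rewrite ler_pM2l.
have : x * e < (e - e') * e by rewrite ltr_pM2r.
by rewrite mulrBl [e' * e]mulrC e1.
Qed.

Lemma hurwitz_kernel_gt a : 0 < a -> a < 1 / 2 ->
  exists2 x, 0 < x & expR x - 1 < x * expR ((1 - a) * x).
Proof.
move=> a0 a2; exists (1 / 2 - a); first lra.
set x := 1 / 2 - a; have x0 : 0 < x by rewrite /x; lra.
have h := expR_le_pade (ltW x0); have h1 := expR_ge1Dx ((1 - a) * x).
have x2 : 0 < 2 - x by rewrite /x; lra.
rewrite -(ltr_pM2l x2).
apply: (@le_lt_trans _ _ (2 * x)); first by lra.
apply: (@lt_le_trans _ _ ((2 - x) * (x * (1 + (1 - a) * x)))); last first.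
  by rewrite ler_pM2l// ler_pM2l.
have -> : (2 - x) * (x * (1 + (1 - a) * x)) = 2 * x + x ^+ 2 * (x + a * x) by rewrite /x; field.
by rewrite ltrDl mulr_gt0 ?exprn_gt0// addr_gt0// mulr_gt0.
Qed.

Lemma hurwitz_kernel_lt_large a : 0 < a -> a <= 1 ->
  exists2 x, 0 < x & x * expR ((1 - a) * x) < expR x - 1.
Proof.
move=> a0 a1; exists (4 / a ^+ 2); first by rewrite divr_gt0// exprn_gt0.
set x := 4 / a ^+ 2; have x0 : 0 < x by rewrite divr_gt0// exprn_gt0.
have ax0 : 0 <= a * x by rewrite mulr_ge0// ltW.
have h := expR_ge_quadratic ax0.
have E : (a * x) ^+ 2 / 2 = 2 * x by rewrite /x; field; rewrite gt_eqF.
rewrite E in h.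
have -> : expR x = expR ((1 - a) * x) * expR (a * x) by rewrite -expRD; congr expR; ring.
have h1 : 1 <= expR ((1 - a) * x).
  by apply: le_trans (expR_ge1Dx _); rewrite lerDl mulr_ge0 ?subr_ge0 ?(ltW x0).
by nra.
Qed.

Lemma hurwitz_realE a y :
  hurwitz_real a y - expR (- y) =
  expR ((1 - a) * expR y) / (expR (expR y) - 1) - 1 / expR y.
Proof.
rewrite /hurwitz_real (expRN y) div1r; congr (_ - _).
have e1 : expR (expR y) * expR (- expR y) = 1 by rewrite -expRD subrr expR0.
have -> : expR (- (a * expR y)) = expR ((1 - a) * expR y) * expR (- expR y).
  by rewrite -expRD; congr expR; ring.
have e0 := expR_gt0 (expR y).
have : 1 < expR (expR y) by rewrite expR_gt1// expR_gt0.
rewrite (expRN (expR y)) => e2; field.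
by rewrite !gt_eqF// ?subr_gt0.
Qed.

Lemma hurwitz_real_lt0 a y :
  (hurwitz_real a y - expR (- y) < 0) =
  (expR y * expR ((1 - a) * expR y) < expR (expR y) - 1).
Proof.
have e0 := expR_gt0 y.
have e1 : 0 < expR (expR y) - 1 by rewrite subr_gt0 expR_gt1.
by rewrite hurwitz_realE subr_lt0 div1r ltr_pdivrMr// ltr_pdivlMl.
Qed.

Lemma hurwitz_real_gt0 a y :
  (0 < hurwitz_real a y - expR (- y)) =
  (expR (expR y) - 1 < expR y * expR ((1 - a) * expR y)).
Proof.
have e0 := expR_gt0 y.
have e1 : 0 < expR (expR y) - 1 by rewrite subr_gt0 expR_gt1.
by rewrite hurwitz_realE subr_gt0 div1r ltr_pdivlMr// ltr_pdivrMl.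
Qed.

Lemma lerch_ker_real a (r y : R) : r < 1 ->
  lerch_ker a r%:C y = (expR ((1 - a) * expR y) / (expR (expR y) - r))%:C.
Proof.
move=> r1; rewrite /lerch_ker /gamma_ker.
rewrite -[1]/(1%:C) -rmorphM -rmorphB -fmorphV -rmorphM; congr (_%:C).
have -> : expR (- (a * expR y)) = expR ((1 - a) * expR y) * expR (- expR y).
  by rewrite -expRD; congr expR; ring.
have e0 := expR_gt0 (expR y).
have : 1 < expR (expR y) by rewrite expR_gt1// expR_gt0.
rewrite (expRN (expR y)) => e2; field.
by rewrite !gt_eqF// ?subr_gt0//; lra.
Qed.

End KernelSigns.

(** * The cases [z = 1] and [z <> 1] *)

Section Cases.
Variable R : realType.
Local Notation C := R[i].

Section HurwitzCase.
Variables (a : R) (g : C -> C).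
Hypotheses (a0 : 0 < a) (a1 : a <= 1) (hg : is_HLZ a 1 g).

Let kr y := hurwitz_real a y - expR (- y).

Let ckr : continuous kr.
Proof.
have h : continuous (fun y : R => expR (expR y)).
  by move=> y; apply: continuous_comp; exact: continuous_expR.
have -> : kr = (fun y => expR ((1 - a) * expR y) / (expR (expR y) - 1) - 1 / expR y).
  by apply/funext => y; exact: hurwitz_realE.
move=> y; apply: cvgB; apply: cvgM.
- apply: (@continuous_comp _ _ _ (fun y => (1 - a) * expR y) (@expR R)).
    by apply: cvgM; [exact: cvg_cst|exact: continuous_expR].
  exact: continuous_expR.
- apply: cvgV; first by rewrite gt_eqF// subr_gt0 expR_gt1// expR_gt0.
  by apply: cvgB; [exact: h|exact: cvg_cst].
- exact: cvg_cst.
- apply: cvgV; [by rewrite gt_eqF// expR_gt0|exact: continuous_expR].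
Qed.

Section FixedAbscissa.
Variable sigma : R.
Hypothesis sg01 : 0 < sigma < 1.

Let ck : rcont (fun y => (kr y)%:C).
Proof. exact: rcont_real. Qed.

Let ik t : cintegrable (fun y => cexp ((sigma +i* t) * y%:C) * (kr y)%:C).
Proof. by have [] := @Hurwitz_laplace _ a a0 a1 g (sigma +i* t) hg sg01. Qed.

Let fk t : fHLZ g sigma t = laplace (fun y => (kr y)%:C) (sigma +i* t).
Proof. by have [] := @Hurwitz_laplace _ a a0 a1 g (sigma +i* t) hg sg01. Qed.

Lemma Hurwitz_is_charfun : 1 / 2 <= a -> is_charfun (FHLZ g sigma).
Proof.
move=> a2; apply: (is_charfun_FHLZ ck ik fk (fun=> erefl) (c := -1)) => y.
by rewrite mulN1r oppr_gt0 hurwitz_real_lt0 hurwitz_kernel_lt ?expR_gt0.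
Qed.

Lemma Hurwitz_density (P : probability R R) : (forall t, charfun P t = FHLZ g sigma t) ->
  has_density P (P1 sigma a (complex.Re (fHLZ g sigma 0))).
Proof.
move=> /(charfun_tilted ck ik fk)[_ _ _].
congr (has_density P _); apply/funext => y.
rewrite (Re_tilted fk (fun=> erefl)) /P1 /kr hurwitz_realE [y * sigma]mulrC.
by rewrite -!mulrA [X in _ * X]mulrC.
Qed.

(** For [a < 1 / 2] the kernel takes both signs. Since the sign of the normalizing constant [r] is
    unknown, both values are needed: they force [r^-1 >= 0] and [r^-1 <= 0]. *)
Lemma Hurwitz_charfun_ge_half : is_charfun (FHLZ g sigma) -> 1 / 2 <= a.
Proof.
move=> [P /(charfun_tilted ck ik fk)[f0 p0 _ _]]; rewrite leNgt; apply/negP => a2.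
have [x x0 xP] := hurwitz_kernel_gt a0 a2.
have [x' x'0 x'P] := hurwitz_kernel_lt_large a0 a1.
set r := complex.Re (fHLZ g sigma 0) in p0 *.
have rn0 : r != 0.
  apply: contraNneq f0 => r0; have := fHLZ0_real fk (fun=> erefl).
  by rewrite /r in r0 => E; rewrite E in r0 *; rewrite /= in r0; rewrite r0.
have hy y : 0 <= kr y / r.
  have := p0 y; rewrite (Re_tilted fk (fun=> erefl)) -/r -mulrA.
  by rewrite pmulr_rge0 ?expR_gt0.
have k1 : 0 < kr (ln x) by rewrite hurwitz_real_gt0 lnK.
have k2 : kr (ln x') < 0 by rewrite hurwitz_real_lt0 lnK.
have := hy (ln x); rewrite pmulr_rge0// => h1.
have := hy (ln x'); rewrite nmulr_rge0// => h2.
have : r^-1 == 0 by rewrite eq_le h1 h2.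
by rewrite invr_eq0 (negPf rn0).
Qed.

End FixedAbscissa.
End HurwitzCase.

Section LerchCase.
Variables (a : R) (z : C) (g : C -> C).
Hypotheses (a0 : 0 < a) (z1 : cabs z <= 1) (zn1 : z != 1) (hg : is_HLZ a z g).
Variable sigma : R.
Hypothesis sg0 : 0 < sigma.

Let ck : rcont (lerch_ker a z).
Proof. exact: rcont_lerch_ker. Qed.

Let ik t : cintegrable (fun y => cexp ((sigma +i* t) * y%:C) * lerch_ker a z y).
Proof. by apply: (cintegrable_laplace (laplace_dom_lerch0 a0 z1 zn1)). Qed.

Let fk t : fHLZ g sigma t = laplace (lerch_ker a z) (sigma +i* t).
Proof. exact: HLZ_laplace. Qed.

Section RealArgument.
Hypotheses (zI : complex.Im z = 0) (zR : complex.Re z < 1).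

Let kE y : lerch_ker a z y =
  (expR ((1 - a) * expR y) / (expR (expR y) - complex.Re z))%:C.
Proof.
rewrite -lerch_ker_real//; congr lerch_ker.
by apply: complex_ext.
Qed.

Lemma Lerch_is_charfun : is_charfun (FHLZ g sigma).
Proof.
apply: (is_charfun_FHLZ ck ik fk kE (c := 1)) => y.
rewrite mul1r divr_gt0 ?expR_gt0// subr_gt0; apply: lt_trans zR _.
by rewrite expR_gt1 expR_gt0.
Qed.

Lemma Lerch_density (P : probability R R) : (forall t, charfun P t = FHLZ g sigma t) ->
  has_density P (P2 sigma a (complex.Re (fHLZ g sigma 0)) (complex.Re z)).
Proof.
move=> /(charfun_tilted ck ik fk)[_ _ _].
congr (has_density P _); apply/funext => y.
rewrite (Re_tilted fk kE) /P2 [y * sigma]mulrC.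
by rewrite invfM; ring.
Qed.

End RealArgument.

Lemma Lerch_charfun_real : is_charfun (FHLZ g sigma) ->
  complex.Im z = 0 /\ -1 <= complex.Re z < 1.
Proof.
move=> [P /(charfun_tilted ck ik fk)[f0 _ pI _]].
set f := fHLZ g sigma 0 in f0 pI.
pose q (y : R) := expR (- expR y).
(* The density at [y] is a positive factor times the inverse of [f * (1 - z * q y)]; its reality
   makes this product real. *)
have qP y : complex.Im f = complex.Im (f * z) * q y.
  have : complex.Im (f * (1 - z * (q y)%:C))^-1 = 0.
    have := pI y; rewrite /tilted -/f /lerch_ker /gamma_ker.
    set A := cexp _; set w := 1 - _.
    have -> : f^-1 * (A * ((expR (- (a * expR y)))%:C * w^-1)) =
        (expR (sigma * y) * expR (- (a * expR y)))%:C * (f * w)^-1.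
      have -> : A = (expR (sigma * y))%:C.
        apply: complex_ext.
          by rewrite Re_cexp_real /= mul0r cos0 mulr1.
        by rewrite Im_cexp_real /= mul0r sin0 mulr0.
      by rewrite (rmorphM (real_complex R)) (invfM f w); ring.
    rewrite ImM /= mul0r addr0 => /eqP; rewrite mulf_eq0 => /orP[|/eqP//].
    by rewrite gt_eqF// mulr_gt0// expR_gt0.
  set w := f * _ => wI; have : complex.Im w = 0.
    have wE : w = (complex.Re w^-1)^-1%:C.
      by rewrite fmorphV -[LHS]invrK; congr (_^-1); apply: complex_ext.
    by rewrite wE.
  by rewrite /w mulrBr mulr1 mulrA ImD ImN [in X in _ - X]ImM /= mulr0 add0r => /eqP;
    rewrite subr_eq0 => /eqP.
(* Two distinct values of [q] force both [Im (f * z)] and [Im f] to vanish; as [f] is real and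
   nonzero, [z] is real. *)
have q01 : q 0 != q 1.
  by rewrite /q (inj_eq (@expR_inj R)) eqr_opp (inj_eq (@expR_inj R)) lt_eqF.
have fz0 : complex.Im (f * z) = 0.
  apply/eqP; move/eqP: (etrans (esym (qP 0)) (qP 1)).
  by rewrite -subr_eq0 -mulrBr mulf_eq0 subr_eq0 (negPf q01) orbF.
have fI : complex.Im f = 0 by rewrite (qP 0) fz0 mul0r.
have zI : complex.Im z = 0.
  move: fz0; rewrite ImM fI mul0r addr0 => /eqP; rewrite mulf_eq0 => /orP[/eqP fR|/eqP//].
  by case/eqP: f0; apply: complex_ext.
split => //; have := le_trans (ler_Re_cabs z) z1; rewrite ler_norml => /andP[-> h].
rewrite lt_neqAle h andbT; apply: contraNneq zn1 => zR.
by apply/eqP; apply: complex_ext; rewrite ?zR ?zI.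
Qed.

End LerchCase.
End Cases.

Theorem theorem2p2 (R : realType) (a : R) (z : R[i]) (g : R[i] -> R[i]) :
  0 < a <= 1 -> 0 < cabs z <= 1 -> is_HLZ a z g ->
  (* (1) z = 1 *)
  (z = 1 ->
     ((forall sigma : R, 0 < sigma < 1 -> is_charfun (FHLZ g sigma)) <-> 1 / 2 <= a) /\
     (1 / 2 <= a -> forall sigma : R, 0 < sigma < 1 ->
        forall mu : probability R R, (forall t, charfun mu t = FHLZ g sigma t) ->
          has_density mu (P1 sigma a (complex.Re (fHLZ g sigma 0))))) /\
  (* (2) z <> 1 *)
  (z <> 1 ->
     ((forall sigma : R, 0 < sigma -> is_charfun (FHLZ g sigma)) <->
        (complex.Im z = 0 /\ -1 <= complex.Re z < 1)) /\
     (complex.Im z = 0 -> -1 <= complex.Re z < 1 -> forall sigma : R, 0 < sigma ->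
        forall mu : probability R R, (forall t, charfun mu t = FHLZ g sigma t) ->
          has_density mu (P2 sigma a (complex.Re (fHLZ g sigma 0)) (complex.Re z)))).
Proof.
move=> /andP[a0 a1] /andP[_ z1] hg; split => [zE|/eqP zn1].
  subst z; split=> [|_ sigma sg P]; last exact: Hurwitz_density.
  split=> [h|a2 sigma sg]; last exact: (Hurwitz_is_charfun a0 a1 hg).
  (* Necessity uses a single abscissa: [1 / 2] here, and [1] when [z <> 1]. *)
  have half : 0 < 1 / 2 :> R by lra.
  by apply: (@Hurwitz_charfun_ge_half R a g a0 a1 hg (1 / 2)); [|apply: h]; lra.
split=> [|zI /andP[_ zR] sigma sg P]; last exact: Lerch_density.
split=> [h|[zI /andP[_ zR]] sigma sg]; last exact: (Lerch_is_charfun a0 z1 zn1 hg).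
exact: (Lerch_charfun_real a0 z1 zn1 hg ltr01 (h 1 ltr01)).
Qed.
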